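(* Let $n \geq 12$ and $b_{\mathrm{max}} = \frac{1}{4n}$. For each $0 < b \leq b_{\mathrm{max}}$, the cone $\mathcal{C}(b)$ is transversally invariant under the Hamilton ODE $\frac{d}{dt} R = Q(R)$.
   Context: An algebraic curvature tensor on $\mathbb{R}^n$ is a four-linear form $R_{ijkl}$ with $R_{ijkl}=-R_{jikl}=-R_{ijlk}=R_{klij}$ and the first Bianchi identity ($R_{1212}$ is the sectional curvature of the plane spanned by orthonormal $e_1,e_2$); $\mathrm{Ric}(R)_{ik}=\sum_p R_{ipkp}$, $\mathrm{scal}(R)=\sum_i \mathrm{Ric}(R)_{ii}$. Kulkarni-Nomizu product: $(A \odot B)_{ijkl} = A_{ik} B_{jl} - A_{il} B_{jk} - A_{jk} B_{il} + A_{jl} B_{ik}$. $Q(R)=R^2+R^\#$, where $(R^2)_{ijkl} = \sum_{p,q} R_{ijpq} R_{klpq}$ and $(R^\#)_{ijkl} = 2 \sum_{p,q} (R_{ipkq} R_{jplq} - R_{iplq} R_{jpkq})$. For real $a,b$ and an algebraic curvature tensor $S$, $\ell_{a,b}(S) = S + b \, \mathrm{Ric}(S) \odot \mathrm{id} + \frac{1}{n} (a-b) \, \mathrm{scal}(S) \, \mathrm{id} \odot \mathrm{id}$. For tensors $T$ having all algebraic properties of a curvature tensor except possibly the first Bianchi identity (i.e. $T_{ijkl}=-T_{jikl}=-T_{ijlk}=T_{klij}$): $T\ge 0$ means $T(\varphi,\bar\varphi)\ge0$ for every complex two-form $\varphi$; $T\in\mathrm{PIC}$ means $T_{1313}+T_{1414}+T_{2323}+T_{2424}+2T_{1342}+2T_{1423}\ge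 0$ for every orthonormal four-frame $\{e_1,e_2,e_3,e_4\}$. For $0<b\le b_{\mathrm{max}}=\frac1{4n}$ put $a = \frac{(2+(n-2)b)^2}{2(2+(n-3)b)} b$, $\gamma = \frac{b}{2+(n-3)b}$, and $\omega>0$ with $\omega^2 = \frac{27(2+(n-2)b)}{8} \cdot \frac{(1-4(n-2)b^2)^4(1+(n-2)b)^2}{n^2b^2(2+(n-3)b)^2}$. $\mathcal{E}(b)$ is the set of all algebraic curvature tensors $S$ for which there exists a tensor $T$ such that: (i) $T$ satisfies all the algebraic properties of a curvature tensor except for the first Bianchi identity, and $T\ge0$; (ii) $S-T\in\mathrm{PIC}$; (iii) $\mathrm{Ric}(S)_{11}+\mathrm{Ric}(S)_{22}+\frac{2\gamma}{n}\mathrm{scal}(S)\ge0$ for every orthonormal pair $\{e_1,e_2\}$; (iv) for every orthonormal frame $\{e_1,\dots,e_n\}$, $\mathrm{Ric}(S)_{22}-\mathrm{Ric}(S)_{11} \leq \omega^{1/2} \mathrm{scal}(S)^{1/2} \big( \sum_{p=3}^n (T_{1p1p}+T_{2p2p}) \big)^{1/2} + 2(n-2)b \sum_{p=3}^n (T_{1p1p}+T_{2p2p})$. Finally $\mathcal{C}(b)=\ell_{a,b}(\mathcal{E}(b))$; this is a convex cone. A convex cone $\mathcal{C}$ is transversally invariant under $\frac{d}{dt}R=Q(R)$ if for every $R\in\mathcal{C}\setminus\{0\}$, $Q(R)$ lies in the interior of the tangent cone $T_R\mathcal{C}$. *)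

(* Defs.v *)
From mathcomp Require Import all_boot all_order all_algebra.
From mathcomp Require Import all_classical all_reals all_analysis.
From mathcomp Require Import complex.

Set Implicit Arguments.
Unset Strict Implicit.
Unset Printing Implicit Defensive.

Import Order.TTheory GRing.Theory Num.Theory.
Import numFieldNormedType.Exports.

Local Open Scope classical_set_scope.
Local Open Scope ring_scope.

(* Four-tensors on R^n are stored as square matrices indexed by pairs of       *)
(* indices: this type carries a canonical normed space structure. The entry    *)
(* T_{ijkl} is [tcoef T i j k l].                                              *)
Notation tensor R n := 'M[R]_#|{: 'I_n * 'I_n}|.

Section Tensors.
Variables (R : realType) (n : nat).
Implicit Types (S T : tensor R n) (A B : 'M[R]_n) (u v w z : 'rV[R]_n).

Definition tcoef T (i j k l : 'I_n) : R := T (enum_rank (i, j)) (enum_rank (k, l)).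

Definition tensor_of (f : 'I_n -> 'I_n -> 'I_n -> 'I_n -> R) : tensor R n :=
  \matrix_(x, y) f (enum_val x).1 (enum_val x).2 (enum_val y).1 (enum_val y).2.

Lemma tensor_ofE f i j k l : tcoef (tensor_of f) i j k l = f i j k l.
Proof. by rewrite /tcoef /tensor_of mxE !enum_rankK. Qed.

Lemma tensorP S T :
  (forall i j k l, tcoef S i j k l = tcoef T i j k l) -> S = T.
Proof.
move=> eqST; apply/matrixP => x y.
rewrite -[x]enum_valK -[y]enum_valK.
by case: (enum_val x) (enum_val y) => i j [k l]; apply: eqST.
Qed.

Definition teval T u v w z : R :=
  \sum_i \sum_j \sum_k \sum_l
    tcoef T i j k l * u 0 i * v 0 j * w 0 k * z 0 l.

Definition beval A u v : R := \sum_i \sum_j A i j * u 0 i * v 0 j.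

Definition dot u v : R := \sum_i u 0 i * v 0 i.

Definition orthonormal (s : seq 'rV[R]_n) : Prop :=
  forall i j : nat, (i < size s)%N -> (j < size s)%N ->
    dot s`_i s`_j = (i == j)%:R.

(* All the algebraic properties of a curvature tensor except possibly the      *)
(* first Bianchi identity.                                                     *)
Definition curvature_symmetries T : Prop :=
  forall i j k l,
    [/\ tcoef T i j k l = - tcoef T j i k l,
        tcoef T i j k l = - tcoef T i j l k &
        tcoef T i j k l = tcoef T k l i j].

Definition bianchi T : Prop :=
  forall i j k l, tcoef T i j k l + tcoef T j k i l + tcoef T k i j l = 0.

Definition curvature_tensor : set (tensor R n) :=
  [set T | curvature_symmetries T /\ bianchi T].

Definition Ric T : 'M[R]_n := \matrix_(i, k) \sum_p tcoef T i p k p.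

Definition scal T : R := \sum_i Ric T i i.

Definition kulkarni_nomizu A B : tensor R n :=
  tensor_of (fun i j k l =>
    A i k * B j l - A i l * B j k - A j k * B i l + A j l * B i k).

Definition tensor_square T : tensor R n :=
  tensor_of (fun i j k l =>
    \sum_p \sum_q tcoef T i j p q * tcoef T k l p q).

Definition tensor_sharp T : tensor R n :=
  tensor_of (fun i j k l =>
    2 * \sum_p \sum_q (tcoef T i p k q * tcoef T j p l q
                       - tcoef T i p l q * tcoef T j p k q)).

Definition hamiltonQ T : tensor R n := tensor_square T + tensor_sharp T.

Definition ell (a b : R) S : tensor R n :=
  S + b *: kulkarni_nomizu (Ric S) 1%:M
    + (n%:R^-1 * (a - b) * scal S) *: kulkarni_nomizu 1%:M 1%:M.

(* A complex two-form is an antisymmetric complex matrix. The order on R[i]    *)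
(* is the partial one: [0 <= x] means that x is real and nonnegative.          *)
Definition tensor_nonneg T : Prop :=
  forall phi : 'M[R[i]]_n, (forall i j, phi i j = - phi j i) ->
    0 <= \sum_i \sum_j \sum_k \sum_l
           real_complex R (tcoef T i j k l) * phi i j * Num.conj (phi k l).

Definition PIC T : Prop :=
  forall e1 e2 e3 e4 : 'rV[R]_n, orthonormal [:: e1; e2; e3; e4] ->
    0 <= teval T e1 e3 e1 e3 + teval T e1 e4 e1 e4
       + teval T e2 e3 e2 e3 + teval T e2 e4 e2 e4
       + 2 * teval T e1 e3 e4 e2 + 2 * teval T e1 e4 e2 e3.

End Tensors.

Section Cones.
Variables (R : realType) (n : nat).
Implicit Types b : R.

Local Notation N := (n%:R : R).

Definition b_max : R := (4 * N)^-1.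

Definition a_of b : R :=
  (2 + (N - 2) * b) ^+ 2 / (2 * (2 + (N - 3) * b)) * b.

Definition gamma_of b : R := b / (2 + (N - 3) * b).

Definition omega_of b : R :=
  Num.sqrt (27 * (2 + (N - 2) * b) / 8
    * ((1 - 4 * (N - 2) * b ^+ 2) ^+ 4 * (1 + (N - 2) * b) ^+ 2
       / (N ^+ 2 * b ^+ 2 * (2 + (N - 3) * b) ^+ 2))).

Definition Econe b : set (tensor R n) :=
  [set S | curvature_tensor S /\ exists T : tensor R n,
    [/\ curvature_symmetries T /\ tensor_nonneg T,
        PIC (S - T),
        forall e1 e2 : 'rV[R]_n, orthonormal [:: e1; e2] ->
          0 <= beval (Ric S) e1 e1 + beval (Ric S) e2 e2
             + 2 * gamma_of b / N * scal S
      & forall (e1 e2 : 'rV[R]_n) (f : seq 'rV[R]_n),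
          size [:: e1, e2 & f] = n -> orthonormal [:: e1, e2 & f] ->
          let sigma := \sum_(p <- f) (teval T e1 p e1 p + teval T e2 p e2 p) in
          beval (Ric S) e2 e2 - beval (Ric S) e1 e1
            <= Num.sqrt (omega_of b) * Num.sqrt (scal S) * Num.sqrt sigma
             + 2 * (N - 2) * b * sigma]].

Definition Ccone b : set (tensor R n) := ell (a_of b) b @` Econe b.

End Cones.

Section Transversality.
Variables (R : realType) (V : normedModType R).

(* For convex C, the tangent cone at x is the closure of the cone spanned by   *)
(* the differences y - x with y in C.                                          *)
Definition tangent_cone (C : set V) (x : V) : set V :=
  closure [set v | exists t y, [/\ 0 <= t, C y & v = t *: (y - x)]].

Definition relative_interior (E B : set V) : set V :=
  [set x | E x /\ within E (nbhs x) B].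

(* Interiors are taken in the subspace E in which the cone C lives.            *)
Definition transversally_invariant (E C : set V) (Q : V -> V) : Prop :=
  forall x, C x -> x <> 0 -> relative_interior E (tangent_cone C x) (Q x).

End Transversality.

(* Main.v *)
Require Import Defs.
From HB Require Import structures.
From mathcomp Require Import all_boot all_order all_algebra.
From mathcomp Require Import all_classical all_reals all_analysis complex.
From mathcomp Require Import zify ring lra.
Require Import Defs.

Set Implicit Arguments.
Unset Strict Implicit.
Unset Printing Implicit Defensive.

Import Order.TTheory GRing.Theory Num.Theory.
Import numFieldNormedType.Exports.

Local Open Scope ring_scope.

(* Idea. Writing ell for the map defining C(b), one has Q(ell S) = ell (Q S + D S) with
   D S depending only on Ric S ([hamiltonQ_ell]). It therefore suffices to move the pairs
   (S, T) defining E(b) in the direction S' = Q S + D S, T' = S^2 + T^# + eps id (.) id.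
   Conditions (i)-(iv) are compact families of inequalities which are linear in (S, T), once
   the square roots in (iv) are dualized by a parameter t in [0, 1]. By compactness it is
   enough that each functional vanishing at (S, T) is positive at (S', T').
   (i) T^# is nonnegative if T is.
   (ii) If U = S - T is PIC, the second variation of U over isotropic planes shows that
   (U + T)^# - T^# is nonnegative at the frames where U vanishes, and by (iii) the tensor
   D S - eps id (.) id is positive there.
   (iii) At a minimum one may diagonalize Ric S; the pinching condition (iv) enters through
   the perfect square (x - 2z/3)^2 (x + z/3), whence the constant in omega^2.
   (iv) Equality gives equality in the arithmetic-geometric mean inequality. The trace of the
   matrix S_{2p2q} - S_{1p1q} is absorbed by its square in S^2, the mixed terms by the
   remaining components of S^2 and by |Ric0|^2 in scal(S'). *)

(** * The parameters *)

(** Why [T] moves along S^2 + T^# + eps id (.) id: S^2 is nonnegative and cancels from S' - T', so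
    that (ii) compares S^# with T^# only, while in (iv) it makes the right side grow. The multiple
    of id (.) id makes T' strictly positive where [T] vanishes; its cost 8 eps in (ii) is paid by
    the strict positivity of D S, which decides the size of eps. The obstacle in (ii) is that a
    curve of isotropic planes needs second-order corrections, and these enter the second variation.
    The curve is therefore given a complex parameter c, and averaging over c = t, -t, it, -it
    removes them. The values of a and gamma make D S at a PIC frame a sum of nonnegative terms, one
    of them the determinant inequality that (iii) implies for isotropic vectors. The same values
    make the terms in scal^2 collapse in (iii). In (iv) the multipliers are the partial derivatives
    of sqrt(omega scal sigma) in sigma and scal. Only S' varies in a neighbourhood, T' stays fixed.
    Compactness gives a step that is uniform in S', which is what places Q in the interior of the
    tangent cone. *)

Section ParamBounds.
Variable R : rcfType.
Variables N b : R.
Hypothesis hN : 12 <= N.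
Hypothesis hb : 0 < b.
Hypothesis hNb : 4 * (N * b) <= 1.

Local Notation L := (2 + (N - 3) * b).
Local Notation M := (2 + (N - 2) * b).
Local Notation gam := (b / L).
Local Notation a := (M ^+ 2 / (2 * L) * b).
Local Notation q := (1 - 4 * (N - 2) * b ^+ 2).
Local Notation om2 := (27 * M / 8 * (q ^+ 4 * (1 + (N - 2) * b) ^+ 2 / (N ^+ 2 * b ^+ 2 * L ^+ 2))).

Local Ltac hyps := have HN := hN; have Hb := hb; have HNb := hNb.

(* The coefficient of [|Ric0|^2 id (.) id] in [ellD], forced by [hamiltonQ_ell]. *)
Definition kappa_param (N b a : R) :=
  (N * b ^+ 2 * (1 - 2 * b) - 2 * (a - b) * (1 - 2 * b + N * b ^+ 2))
    / (N * (1 + 2 * (N - 1) * a)).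

Lemma param_b_le : 48 * b <= 1. Proof. hyps; nra. Qed.
Lemma param_Nb_gt : 0 < N * b. Proof. hyps; nra. Qed.

Lemma param_L_gt2 : 2 < L. Proof. hyps; nra. Qed.
Lemma param_L_neq0 : L != 0. Proof. hyps; by rewrite gt_eqF //; have := param_L_gt2; lra. Qed.

Lemma param_gamma_gt0 : 0 < gam.
Proof. hyps; by rewrite divr_gt0 //; have := param_L_gt2; lra. Qed.

Lemma param_gamma_le : 2 * gam <= b.
Proof.
hyps.
have L2 := param_L_gt2; rewrite mulrA ler_pdivrMr ?(lt_trans _ L2) //; nra.
Qed.

Lemma param_gammaD1 : 1 + gam = M / L.
Proof. hyps; by have L0 := param_L_neq0; field. Qed.

Lemma param_a_gt0 : 0 < a.
Proof.
hyps.
have L2 := param_L_gt2; rewrite mulr_gt0 // divr_gt0 ?mulr_gt0 ?exprn_gt0 //; nra.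
Qed.

Lemma param_aE : 2 * a = M ^+ 2 * gam.
Proof. hyps; by have L0 := param_L_neq0; field. Qed.

Lemma param_aBb : 2 * (a - b) = b ^+ 2 * (N - 1 + gam).
Proof. hyps; by have L0 := param_L_neq0; field. Qed.

(** By [param_aBb] the numerator is b^2 times (1 - gam)(1 - 2b) - N b^2 (N - 1 + gam). The first
    product is close to 1, the second term is about (N b)^2 <= 1/16. *)
Lemma param_kappa_gt0 : 0 < kappa_param N b a.
Proof.
hyps.
have g0 := param_gamma_gt0; have gb := param_gamma_le; have a0 := param_a_gt0.
have b48 := param_b_le; have Nb0 := param_Nb_gt.
rewrite /kappa_param divr_gt0 //; last by rewrite mulr_gt0 //; nra.
rewrite (_ : N * b ^+ 2 * (1 - 2 * b) - _ = b ^+ 2 * ((1 - gam) * (1 - 2 * b) - N * b ^+ 2 * (N - 1 + gam))).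
  rewrite mulr_gt0 ?exprn_gt0 //.
  move: gam g0 gb => g g0 gb.
  have : (N * b) * (N * b) <= 1 / 16 by nra.
  have bg : b * g <= 1 / 48 by nra.
  have : N * b ^+ 2 * g <= 1 / 16.
    rewrite (_ : _ * g = (N * b) * (b * g)); last by ring.
    have : 0 <= b * g by nra.
    nra.
  have : 0 <= N * b ^+ 2 by nra.
  nra.
by rewrite param_aBb; ring.
Qed.

Lemma param_q_gt : 11 / 12 < q. Proof. hyps; nra. Qed.

Lemma param_om2_ge0 : 0 <= om2.
Proof.
hyps.
have L2 := param_L_gt2; rewrite mulr_ge0 ?divr_ge0 ?mulr_ge0 ?exprn_ge0 //; nra.
Qed.

(** Since L <= 2 + y, replacing (2 + y) / L^2 by 1 / (2 + y) removes L and leaves a bound in y, q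
    and N b. *)
Lemma param_om2_ge (y := (N - 2) * b) :
  27 / 8 * q ^+ 4 * (1 + y) ^+ 2 / ((2 + y) * (N * b) ^+ 2) <= om2.
Proof.
hyps.
have L2 := param_L_gt2; have Nb0 := param_Nb_gt; have q0 := param_q_gt.
have b0 := hb; have y0 : 0 < y by rewrite /y; nra.
have LM : L <= 2 + y by rewrite /y; nra.
have e1 : 27 / 8 * q ^+ 4 * (1 + y) ^+ 2 / ((2 + y) * (N * b) ^+ 2) =
  (27 / 8 * q ^+ 4 * (1 + y) ^+ 2 / (N * b) ^+ 2) * (2 + y)^-1.
  field; do ?[apply/andP; split]; rewrite ?gt_eqF //; nra.
have e2 : om2 = (27 / 8 * q ^+ 4 * (1 + y) ^+ 2 / (N * b) ^+ 2) * ((2 + y) / L ^+ 2).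
  rewrite /y; field; do ?[apply/andP; split]; rewrite ?gt_eqF //; nra.
rewrite e1 e2 ler_wpM2l //.
  apply: divr_ge0 (sqr_ge0 _); apply: mulr_ge0 (sqr_ge0 _); apply: mulr_ge0; first lra.
  by apply: exprn_ge0; lra.
rewrite ler_pdivlMr ?exprn_gt0 //; last lra.
rewrite mulrC ler_pdivrMr; last lra.
by rewrite -expr2; nra.
Qed.

Lemma param_om2_ge24 : (24 / 5) ^+ 2 <= om2.
Proof.
hyps.
apply: le_trans param_om2_ge.
have Nb0 := param_Nb_gt; have q0 := param_q_gt; have b0 := hb.
set y := (N - 2) * b.
have y0 : 0 < y by rewrite /y; nra.
have yN : 4 * y <= 1 by rewrite /y; nra.
have q4 : 11 / 12 <= q ^+ 4.
  have : q = 1 - 4 * y * b by rewrite /y; ring.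
  have : 4 * y * b <= 1 / 48 by have := param_b_le; nra.
  have : 0 < 4 * y * b by nra.
  move: (4 * y * b) => z z0 z1 ->.
  have z2 : 1 - 2 * z <= (1 - z) ^+ 2 by nra.
  rewrite (_ : (1 - z) ^+ 4 = ((1 - z) ^+ 2) ^+ 2); last by rewrite -exprM.
  move: ((1 - z) ^+ 2) z2 => w w2.
  have : 0 <= (w - (1 - 2 * z)) * (w + (1 - 2 * z)) by rewrite mulr_ge0 //; lra.
  nra.
rewrite ler_pdivlMr; last by rewrite mulr_gt0 ?exprn_gt0 //; lra.
have x2 : (N * b) ^+ 2 <= 1 / 16 by nra.
have : (2 + y) * (N * b) ^+ 2 <= (2 + y) / 16 by nra.
have : 27 / 8 * (11 / 12) * (1 + y) ^+ 2 <= 27 / 8 * q ^+ 4 * (1 + y) ^+ 2 by nra.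
nra.
Qed.

(** The value 41/16 = 1 + 1 + (9/4)(1/4) is the limit of the left side for N to infinity with N b =
    1/4, where 2 a (N - 3) tends to (2 + y) y with y = 1/4. The coefficient 148/16 covers all terms
    of order t = 1/N for 12 t <= 1. *)
Lemma param_Cbound :
  1 + N / (N - 3) + 2 * a * (N - 3) + (4 / (N - 2) + 8 * b) * (1 + gam)
  <= (41 + 148 / N) / 16.
Proof.
hyps.
have g0 := param_gamma_gt0; have gb := param_gamma_le; have b0 := hb.
rewrite param_aE.
pose t := N^-1.
have N0 : 0 < N by have := hN; lra.
have Nt : N * t = 1 by rewrite /t mulfV ?gt_eqF.
have t0 : 0 < t by rewrite invr_gt0.
have t1 : 12 * t <= 1 by have := hN; nra.
have bt : 4 * b <= t by nra.
have -> : N / (N - 3) = 1 / (1 - 3 * t).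
  have -> : N - 3 = N * (1 - 3 * t) by rewrite mulrBr mulrCA Nt; ring.
  field; rewrite !gt_eqF //; lra.
have -> : 4 / (N - 2) = 4 * t / (1 - 2 * t).
  have -> : N - 2 = N * (1 - 2 * t) by rewrite mulrBr mulrCA Nt; ring.
  by rewrite /t; field; rewrite !gt_eqF // -/t; lra.
have -> : (41 + 148 / N) / 16 = (41 + 148 * t) / 16 by [].
have -> : M ^+ 2 * gam * (N - 3) = M * (1 + gam) * ((N - 3) * b).
  by rewrite param_gammaD1; have L0 := param_L_neq0; field.
have i3 : 1 / (1 - 3 * t) <= 1 + 4 * t by rewrite ler_pdivrMr; nra.
have i2 : 4 * t / (1 - 2 * t) <= 4 * t * (1 + 12 / 5 * t).
  rewrite ler_pdivrMr; last lra.
  nra.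
have y1 : 0 <= (N - 2) * b <= 1 / 4 - t / 2.
  apply/andP; split; nra.
have z1 : 0 <= (N - 3) * b <= 1 / 4 - 3 * t / 4.
  apply/andP; split; nra.
have g1 : 1 + gam <= 1 + t / 8 by lra.
have g2 : 1 <= 1 + gam by lra.
move: (1 + gam) g1 g2 => g g1 g2.
move: y1 z1; move: ((N - 2) * b) ((N - 3) * b) => y z /andP[y0 y1] /andP[z0 z1].
have h1 : (2 + y) * z <= (9 / 4 - t / 2) * (1 / 4 - 3 * t / 4) by nra.
have h2 : (2 + y) * g * z <= (9 / 4 - t / 2) * (1 / 4 - 3 * t / 4) * (1 + t / 8).
  rewrite -mulrA [g * z]mulrC mulrA; nra.
have h3 : (4 * t / (1 - 2 * t) + 8 * b) * g <= (4 * t * (1 + 12 / 5 * t) + 2 * t) * (1 + t / 8).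
  have : 0 <= 4 * t / (1 - 2 * t) by rewrite divr_ge0 //; lra.
  nra.
nra.
Qed.

Lemma param_om2_gtC :
  ((41 + 148 / N) / 16) ^+ 2 < om2 * (N / (2 * (N - 2))) ^+ 2.
Proof.
hyps.
have N0 : 0 < N by have := hN; lra.
have b0 := hb; have Nb0 := param_Nb_gt; have q0 := param_q_gt.
have N2 : 0 < N - 2 by have := hN; lra.
apply: (@lt_le_trans _ _ (27 / 32 * q ^+ 4 * (1 + (N - 2) * b) ^+ 2 / ((2 + (N - 2) * b) * ((N - 2) * b) ^+ 2))); last first.
  apply: le_trans (ler_wpM2r _ param_om2_ge); last by rewrite exprn_ge0 // divr_ge0 //; lra.
  rewrite le_eqVlt; apply/orP; left; apply/eqP; field.
  by rewrite !gt_eqF //; nra.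
pose t := N^-1.
have Nt : N * t = 1 by rewrite /t mulfV ?gt_eqF.
have t0 : 0 < t by rewrite invr_gt0.
have t1 : 12 * t <= 1 by have := hN; nra.
have bt : 4 * b <= t by nra.
have -> : (41 + 148 / N) / 16 = (41 + 148 * t) / 16 by [].
have y1 : 4 * ((N - 2) * b) <= 1 - 2 * t by nra.
have y0 : 0 < (N - 2) * b by nra.
have q4 : 1 - t <= q ^+ 4.
  have -> : q = 1 - 4 * ((N - 2) * b) * b by ring.
  move: ((N - 2) * b) y0 y1 => y y0 y1.
  have : 4 * y * b <= t / 4 by nra.
  have : 0 < 4 * y * b by nra.
  move: (4 * y * b) => z z0 z1.
  by rewrite -[4%N]/(2 * 2)%N exprM; nra.
move: (q ^+ 4) q4 ((N - 2) * b) y0 y1 => Q Q1 y y0 y1.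
(* The claim at the extreme value y = (1 - 2t)/4, that is N b = 1/4. Its margin relies on 12 t <= 1
   through [v1]. *)
have key : (41 + 148 * t) ^+ 2 * ((9 - 2 * t) * (1 - 2 * t) ^+ 2) <
    27 * 8 * (1 - t) * (4 * (5 - 2 * t) ^+ 2).
  have v1 : (41 + 148 * t) * (1 - 2 * t) <= 89 / 2 by nra.
  have v0 : 0 <= (41 + 148 * t) * (1 - 2 * t) by nra.
  have v2 : ((41 + 148 * t) * (1 - 2 * t)) ^+ 2 <= (89 / 2) ^+ 2 by rewrite ler_pXn2r // nnegrE; lra.
  have w1 : 85 / 4 <= (1 - t) * (5 - 2 * t) ^+ 2 by nra.
  have -> : (41 + 148 * t) ^+ 2 * ((9 - 2 * t) * (1 - 2 * t) ^+ 2) = ((41 + 148 * t) * (1 - 2 * t)) ^+ 2 * (9 - 2 * t) by ring.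
  have -> : 27 * 8 * (1 - t) * (4 * (5 - 2 * t) ^+ 2) = 9 * (3 * 8 * 4 * ((1 - t) * (5 - 2 * t) ^+ 2)) by ring.
  have v3 : ((41 + 148 * t) * (1 - 2 * t)) ^+ 2 * (9 - 2 * t) <= (89 / 2) ^+ 2 * 9.
    apply: ler_pM => //; [exact: sqr_ge0|lra|lra].
  apply: le_lt_trans v3 _; rewrite mulrC ltr_pM2l; lra.
rewrite ltr_pdivlMr; last by rewrite mulr_gt0 ?exprn_gt0 //; lra.
(* The quotient (2 + y) y^2 / (1 + y)^2 is compared with its value at y = (1 - 2t)/4, which is (9 -
   2t)(1 - 2t)^2 / (4 (5 - 2t)^2). *)
have h1 : (2 + y) * y ^+ 2 * (4 * (5 - 2 * t) ^+ 2) <= (1 + y) ^+ 2 * ((9 - 2 * t) * (1 - 2 * t) ^+ 2).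
  have -> : (2 + y) * y ^+ 2 * (4 * (5 - 2 * t) ^+ 2) = (4 * (2 + y)) * (y * (5 - 2 * t)) ^+ 2 by ring.
  have -> : (1 + y) ^+ 2 * ((9 - 2 * t) * (1 - 2 * t) ^+ 2) = (9 - 2 * t) * ((1 + y) * (1 - 2 * t)) ^+ 2 by ring.
  apply: ler_pM; [lra|exact: sqr_ge0|lra|].
  by rewrite ler_pXn2r // ?nnegrE; nra.
have E0 : 0 < 4 * (5 - 2 * t) ^+ 2 by rewrite mulr_gt0 ?exprn_gt0 //; lra.
have B0 : 0 < (1 + y) ^+ 2 by rewrite exprn_gt0 //; lra.
rewrite -(ltr_pM2r E0).
move: key h1 E0 B0.
move: ((9 - 2 * t) * (1 - 2 * t) ^+ 2) (4 * (5 - 2 * t) ^+ 2) ((2 + y) * y ^+ 2) ((1 + y) ^+ 2) => F E A B key h1 E0 B0.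
have -> : ((41 + 148 * t) / 16) ^+ 2 * A * E = (41 + 148 * t) ^+ 2 / (16 * 16) * (A * E) by field.
apply: (@le_lt_trans _ _ ((41 + 148 * t) ^+ 2 / (16 * 16) * (B * F))).
  by rewrite ler_wpM2l // divr_ge0 ?exprn_ge0 //; lra.
apply: (@lt_le_trans _ _ (27 / 32 * (1 - t) * B * E)).
  have -> : (41 + 148 * t) ^+ 2 / (16 * 16) * (B * F) = B / (16 * 16) * ((41 + 148 * t) ^+ 2 * F) by field.
  have -> : 27 / 32 * (1 - t) * B * E = B / (16 * 16) * (27 * 8 * (1 - t) * E) by field.
  by rewrite ltr_pM2l // divr_gt0 //; lra.
by rewrite ler_pM2r // ler_pM2r // ler_pM2l //; lra.
Qed.

Lemma param_om_gtC (om : R) : 0 <= om -> om ^+ 2 = om2 ->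
  1 + N / (N - 3) + 2 * a * (N - 3) + (4 / (N - 2) + 8 * b) * (1 + gam)
  < om * N / (2 * (N - 2)).
Proof.
hyps; move=> om0 omE; apply: le_lt_trans param_Cbound _.
have N0 : 0 < N by lra.
have Nn : 0 <= om * N / (2 * (N - 2)) by rewrite divr_ge0 ?mulr_ge0 //; lra.
rewrite -(@ltr_pXn2r _ 2) ?nnegrE //; last first.
  by rewrite divr_ge0 // addr_ge0 // divr_ge0 //; lra.
rewrite -[om * N / _]mulrA [X in _ < X]exprMn omE; exact: param_om2_gtC.
Qed.

Lemma param_om_ge (om : R) : 0 <= om -> om ^+ 2 = om2 -> 24 / 5 <= om.
Proof.
hyps; move=> om0 omE; have p : 0 <= 24 / 5 :> R by lra.
by rewrite -(@ler_pXn2r _ 2) ?nnegrE // omE param_om2_ge24.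
Qed.

End ParamBounds.

(** * Curvature tensors and the reaction term Q *)

Section DeltaSums.
Variables (R : pzRingType) (I : finType).

Lemma sum_delta_r (i : I) (F : I -> R) : \sum_p F p * (p == i)%:R = F i.
Proof.
rewrite (bigD1 i) //= eqxx mulr1 big1 ?addr0 // => p /negbTE ->.
by rewrite mulr0.
Qed.

Lemma sum_delta_r' (i : I) (F : I -> R) : \sum_p F p * (i == p)%:R = F i.
Proof. by under eq_bigr do rewrite eq_sym; exact: sum_delta_r. Qed.

End DeltaSums.

Section TensorAlgebra.
Variables (R : realType) (n : nat).
Implicit Types (S T : tensor R n) (A B : 'M[R]_n).
Local Notation KN := (@kulkarni_nomizu R n).

Lemma tcoefD S T i j k l : tcoef (S + T) i j k l = tcoef S i j k l + tcoef T i j k l.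
Proof. by rewrite /tcoef mxE. Qed.

Lemma tcoefN S i j k l : tcoef (- S) i j k l = - tcoef S i j k l.
Proof. by rewrite /tcoef mxE. Qed.

Lemma tcoefB S T i j k l : tcoef (S - T) i j k l = tcoef S i j k l - tcoef T i j k l.
Proof. by rewrite tcoefD tcoefN. Qed.

Lemma tcoefZ (c : R) S i j k l : tcoef (c *: S) i j k l = c * tcoef S i j k l.
Proof. by rewrite /tcoef mxE. Qed.

Lemma tcoef0 i j k l : tcoef (0 : tensor R n) i j k l = 0.
Proof. by rewrite /tcoef mxE. Qed.

Lemma tcoef_kn A B i j k l : tcoef (KN A B) i j k l =
  A i k * B j l - A i l * B j k - A j k * B i l + A j l * B i k.
Proof. exact: tensor_ofE. Qed.

Definition tcoefE := (tcoefD, tcoefN, tcoefZ, tcoef0, tcoef_kn).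

Lemma Ric_is_linear : linear (@Ric R n).
Proof.
move=> c S T; apply/matrixP => i k; rewrite !mxE mulr_sumr -big_split /=.
by apply: eq_bigr => p _; rewrite !tcoefE.
Qed.
HB.instance Definition _ := GRing.isLinear.Build R (tensor R n) 'M[R]_n _ (@Ric R n) Ric_is_linear.

Lemma scalE S : scal S = \tr (Ric S). Proof. by []. Qed.

Lemma scal_is_scalar : scalar (@scal R n).
Proof. by move=> c S T; rewrite !scalE linearP /= mxtraceD mxtraceZ. Qed.
HB.instance Definition _ := GRing.isLinear.Build R (tensor R n) R _ (@scal R n) scal_is_scalar.

Lemma Ric_kn A B : Ric (KN A B) = \tr B *: A - A *m B - B *m A + \tr A *: B.
Proof.
apply/matrixP => i k; rewrite !mxE /mxtrace mulr_suml mulr_suml.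
under eq_bigr do rewrite tcoefE.
rewrite !big_split /= !sumrN; congr (_ - _ - _ + _).
- by apply: eq_bigr => p _; rewrite mulrC.
- by apply: eq_bigr => p _; rewrite mulrC.
Qed.

Definition ric_contract S A : 'M[R]_n :=
  \matrix_(i, k) \sum_p \sum_q tcoef S i p k q * A p q.

Lemma ric_contractDr S A B : ric_contract S (A + B) = ric_contract S A + ric_contract S B.
Proof.
apply/matrixP => i k; rewrite !mxE -big_split; apply: eq_bigr => p _.
by rewrite -big_split; apply: eq_bigr => q _; rewrite mxE mulrDr.
Qed.

Lemma ric_contractZr (c : R) S A : ric_contract S (c *: A) = c *: ric_contract S A.
Proof.
apply/matrixP => i k; rewrite !mxE mulr_sumr; apply: eq_bigr => p _.
by rewrite mulr_sumr; apply: eq_bigr => q _; rewrite mxE mulrCA.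
Qed.

Lemma ric_contract1 S : ric_contract S 1%:M = Ric S.
Proof.
apply/matrixP => i k; rewrite !mxE; apply: eq_bigr => p _.
by under eq_bigr do rewrite mxE; rewrite sum_delta_r'.
Qed.

Lemma ric_contract_kn A B C : ric_contract (KN A B) C =
  \tr (B *m C^T) *: A - A *m C^T *m B - B *m C^T *m A + \tr (A *m C^T) *: B.
Proof.
apply/matrixP => i k; rewrite !mxE /mxtrace.
under eq_bigr => p _ do under eq_bigr => q _ do rewrite tcoefE !mulrDl !mulNr.
under eq_bigr => p _ do rewrite !big_split /= !sumrN.
rewrite !big_split /= !sumrN; congr (_ - _ - _ + _).
- rewrite mulr_suml; apply: eq_bigr => p _; rewrite mxE mulr_suml.
  by apply: eq_bigr => q _; rewrite !mxE; ring.
- apply: eq_bigr => p _; rewrite mxE mulr_suml.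
  by apply: eq_bigr => q _; rewrite !mxE; ring.
- apply: eq_bigr => p _; rewrite mxE mulr_suml.
  by apply: eq_bigr => q _; rewrite !mxE; ring.
- rewrite mulr_suml; apply: eq_bigr => p _; rewrite mxE mulr_suml.
  by apply: eq_bigr => q _; rewrite !mxE; ring.
Qed.

Section Symmetries.
Variable S : tensor R n.
Hypothesis symS : curvature_symmetries S.

Lemma cs12 i j k l : tcoef S i j k l = - tcoef S j i k l.
Proof. by case: (symS i j k l). Qed.
Lemma cs34 i j k l : tcoef S i j k l = - tcoef S i j l k.
Proof. by case: (symS i j k l). Qed.
Lemma cspair i j k l : tcoef S i j k l = tcoef S k l i j.
Proof. by case: (symS i j k l). Qed.
Lemma csflip i j k l : tcoef S i j k l = tcoef S j i l k.
Proof. by rewrite cs12 cs34 opprK. Qed.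
Lemma cs_ii i k l : tcoef S i i k l = 0.
Proof. by have := cs12 i i k l; lra. Qed.
Lemma cs_kk i j k : tcoef S i j k k = 0.
Proof. by have := cs34 i j k k; lra. Qed.

Lemma Ric_sym : (Ric S)^T = Ric S.
Proof. by apply/matrixP => i k; rewrite !mxE; apply: eq_bigr => p _; rewrite cspair. Qed.

End Symmetries.

Lemma cs_kn A B : A^T = A -> B^T = B -> curvature_symmetries (KN A B).
Proof.
move=> symA symB i j k l.
have eA x y : A x y = A y x by rewrite -{1}symA mxE.
have eB x y : B x y = B y x by rewrite -{1}symB mxE.
rewrite !tcoefE; split; [ring|ring|].
rewrite (eA k i) (eA k j) (eA l i) (eA l j) (eB k i) (eB k j) (eB l i) (eB l j); ring.
Qed.

Lemma bianchi_kn A B : A^T = A -> B^T = B -> bianchi (KN A B).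
Proof.
move=> symA symB i j k l.
have eA x y : A x y = A y x by rewrite -{1}symA mxE.
have eB x y : B x y = B y x by rewrite -{1}symB mxE.
by rewrite !tcoefE (eA k j) (eA k i) (eA j i) (eB k j) (eB k i) (eB j i); ring.
Qed.

Lemma ct_kn A B : A^T = A -> B^T = B -> curvature_tensor (KN A B).
Proof. by move=> ? ?; split; [exact: cs_kn|exact: bianchi_kn]. Qed.

Lemma csD S T : curvature_symmetries S -> curvature_symmetries T -> curvature_symmetries (S + T).
Proof.
move=> hS hT i j k l; rewrite !tcoefE; have [-> -> ->] := hS i j k l; have [-> e1 e2] := hT i j k l.
have [e3 e4 e5] := hS i j k l; split; lra.
Qed.

Lemma csZ (c : R) S : curvature_symmetries S -> curvature_symmetries (c *: S).
Proof.
by move=> hS i j k l; rewrite !tcoefE; have [e1 e2 e3] := hS i j k l; split; rewrite -?mulrN -?e1 -?e2 -?e3.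
Qed.

Lemma ctD S T : curvature_tensor S -> curvature_tensor T -> curvature_tensor (S + T).
Proof.
move=> [cS bS] [cT bT]; split; first exact: csD.
by move=> i j k l; rewrite !tcoefE; have := bS i j k l; have := bT i j k l; lra.
Qed.

Lemma ctZ (c : R) S : curvature_tensor S -> curvature_tensor (c *: S).
Proof.
move=> [cS bS]; split; first exact: csZ.
by move=> i j k l; rewrite !tcoefE -!mulrDr bS mulr0.
Qed.

Lemma tcoef_square S i j k l : tcoef (tensor_square S) i j k l =
  \sum_p \sum_q tcoef S i j p q * tcoef S k l p q.
Proof. exact: tensor_ofE. Qed.

(** Hamilton's quadratic expression B_{ijkl}, polarized. R^# is twice its antisymmetrization in the
    last two indices. *)
Definition sharp_form S T (i j k l : 'I_n) : R := \sum_p \sum_q tcoef S i p k q * tcoef T j p l q.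

Lemma tcoef_sharp S i j k l : tcoef (tensor_sharp S) i j k l =
  2 * (sharp_form S S i j k l - sharp_form S S i j l k).
Proof.
rewrite tensor_ofE /sharp_form -sumrB; congr (_ * _); apply: eq_bigr => p _.
by rewrite -sumrB; apply: eq_bigr => q _.
Qed.

Lemma cs_square S : curvature_symmetries S -> curvature_symmetries (tensor_square S).
Proof.
move=> symS i j k l; rewrite !tcoef_square; split.
- rewrite -sumrN; apply: eq_bigr => p _; rewrite -sumrN; apply: eq_bigr => q _.
  by rewrite (cs12 symS i j) mulNr.
- rewrite -sumrN; apply: eq_bigr => p _; rewrite -sumrN; apply: eq_bigr => q _.
  by rewrite (cs12 symS k l) mulrN.
- by apply: eq_bigr => p _; apply: eq_bigr => q _; rewrite mulrC.
Qed.

Lemma sharp_formC S T i j k l : sharp_form S T i j k l = sharp_form T S j i l k.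
Proof. by apply: eq_bigr => p _; apply: eq_bigr => q _; rewrite mulrC. Qed.

Lemma sharp_form_swap S T : curvature_symmetries S -> curvature_symmetries T ->
  forall i j k l, sharp_form S T i j k l = sharp_form S T k l i j.
Proof.
move=> symS symT i j k l; rewrite /sharp_form exchange_big.
by apply: eq_bigr => p _; apply: eq_bigr => q _; rewrite (cspair symS) (cspair symT).
Qed.

Lemma cs_sharp S : curvature_symmetries S -> curvature_symmetries (tensor_sharp S).
Proof.
move=> symS i j k l; rewrite !tcoef_sharp.
rewrite (sharp_formC S S j i k l) (sharp_formC S S j i l k).
rewrite (sharp_form_swap symS symS k l i j) (sharp_form_swap symS symS k l j i).
by rewrite (sharp_formC S S j i k l); split; ring.
Qed.

Lemma cs_hamiltonQ S : curvature_symmetries S -> curvature_symmetries (hamiltonQ S).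
Proof. by move=> h; apply: csD; [exact: cs_square|exact: cs_sharp]. Qed.

Section Bianchi.
Variable S : tensor R n.
Hypothesis ctS : curvature_tensor S.
Let symS := ctS.1.

Lemma bianchi_sub i j p q : tcoef S i j p q = tcoef S i p j q - tcoef S i q j p.
Proof.
have := ctS.2 i j p q.
rewrite (cspair symS j p i q) (cs12 symS i q j p) (cs12 symS p i j q); lra.
Qed.

(** The Bianchi identity writes S_{ijpq} as S_{ipjq} - S_{iqjp}, so R^2 is expressed by the same
    form as R^#, with the middle indices exchanged. *)
Lemma square_sharp_form i j k l : tcoef (tensor_square S) i j k l =
  2 * (sharp_form S S i k j l - sharp_form S S i l j k).
Proof.
have e : tcoef (tensor_square S) i j k l =
   \sum_p \sum_q (tcoef S i p j q * tcoef S k p l q) + \sum_p \sum_q (tcoef S i q j p * tcoef S k q l p)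
  - \sum_p \sum_q (tcoef S i p j q * tcoef S k q l p) - \sum_p \sum_q (tcoef S i q j p * tcoef S k p l q).
  rewrite tcoef_square -big_split -!sumrB; apply: eq_bigr => p _ /=.
  rewrite -big_split -!sumrB; apply: eq_bigr => q _ /=.
  by rewrite (bianchi_sub i j p q) (bianchi_sub k l p q); ring.
have e2 : \sum_p \sum_q (tcoef S i q j p * tcoef S k q l p) = sharp_form S S i k j l.
  by rewrite exchange_big.
have e3 : \sum_p \sum_q (tcoef S i p j q * tcoef S k q l p) = sharp_form S S i l j k.
  by apply: eq_bigr => p _; apply: eq_bigr => q _; rewrite (cspair symS k q).
have e4 : \sum_p \sum_q (tcoef S i q j p * tcoef S k p l q) = sharp_form S S i l j k.
  by rewrite exchange_big -e3.
rewrite e e2 e3 e4 -/(sharp_form S S i k j l); ring.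
Qed.

(** Once Q is written with [sharp_form] alone, the cyclic sum cancels by the symmetries collected in
    [orbit]. *)
Lemma bianchi_hamiltonQ : bianchi (hamiltonQ S).
Proof.
move=> i j k l; rewrite !tcoefE !tcoef_sharp !square_sharp_form.
have orbit x y z t : [/\ sharp_form S S y x t z = sharp_form S S x y z t,
    sharp_form S S z t x y = sharp_form S S x y z t &
    sharp_form S S t z y x = sharp_form S S x y z t].
  by rewrite -(sharp_formC S S x y z t) (sharp_form_swap symS symS z t)
     -(sharp_formC S S z t) (sharp_form_swap symS symS z t).
have [] := orbit i j k l; have [] := orbit i j l k; have [] := orbit i k j l.
have [] := orbit i k l j; have [] := orbit i l j k; have [] := orbit i l k j.
lra.
Qed.

End Bianchi.

Section Polarization.
Variables (S : tensor R n) (A : 'M[R]_n).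
Hypotheses (ctS : curvature_tensor S) (symA : A^T = A).
Let symS := ctS.1.
Let eA x y : A x y = A y x. Proof. by rewrite -{1}symA mxE. Qed.
Local Notation B := (KN A 1%:M).

Definition contract1 j i k l := \sum_q A j q * tcoef S q i k l.

Let c1_34 j i k l : contract1 j i k l = - contract1 j i l k.
Proof. by rewrite -sumrN; apply: eq_bigr => q _; rewrite (cs34 symS) mulrN. Qed.

Let c1_bianchi j i k l : contract1 j i k l + contract1 j k l i + contract1 j l i k = 0.
Proof.
rewrite -!big_split big1 // => q _ /=; rewrite -!mulrDr.
rewrite (_ : _ + _ + _ = 0) ?mulr0 //.
have := ctS.2 i k l q; rewrite (cspair symS i k) (cspair symS k l) (cspair symS l i).
rewrite (cs12 symS l q) (cs12 symS i q) (cs12 symS k q); lra.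
Qed.

Lemma square_cross i j k l : \sum_p \sum_q tcoef S i j p q * tcoef B k l p q =
  2 * (contract1 k l i j - contract1 l k i j).
Proof.
under eq_bigr => p _ do under eq_bigr => q _ do
  rewrite tcoefE !mulrDr !mulrN !mxE !mulrA.
under eq_bigr => p _ do rewrite !big_split /= !sumrN !sum_delta_r'.
rewrite !big_split /= !sumrN.
under [X in _ - X - _ + _]eq_bigr => p _ do rewrite -mulr_suml.
under [X in _ - _ - _ + X]eq_bigr => p _ do rewrite -mulr_suml.
rewrite !sum_delta_r'.
have e x y : \sum_p tcoef S i j p y * A x p = contract1 x y i j.
  by apply: eq_bigr => p _; rewrite mulrC (cspair symS).
have e' x y : \sum_p tcoef S i j y p * A x p = - contract1 x y i j.
  by rewrite -sumrN; apply: eq_bigr => p _; rewrite mulrC (cs34 symS) (cspair symS) mulrN.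
rewrite !e !e'; ring.
Qed.

Lemma sharp_cross i j k l : sharp_form S B i j k l =
  A j l * Ric S i k + (ric_contract S A) i k * (j == l)%:R - contract1 j k l i - contract1 l i j k.
Proof.
rewrite /sharp_form.
under eq_bigr => p _ do under eq_bigr => q _ do
  rewrite tcoefE !mulrDr !mulrN !mxE !mulrA.
under eq_bigr => p _ do rewrite !big_split /= !sumrN ?sum_delta_r'.
rewrite !big_split /= !sumrN.
under [X in _ - X - _ + _]eq_bigr => p _ do rewrite -mulr_suml.
under [X in _ - _ - _ + X]eq_bigr => p _ do rewrite -mulr_suml.
rewrite !sum_delta_r -!mulr_suml !mxE.
have -> : \sum_q tcoef S i l k q * A j q = contract1 j k l i.
  by apply: eq_bigr => q _; rewrite mulrC (cspair symS) (csflip symS).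
have -> : \sum_p tcoef S i p k j * A p l = contract1 l i j k.
  by apply: eq_bigr => q _; rewrite mulrC (eA q) (csflip symS).
ring.
Qed.

(** The cross terms of R^2 and of R^# both contain contractions of [A] with one slot of [S]. These
    cancel by the Bianchi identity in the three uncontracted slots, and only terms in Ric S and
    [ric_contract] survive. *)
Lemma hamiltonQ_polar : hamiltonQ (S + B) =
  hamiltonQ S + hamiltonQ B + 2 *: KN (Ric S) A + 2 *: KN (ric_contract S A) 1%:M.
Proof.
have d x y : (1%:M : 'M[R]_n) x y = (x == y)%:R by rewrite mxE.
apply: tensorP => i j k l; rewrite !tcoefE !tcoef_square !tcoef_sharp !d.
have -> : \sum_p \sum_q tcoef (S + B) i j p q * tcoef (S + B) k l p q =
   \sum_p \sum_q tcoef S i j p q * tcoef S k l p q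
   + \sum_p \sum_q tcoef B i j p q * tcoef B k l p q
   + 2 * (contract1 k l i j - contract1 l k i j) + 2 * (contract1 i j k l - contract1 j i k l).
  rewrite -!square_cross -!big_split; apply: eq_bigr => p _ /=.
  by rewrite -!big_split; apply: eq_bigr => q _ /=; rewrite !tcoefD; ring.
have eF x y z t : sharp_form (S + B) (S + B) x y z t = sharp_form S S x y z t + sharp_form B B x y z t
   + sharp_form S B x y z t + sharp_form S B y x t z.
  rewrite -(sharp_formC B S) -!big_split; apply: eq_bigr => p _ /=.
  by rewrite -!big_split; apply: eq_bigr => q _ /=; rewrite !tcoefD; ring.
rewrite !eF !sharp_cross.
have := c1_bianchi j i k l; have := c1_bianchi i j k l.
have := c1_bianchi k i j l; have := c1_bianchi l i j k.
have := c1_34 k l i j; have := c1_34 l k i j; have := c1_34 i j k l; have := c1_34 j i k l.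
have := c1_34 j k l i; have := c1_34 j l i k; have := c1_34 i k l j.
have := c1_34 i l j k; have := c1_34 k i l j; have := c1_34 k j l i; have := c1_34 l i j k.
have := c1_34 l j k i; have := c1_34 k i j l; have := c1_34 l i j k; have := c1_34 l j i k.
have := c1_34 k j i l; have := c1_34 i k j l; have := c1_34 i l k j.
lra.
Qed.

End Polarization.

(* [Q] is quadratic, so polarizing at [S = B] determines [Q B]. *)
Lemma hamiltonQ_kn1 A : A^T = A -> hamiltonQ (KN A 1%:M) =
  (n%:R - 2) *: KN A A + (2 * \tr A) *: KN A 1%:M - 2 *: KN (A *m A) 1%:M
    + \tr (A *m A) *: KN 1%:M 1%:M.
Proof.
move=> symA; pose B := KN A 1%:M.
have ctB : curvature_tensor B by apply: ct_kn; rewrite ?trmx1.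
have e4 : hamiltonQ (B + B) = 4 *: hamiltonQ B.
  apply: tensorP => i j k l; rewrite !tcoefE !tcoef_square !tcoef_sharp.
  have e x y z t : sharp_form (B + B) (B + B) x y z t = 4 * sharp_form B B x y z t.
    rewrite mulr_sumr; apply: eq_bigr => p _; rewrite mulr_sumr; apply: eq_bigr => q _.
    by rewrite !tcoefD; ring.
  have -> : \sum_p \sum_q tcoef (B + B) i j p q * tcoef (B + B) k l p q =
      4 * \sum_p \sum_q tcoef B i j p q * tcoef B k l p q.
    rewrite mulr_sumr; apply: eq_bigr => p _; rewrite mulr_sumr; apply: eq_bigr => q _.
    by rewrite !tcoefD; ring.
  by rewrite !e; ring.
have := hamiltonQ_polar ctB symA; rewrite -/B e4 Ric_kn ric_contract_kn symA mxtrace1 mul1mx !mulmx1.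
move/matrixP => e; apply: tensorP => i j k l; move: (e (enum_rank (i, j)) (enum_rank (k, l))).
rewrite -!/(tcoef _ _ _ _ _) !tcoefE -/B !mxE; lra.
Qed.

Lemma Ric_hamiltonQ S : curvature_tensor S -> Ric (hamiltonQ S) = 2 *: ric_contract S (Ric S).
Proof.
move=> ctS; have symS := ctS.1; apply/matrixP => i k; rewrite !mxE.
under eq_bigr do rewrite !tcoefE tcoef_sharp square_sharp_form //.
under eq_bigr => j _ do rewrite -mulrDr.
rewrite -mulr_sumr; congr (_ * _); rewrite big_split !sumrB /=.
rewrite [X in _ + (X - _)](_ : _ = \sum_p \sum_q tcoef S i p k q * Ric S p q); last first.
  rewrite exchange_big; apply: eq_bigr => p _; rewrite exchange_big; apply: eq_bigr => q _.
  by rewrite mxE mulr_sumr; apply: eq_bigr => j _; rewrite (csflip symS j).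
(* Written once as in [e1] and once as in [e2], the two equal sums complete the first one to a
   contraction of S_{ipjq} with a cyclic sum, which the Bianchi identity kills. *)
suff : \sum_j sharp_form S S i k j j - \sum_j sharp_form S S i j j k - \sum_j sharp_form S S i j j k = 0 by lra.
have e1 : \sum_j sharp_form S S i j j k = - \sum_j \sum_p \sum_q tcoef S i p j q * tcoef S k q p j.
  rewrite -sumrN; apply: eq_bigr => j _; rewrite -sumrN; apply: eq_bigr => p _; rewrite -sumrN; apply: eq_bigr => q _.
  by rewrite (cspair symS j p) (cs34 symS k q) mulrN.
have e2 : \sum_j sharp_form S S i j j k = - \sum_j \sum_p \sum_q tcoef S i p j q * tcoef S k j q p.
  rewrite /sharp_form [X in - X]exchange_big [LHS]exchange_big -sumrN; apply: eq_bigr => p _ /=.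
  rewrite [X in - X]exchange_big -sumrN; apply: eq_bigr => j _; rewrite -sumrN; apply: eq_bigr => q _.
  by rewrite (cspair symS j p) (cs34 symS i p q j) mulNr opprK.
rewrite {1}e1 e2 !opprK /sharp_form -!big_split big1 // => j _ /=.
rewrite -!big_split big1 // => p _ /=; rewrite -!big_split big1 // => q _ /=.
rewrite -!mulrDr (_ : _ + _ = 0) ?mulr0 //.
have := ctS.2 p j q k; rewrite (cspair symS p j) (cspair symS j q) (cspair symS q p).
rewrite (cs12 symS q k) (cs12 symS p k) (cs12 symS j k).
rewrite (cs34 symS k q p j) (cs34 symS k p j q) (cs34 symS k j q p).
lra.
Qed.
End TensorAlgebra.

(** * The map ell *)

Section Ell.
Variables (R : realType) (n : nat).
Implicit Types (S T : tensor R n) (A B : 'M[R]_n).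
Local Notation KN := (@kulkarni_nomizu R n).
Local Notation N := (n%:R : R).

(** The trace-free Ricci tensor, locked so that [mxE] does not open its entries. *)
Definition ric0 S : 'M[R]_n := locked (Ric S - (scal S / N) *: 1%:M).

(** The difference of Q pulled back by ell and Q itself, known from the work of Böhm and Wilking. *)
Definition ellD (a b : R) S : tensor R n :=
  (2 * b + (N - 2) * b ^+ 2) *: KN (ric0 S) (ric0 S)
  + (4 * a * (scal S / N)) *: KN (ric0 S) 1%:M
  + (2 * b ^+ 2) *: KN (ric0 S *m ric0 S) 1%:M
  + (2 * a * (scal S / N) ^+ 2 + kappa_param N b a * \tr (ric0 S *m ric0 S)) *: KN 1%:M 1%:M.

(** As ell multiplies [ric0] by 1 + (N - 2) b and [scal] by 1 + 2 (N - 1) a, the Kulkarni-Nomizu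
    term added by ell is recovered from the image by dividing. *)
Definition ellinv (a b : R) S : tensor R n :=
  S - KN ((b / (1 + (N - 2) * b)) *: ric0 S + (a * (scal S / N) / (1 + 2 * (N - 1) * a)) *: 1%:M) 1%:M.

Lemma ric0E S : ric0 S = Ric S - (scal S / N) *: 1%:M.
Proof. by rewrite /ric0 -lock. Qed.

Lemma Ric_decomp S : Ric S = ric0 S + (scal S / N) *: 1%:M.
Proof. by rewrite ric0E subrK. Qed.

Lemma ric0_sym S : curvature_symmetries S -> (ric0 S)^T = ric0 S.
Proof. by move=> symS; rewrite ric0E linearB linearZ /= Ric_sym // trmx1. Qed.

Hypothesis n_gt0 : (0 < n)%N.
Let N0 : N != 0. Proof. by rewrite pnatr_eq0 -lt0n. Qed.

Lemma tr_ric0 S : \tr (ric0 S) = 0.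
Proof. by rewrite ric0E raddfB /= mxtraceZ mxtrace1 -scalE mulfVK ?subrr. Qed.

Lemma ellE a b S : ell a b S = S + KN (b *: ric0 S + (a * (scal S / N)) *: 1%:M) 1%:M.
Proof. by apply: tensorP => i j k l; rewrite /ell Ric_decomp !tcoefE !mxE; field. Qed.

Lemma Ric_ell a b S : Ric (ell a b S) = (1 + (N - 2) * b) *: ric0 S + ((1 + 2 * (N - 1) * a) * (scal S / N)) *: 1%:M.
Proof.
rewrite ellE linearD /= Ric_kn mxtraceD !mxtraceZ tr_ric0 mxtrace1 mulmx1 mul1mx mulr0 add0r.
by rewrite Ric_decomp; apply/matrixP => i k; rewrite !mxE; field.
Qed.

Lemma scal_ell a b S : scal (ell a b S) = (1 + 2 * (N - 1) * a) * scal S.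
Proof. by rewrite scalE Ric_ell !mxtraceD !mxtraceZ tr_ric0 mxtrace1; field. Qed.

Lemma ric0_ell a b S : ric0 (ell a b S) = (1 + (N - 2) * b) *: ric0 S.
Proof. by rewrite ric0E Ric_ell scal_ell -[_ * scal S / _]mulrA addrK. Qed.

Lemma ellK a b S : 1 + (N - 2) * b != 0 -> 1 + 2 * (N - 1) * a != 0 -> ellinv a b (ell a b S) = S.
Proof.
move=> h1 h2; rewrite /ellinv ric0_ell scal_ell {1}ellE.
apply: tensorP => i j k l; rewrite !tcoefE !mxE; field.
by rewrite h1 h2 N0.
Qed.

Lemma ellinvK a b S : 1 + (N - 2) * b != 0 -> 1 + 2 * (N - 1) * a != 0 -> ell a b (ellinv a b S) = S.
Proof.
move=> h1 h2.
pose B := KN ((b / (1 + (N - 2) * b)) *: ric0 S + (a * (scal S / N) / (1 + 2 * (N - 1) * a)) *: 1%:M) 1%:M.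
have RB : Ric B = ((N - 2) * (b / (1 + (N - 2) * b))) *: ric0 S + (2 * (N - 1) * (a * (scal S / N) / (1 + 2 * (N - 1) * a))) *: 1%:M.
  rewrite Ric_kn mxtraceD !mxtraceZ tr_ric0 mxtrace1 mulmx1 mul1mx mulr0 add0r.
  by apply/matrixP => i k; rewrite !mxE; ring.
have sB : scal B = N * (2 * (N - 1) * (a * (scal S / N) / (1 + 2 * (N - 1) * a))).
  by rewrite scalE RB !mxtraceD !mxtraceZ tr_ric0 mxtrace1; ring.
rewrite ellE ric0E /ellinv -/B !linearB /= RB sB Ric_decomp.
apply: tensorP => i j k l; rewrite !tcoefE !mxE; field.
by rewrite h1 h2 N0.
Qed.

Lemma ct_ellinv a b S : curvature_tensor S -> curvature_tensor (ellinv a b S).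
Proof.
move=> ctS; have symS := ctS.1; have sP := ric0_sym symS.
rewrite /ellinv -scaleN1r; apply: ctD => //; apply: ctZ; apply: ct_kn; rewrite ?trmx1 //.
by rewrite linearD !linearZ /= sP trmx1.
Qed.

Lemma Ric_ellD a b S : Ric (ellD a b S) =
  (- 4 * b) *: (ric0 S *m ric0 S) + (4 * a * (N - 2) * (scal S / N)) *: ric0 S
  + (4 * (N - 1) * a * (scal S / N) ^+ 2 + 2 * (b ^+ 2 + (N - 1) * kappa_param N b a) * \tr (ric0 S *m ric0 S)) *: 1%:M.
Proof.
rewrite /ellD !linearD !linearZ /= !Ric_kn tr_ric0 mxtrace1 !mulmx1 !mul1mx.
by apply/matrixP => i k; rewrite !mxE; ring.
Qed.

Lemma scal_ellD a b S : scal (ellD a b S) =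
  4 * N * (N - 1) * a * (scal S / N) ^+ 2 + (2 * N * (b ^+ 2 + (N - 1) * kappa_param N b a) - 4 * b) * \tr (ric0 S *m ric0 S).
Proof. by rewrite scalE Ric_ellD !mxtraceD !mxtraceZ tr_ric0 mxtrace1; ring. Qed.

Lemma tr_Ric_sqr S : \tr (Ric S *m Ric S) = \tr (ric0 S *m ric0 S) + N * (scal S / N) ^+ 2.
Proof.
rewrite Ric_decomp mulmxDl !mulmxDr -!scalemxAl -!scalemxAr !mulmx1 !mul1mx.
by rewrite !mxtraceD !mxtraceZ tr_ric0 mxtrace1; ring.
Qed.

Lemma scal_hamiltonQ S : curvature_tensor S ->
  scal (hamiltonQ S) = 2 * (\tr (ric0 S *m ric0 S) + N * (scal S / N) ^+ 2).
Proof.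
move=> ctS; rewrite scalE Ric_hamiltonQ // linearZ /= -tr_Ric_sqr; congr (_ * _).
rewrite /mxtrace; under eq_bigr do rewrite mxE.
rewrite exchange_big; apply: eq_bigr => p _; rewrite exchange_big mxE; apply: eq_bigr => q _.
rewrite -mulr_suml; congr (_ * _); last by rewrite -{1}(Ric_sym ctS.1) mxE.
by rewrite mxE; apply: eq_bigr => i _; rewrite (csflip ctS.1).
Qed.

(** In [hamiltonQ_polar] with A = b ric0 + a s id, the contraction of S with A is b times that with
    Ric S, up to a multiple of Ric S. By [Ric_hamiltonQ] this is the term b Ric(Q S) (.) id of ell
    (Q S). What is left involves Ricci and its square only and is matched entrywise. *)
Lemma hamiltonQ_ell a b S : 1 + 2 * (N - 1) * a != 0 -> curvature_tensor S ->
  hamiltonQ (ell a b S) = ell a b (hamiltonQ S + ellD a b S).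
Proof.
move=> a1 ctS; have symS := ctS.1; have sP := ric0_sym symS.
pose s := scal S / N.
set A := b *: ric0 S + (a * (scal S / N)) *: 1%:M.
have symA : A^T = A by rewrite /A linearD !linearZ /= sP trmx1.
rewrite ellE -/A hamiltonQ_polar // hamiltonQ_kn1 //.
have trA : \tr A = N * (a * s) by rewrite /A !mxtraceD !mxtraceZ tr_ric0 mxtrace1 -/s; ring.
have AA : A *m A = (b ^+ 2) *: (ric0 S *m ric0 S) + (2 * a * b * s) *: ric0 S + ((a * s) ^+ 2) *: 1%:M.
  rewrite /A mulmxDl !mulmxDr -!scalemxAl -!scalemxAr !mulmx1 !mul1mx.
  by apply/matrixP => i k; rewrite !mxE -/s; ring.
have trAA : \tr (A *m A) = b ^+ 2 * \tr (ric0 S *m ric0 S) + N * (a * s) ^+ 2.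
  by rewrite AA !mxtraceD !mxtraceZ tr_ric0 mxtrace1; ring.
have SA : ric_contract S A = b *: ric_contract S (Ric S) + ((a - b) * s) *: Ric S.
  transitivity (ric_contract S (b *: Ric S + ((a - b) * s) *: 1%:M)); last first.
    by rewrite ric_contractDr !ric_contractZr ric_contract1.
  congr (ric_contract _ _).
  by rewrite Ric_decomp /A; apply/matrixP => i k; rewrite !mxE -/s; ring.
have eR : Ric (hamiltonQ S + ellD a b S) = Ric (hamiltonQ S) + Ric (ellD a b S) by exact: linearD.
have eS : scal (hamiltonQ S + ellD a b S) = scal (hamiltonQ S) + scal (ellD a b S) by exact: linearD.
rewrite trA trAA AA SA /ell eR eS Ric_hamiltonQ // Ric_ellD scal_hamiltonQ // scal_ellD.
rewrite Ric_decomp /A /ellD -/s /kappa_param.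
move: (ric_contract S _) (ric0 S *m ric0 S) (hamiltonQ S) => Z P2 Q.
move: (\tr P2) (ric0 S) => t P.
apply: tensorP => i j k l; rewrite !tcoefE !mxE.
move: (tcoef Q _ _ _ _) => q.
move: (P i k) (P i l) (P j k) (P j l) (P2 i k) (P2 i l) (P2 j k) (P2 j l) (Z i k) (Z i l) (Z j k) (Z j l).
move: (i == k)%:R (i == l)%:R (j == k)%:R (j == l)%:R => *.
by field; rewrite N0 a1.
Qed.

End Ell.

(** * Change of orthonormal frame *)

Lemma sum_pairs (V : nmodType) (I : finType) (F : 'I_#|{: I * I}| -> V) :
  \sum_x F x = \sum_i \sum_j F (enum_rank (i, j)).
Proof.
rewrite pair_bigA (reindex (@enum_rank {: I * I})) /=; last first.
  by exists (@enum_val _ _) => x _; [exact: enum_rankK|exact: enum_valK].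
by apply: eq_bigr => -[].
Qed.

Section Rotation.
Variables (R : realType) (n : nat).
Implicit Types (S T : tensor R n) (A B : 'M[R]_n).
Local Notation KN := (@kulkarni_nomizu R n).

(** As tensors are matrices indexed by pairs, a change of frame is conjugation by the Kronecker
    square of P, and R^2 is the matrix T T^T. *)
Definition kron (P : 'M[R]_n) : tensor R n :=
  tensor_of (fun i j k l => P i k * P j l).

Definition colvec A : 'cV[R]_#|{: 'I_n * 'I_n}| := \col_x A (enum_val x).1 (enum_val x).2.

Lemma colvecE A i j y : colvec A (enum_rank (i, j)) y = A i j.
Proof. by rewrite mxE enum_rankK. Qed.

Lemma colvecP (u v : 'cV[R]_#|{: 'I_n * 'I_n}|) :
  (forall i j, u (enum_rank (i, j)) 0 = v (enum_rank (i, j)) 0) -> u = v.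
Proof.
move=> e; apply/matrixP => x y; rewrite ord1 -[x]enum_valK; case: (enum_val x) => i j; exact: e.
Qed.

Definition rotT P T : tensor R n := kron P *m T *m (kron P)^T.
(** Exchanging the middle indices turns the contractions in R^#, Ric and the Kulkarni-Nomizu product
    into matrix products, so that their equivariance follows from that of matrix multiplication. *)
Definition mid T : tensor R n := tensor_of (fun i j k l => tcoef T i k j l).
Definition swap34 T : tensor R n := tensor_of (fun i j k l => tcoef T i j l k).

Lemma kron_colvec P A : kron P *m colvec A = colvec (P *m A *m P^T).
Proof.
apply: colvecP => i j; rewrite colvecE !mxE sum_pairs.
under [RHS]eq_bigr do rewrite mxE mulr_suml.
rewrite [RHS]exchange_big; apply: eq_bigr => k _; apply: eq_bigr => l _.
by rewrite colvecE -/(tcoef _ _ _ _ _) tensor_ofE !mxE; ring.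
Qed.

Lemma kron_tr P : (kron P)^T = kron P^T.
Proof. by apply: tensorP => i j k l; rewrite tensor_ofE /tcoef mxE -/(tcoef _ _ _ _ _) tensor_ofE !mxE. Qed.

Lemma kron_orth P : P *m P^T = 1%:M -> kron P *m (kron P)^T = 1%:M.
Proof.
move=> PP; apply: tensorP => i j k l.
rewrite kron_tr /tcoef [LHS]mxE sum_pairs [RHS]mxE.
rewrite (inj_eq enum_rank_inj) xpair_eqE.
transitivity ((1%:M : 'M[R]_n) i k * (1%:M : 'M[R]_n) j l); last by rewrite !mxE -natrM mulnb.
rewrite -PP !mxE mulr_suml; apply: eq_bigr => p _; rewrite mulr_sumr; apply: eq_bigr => q _.
by rewrite -!/(tcoef _ _ _ _ _) !tensor_ofE !mxE; ring.
Qed.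

Lemma tcoef_rot P T i j k l : tcoef (rotT P T) i j k l =
  \sum_a \sum_b \sum_c \sum_d tcoef T a b c d * P i a * P j b * P k c * P l d.
Proof.
rewrite /rotT /tcoef kron_tr mxE sum_pairs.
under eq_bigr => c _ do under eq_bigr => d _ do rewrite mxE sum_pairs mulr_suml.
under eq_bigr => c _ do rewrite exchange_big /=.
rewrite exchange_big; apply: eq_bigr => a _ /=.
under eq_bigr => c _ do under eq_bigr => d _ do rewrite mulr_suml.
under eq_bigr => c _ do rewrite exchange_big /=.
rewrite exchange_big; apply: eq_bigr => b _ /=.
apply: eq_bigr => c _; apply: eq_bigr => d _.
rewrite -!/(tcoef _ _ _ _ _) !tensor_ofE !mxE; ring.
Qed.

Lemma tcoef_rot_teval P T i j k l :
  tcoef (rotT P T) i j k l = teval T (row i P) (row j P) (row k P) (row l P).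
Proof.
rewrite tcoef_rot; apply: eq_bigr => a _; apply: eq_bigr => b _; apply: eq_bigr => c _.
by apply: eq_bigr => d _; rewrite !mxE.
Qed.

Lemma kron1 : kron 1%:M = 1%:M.
Proof.
apply: tensorP => i j k l; rewrite tensor_ofE /tcoef !mxE (inj_eq enum_rank_inj) xpair_eqE.
by rewrite -natrM mulnb.
Qed.

Lemma rot1 T : rotT 1%:M T = T.
Proof. by rewrite /rotT kron1 trmx1 mul1mx mulmx1. Qed.

Lemma rot_is_linear P : linear (rotT P).
Proof. by move=> c S T; rewrite /rotT mulmxDr -scalemxAr mulmxDl -scalemxAl. Qed.
HB.instance Definition _ P := GRing.isLinear.Build R (tensor R n) (tensor R n) _ (rotT P) (rot_is_linear P).

Lemma rotD P S T : rotT P (S + T) = rotT P S + rotT P T. Proof. exact: linearD. Qed.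
Lemma rotB P S T : rotT P (S - T) = rotT P S - rotT P T. Proof. exact: linearB. Qed.
Lemma rotZ P (c : R) T : rotT P (c *: T) = c *: rotT P T. Proof. exact: linearZ. Qed.

Lemma rot_mid P T : rotT P (mid T) = mid (rotT P T).
Proof.
apply: tensorP => i j k l; rewrite tensor_ofE !tcoef_rot; apply: eq_bigr => a _.
rewrite exchange_big; apply: eq_bigr => b _; apply: eq_bigr => c _; apply: eq_bigr => d _.
by rewrite tensor_ofE; ring.
Qed.

Lemma rot_swap34 P T : rotT P (swap34 T) = swap34 (rotT P T).
Proof.
apply: tensorP => i j k l; rewrite tensor_ofE !tcoef_rot; apply: eq_bigr => a _.
apply: eq_bigr => b _; rewrite exchange_big; apply: eq_bigr => c _; apply: eq_bigr => d _.
by rewrite tensor_ofE; ring.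
Qed.

Lemma squareE T : tensor_square T = T *m T^T.
Proof.
apply: tensorP => i j k l; rewrite tcoef_square /tcoef mxE sum_pairs.
by apply: eq_bigr => p _; apply: eq_bigr => q _; rewrite mxE.
Qed.

Lemma sharpE T : tensor_sharp T = 2 *: (mid (tensor_square (mid T)) - swap34 (mid (tensor_square (mid T)))).
Proof.
apply: tensorP => i j k l; rewrite tcoef_sharp !tcoefE !tensor_ofE; congr (_ * (_ - _));
by apply: eq_bigr => p _; apply: eq_bigr => q _; rewrite !tensor_ofE.
Qed.

Lemma knE A B : KN A B = mid (colvec A *m (colvec B)^T) - swap34 (mid (colvec A *m (colvec B)^T))
   - swap34 (mid (colvec B *m (colvec A)^T)) + mid (colvec B *m (colvec A)^T).
Proof.
have e X Y i j k l : tcoef (colvec X *m (colvec Y)^T) i j k l = X i j * Y k l.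
  by rewrite /tcoef mxE big_ord1 [X in _ * X]mxE !colvecE.
by apply: tensorP => i j k l; rewrite !tcoefE !tensor_ofE !e; ring.
Qed.

Lemma cs_rot P T : curvature_symmetries T -> curvature_symmetries (rotT P T).
Proof.
move=> symT i j k l; rewrite !tcoef_rot; split.
- rewrite -sumrN exchange_big; apply: eq_bigr => a _; rewrite -sumrN; apply: eq_bigr => b _.
  rewrite -sumrN; apply: eq_bigr => c _; rewrite -sumrN; apply: eq_bigr => d _.
  by rewrite (cs12 symT); ring.
- rewrite -sumrN; apply: eq_bigr => a _; rewrite -sumrN; apply: eq_bigr => b _.
  rewrite -sumrN exchange_big; apply: eq_bigr => c _; rewrite -sumrN; apply: eq_bigr => d _.
  by rewrite (cs34 symT); ring.
- rewrite -!tcoef_rot.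
  have /matrixP/(_ (enum_rank (i, j)) (enum_rank (k, l))) : (rotT P T)^T = rotT P T.
    rewrite /rotT !trmx_mul trmxK mulmxA; congr (_ *m _ *m _).
    by apply: tensorP => x y z t; rewrite /tcoef mxE -!/(tcoef _ _ _ _ _) (cspair symT).
  by rewrite mxE; exact: esym.
Qed.

Lemma ct_rot P T : curvature_tensor T -> curvature_tensor (rotT P T).
Proof.
move=> [symT bT]; split; first exact: cs_rot.
move=> i j k l; rewrite (tcoef_rot P T j) (tcoef_rot P T k).
have -> : \sum_a \sum_b \sum_c \sum_d tcoef T a b c d * P j a * P k b * P i c * P l d =
  \sum_a \sum_b \sum_c \sum_d tcoef T b c a d * P i a * P j b * P k c * P l d.
  under eq_bigr => a _ do rewrite exchange_big /=.
  rewrite exchange_big; apply: eq_bigr => a _; apply: eq_bigr => b _; apply: eq_bigr => c _.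
  by apply: eq_bigr => d _; ring.
have -> : \sum_a \sum_b \sum_c \sum_d tcoef T a b c d * P k a * P i b * P j c * P l d =
  \sum_a \sum_b \sum_c \sum_d tcoef T c a b d * P i a * P j b * P k c * P l d.
  rewrite exchange_big; apply: eq_bigr => a _; rewrite exchange_big; apply: eq_bigr => b _.
  by apply: eq_bigr => c _; apply: eq_bigr => d _; ring.
rewrite tcoef_rot -!big_split big1 // => a _ /=; rewrite -!big_split big1 // => b _ /=.
rewrite -!big_split big1 // => c _ /=; rewrite -!big_split big1 // => d _ /=.
by rewrite -!mulrDl bT !mul0r.
Qed.

Section Orthogonal.
Variable P : 'M[R]_n.
Hypothesis PP : P *m P^T = 1%:M.
Let PtP : P^T *m P = 1%:M. Proof. exact: mulmx1C. Qed.
Let KtK : (kron P)^T *m kron P = 1%:M. Proof. by apply: mulmx1C; exact: kron_orth. Qed.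

Lemma rot_square T : rotT P (tensor_square T) = tensor_square (rotT P T).
Proof. by rewrite !squareE /rotT !trmx_mul trmxK !mulmxA -(mulmxA _ (kron P)^T (kron P)) KtK mulmx1. Qed.

Lemma rot_sharp T : rotT P (tensor_sharp T) = tensor_sharp (rotT P T).
Proof. by rewrite !sharpE linearZ linearB /= rot_swap34 !rot_mid rot_square rot_mid. Qed.

Lemma rot_hamiltonQ T : rotT P (hamiltonQ T) = hamiltonQ (rotT P T).
Proof. by rewrite linearD /= rot_square rot_sharp. Qed.

Lemma rot_kn A B : rotT P (KN A B) = KN (P *m A *m P^T) (P *m B *m P^T).
Proof.
have e X Y : rotT P (colvec X *m (colvec Y)^T) = colvec (P *m X *m P^T) *m (colvec (P *m Y *m P^T))^T.
  by rewrite -!kron_colvec /rotT trmx_mul !mulmxA.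
by rewrite !knE rotD !rotB !rot_swap34 !rot_mid !e.
Qed.

Lemma Ric_rot T : Ric (rotT P T) = P *m Ric T *m P^T.
Proof.
have eR X : colvec (Ric X) = mid X *m colvec 1%:M.
  apply: colvecP => i k; rewrite colvecE mxE [RHS]mxE sum_pairs; apply: eq_bigr => p _.
  under eq_bigr do rewrite colvecE [X in _ * X]mxE.
  by rewrite sum_delta_r' -/(tcoef _ _ _ _ _) tensor_ofE.
have : colvec (Ric (rotT P T)) = colvec (P *m Ric T *m P^T).
  rewrite -kron_colvec !eR -rot_mid /rotT -!mulmxA; congr (_ *m (_ *m _)).
  by rewrite kron_tr kron_colvec mulmx1 trmxK PtP.
by move/matrixP=> e; apply/matrixP => i k; move: (e (enum_rank (i, k)) 0); rewrite !colvecE.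
Qed.

Lemma scal_rot T : scal (rotT P T) = scal T.
Proof. by rewrite !scalE Ric_rot mxtrace_mulC mulmxA PtP mul1mx. Qed.

Lemma ric0_rot T : ric0 (rotT P T) = P *m ric0 T *m P^T.
Proof. by rewrite !ric0E scal_rot Ric_rot mulmxBr mulmxBl -scalemxAr -scalemxAl mulmx1 PP. Qed.

Lemma rot_ellD a b T : rotT P (ellD a b T) = ellD a b (rotT P T).
Proof.
rewrite /ellD !linearD !linearZ /= !rot_kn scal_rot ric0_rot mulmx1 PP.
have trP X : \tr (P *m X *m P^T) = \tr X by rewrite mxtrace_mulC mulmxA PtP mul1mx.
have -> : P *m ric0 T *m P^T *m (P *m ric0 T *m P^T) = P *m (ric0 T *m ric0 T) *m P^T.
  by rewrite !mulmxA -(mulmxA _ P^T P) PtP mulmx1.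
by rewrite trP.
Qed.

End Orthogonal.
End Rotation.

(** * The sharp product of nonnegative tensors *)

Section TracePsd.
Local Open Scope sesquilinear_scope.
Variables (C : numClosedFieldType) (m : nat).
Implicit Types (M N : 'M[C]_m) (y : 'rV[C]_m).

(* Diagonalizing [N], the trace is a sum of values of [M] at eigenvectors of
   [N], and an eigenvector with nonzero eigenvalue lies in the image of [N]. *)
Lemma trace_psd_ge0 M N : N^t* = N -> (forall y, 0 <= (y *m N *m y^t*) 0 0) ->
  (forall y, 0 <= (y *m N *m M *m (y *m N)^t*) 0 0) -> 0 <= \tr (M *m N).
Proof.
move=> hN N0 MN0.
have /orthomx_spectralP eN : N \is normalmx by apply/normalmxP; rewrite hN.
set P := spectralmx N in eN; set d := spectral_diag N in eN.
have uP : P \is unitarymx by exact: spectral_unitarymx.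
rewrite (invmx_unitary uP) in eN.
have /unitarymxP PP := uP.
have PN : P *m N = diag_mx d *m P by rewrite {1}eN !mulmxA PP mul1mx.
have dE i : row i P *m N = d 0 i *: row i P.
  by rewrite -row_mul PN row_mul; apply/rowP => j; rewrite !mxE; under eq_bigr do rewrite !mxE;
    rewrite (bigD1 i) //= eqxx big1 ?addr0 // => k /negbTE ki; rewrite eq_sym ki mul0r.
have nP i : (row i P *m (row i P)^t*) 0 0 = 1.
  have : (P *m P^t*) i i = 1 by rewrite PP mxE eqxx.
  rewrite mxE => <-; rewrite mxE.
  by apply: eq_bigr => k _; rewrite !mxE.
have d0 i : 0 <= d 0 i.
  by have := N0 (row i P); rewrite dE -scalemxAl mxE nP mulr1.
have trE : \tr (M *m N) = \sum_i d 0 i * (row i P *m M *m (row i P)^t*) 0 0.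
  rewrite {1}eN mulmxA mxtrace_mulC !mulmxA /mxtrace; apply: eq_bigr => i _.
  rewrite mxE (bigD1 i) //= big1 ?addr0; last first.
    by move=> k /negbTE ki; rewrite [diag_mx d k i]mxE ki mulr0.
  rewrite [diag_mx d i i]mxE eqxx mulr1n mulrC; congr (_ * _).
  rewrite [LHS]mxE [RHS]mxE; apply: eq_bigr => k _; rewrite -row_mul !mxE.
  by congr (_ * _); rewrite !mxE.
rewrite trE sumr_ge0 // => i _.
have [->|dn0] := eqVneq (d 0 i) 0; first by rewrite mul0r.
have := MN0 (row i P); rewrite dE -scalemxAl linearZ map_mxZ /= -scalemxAr -scalemxAl !mxE.
rewrite (CrealP (ger0_real (d0 i))) => h; move: h.
have dp : 0 < d 0 i by rewrite lt_def dn0 d0.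
by rewrite pmulr_rge0.
Qed.

End TracePsd.

Section ComplexForm.
Local Open Scope sesquilinear_scope.
Variables (R : realType) (n : nat).
Local Notation C := (R[i]).
Implicit Types (T U W : tensor R n) (phi psi : 'M[C]_n) (A B : 'M[R]_n).
Local Notation rc := (real_complex R).
Local Notation conj := (@Num.conj C).

Definition cten T : 'M[C]_#|{: 'I_n * 'I_n}| := map_mx rc T.
Definition cvec phi : 'rV[C]_#|{: 'I_n * 'I_n}| := \row_x phi (enum_val x).1 (enum_val x).2.
Definition cform T phi psi : C := (cvec phi *m cten T *m (cvec psi)^t*) 0 0.

Lemma conj_rc (x : R) : conj (rc x) = rc x. Proof. exact: conjc_real. Qed.

Lemma cvecE phi i j y : cvec phi y (enum_rank (i, j)) = phi i j.
Proof. by rewrite mxE enum_rankK. Qed.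

Lemma cvec_surj (y : 'rV[C]_#|{: 'I_n * 'I_n}|) : y = cvec (\matrix_(i, j) y 0 (enum_rank (i, j))).
Proof. by apply/rowP => x; rewrite !mxE -surjective_pairing enum_valK. Qed.

Lemma cformE T phi psi : cform T phi psi =
  \sum_i \sum_j \sum_k \sum_l rc (tcoef T i j k l) * phi i j * conj (psi k l).
Proof.
rewrite /cform mxE sum_pairs.
under eq_bigr => k _ do under eq_bigr => l _ do rewrite mxE sum_pairs mulr_suml.
under eq_bigr => k _ do rewrite exchange_big /=.
rewrite exchange_big; apply: eq_bigr => i _ /=.
under eq_bigr => k _ do under eq_bigr => l _ do rewrite mulr_suml.
under eq_bigr => k _ do rewrite exchange_big /=.
rewrite exchange_big; apply: eq_bigr => j _ /=.
apply: eq_bigr => k _; apply: eq_bigr => l _.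
by rewrite !mxE !enum_rankK /= /tcoef; congr (_ * _); rewrite mulrC.
Qed.

Lemma cvecD phi psi : cvec (phi + psi) = cvec phi + cvec psi.
Proof. by apply/rowP => x; rewrite !mxE. Qed.
Lemma cvecZ c phi : cvec (c *: phi) = c *: cvec phi.
Proof. by apply/rowP => x; rewrite !mxE. Qed.

Lemma cformDl T phi phi' psi : cform T (phi + phi') psi = cform T phi psi + cform T phi' psi.
Proof. by rewrite /cform cvecD !mulmxDl mxE. Qed.
Lemma cformZl T c phi psi : cform T (c *: phi) psi = c * cform T phi psi.
Proof. by rewrite /cform cvecZ -!scalemxAl mxE. Qed.
Lemma cformDr T phi psi psi' : cform T phi (psi + psi') = cform T phi psi + cform T phi psi'.
Proof. by rewrite /cform cvecD linearD map_mxD mulmxDr mxE. Qed.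
Lemma cformZr T c phi psi : cform T phi (c *: psi) = conj c * cform T phi psi.
Proof. by rewrite /cform cvecZ linearZ map_mxZ -scalemxAr mxE. Qed.
Lemma cformNl T phi psi : cform T (- phi) psi = - cform T phi psi.
Proof. by rewrite -scaleN1r cformZl mulN1r. Qed.
Lemma cformNr T phi psi : cform T phi (- psi) = - cform T phi psi.
Proof. by rewrite -scaleN1r cformZr rmorphN rmorph1 mulN1r. Qed.
Lemma cformDt T U phi psi : cform (T + U) phi psi = cform T phi psi + cform U phi psi.
Proof. by rewrite /cform /cten map_mxD mulmxDr mulmxDl mxE. Qed.
Lemma cform0l T psi : cform T 0 psi = 0.
Proof. by rewrite -(scale0r 0) cformZl mul0r. Qed.

Definition rform T A B : R := \sum_i \sum_j \sum_k \sum_l tcoef T i j k l * A i j * B k l.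

Lemma cform_rc T A B : cform T (map_mx rc A) (map_mx rc B) = rc (rform T A B).
Proof.
rewrite cformE /rform; do 4![rewrite rmorph_sum; apply: eq_bigr => ? _].
by rewrite !mxE conj_rc !rmorphM.
Qed.

Section Sym.
Variable T : tensor R n.
Hypothesis symT : curvature_symmetries T.

Lemma cformC phi psi : conj (cform T phi psi) = cform T psi phi.
Proof.
have eT : (cten T)^t* = cten T.
  apply/matrixP => x y; rewrite !mxE conj_rc -[x]enum_valK -[y]enum_valK.
  case: (enum_val x) (enum_val y) => i j [k l].
  by rewrite -!/(tcoef _ _ _ _ _) (cspair symT).
rewrite /cform -{2}[cvec phi]trmxCK -{1}eT.
have -> : conj ((cvec phi *m (cten T)^t* *m (cvec psi)^t*) 0 0) =
  ((cvec phi *m (cten T)^t* *m (cvec psi)^t*)^t*) 0 0 by rewrite [RHS]mxE [X in _ = conj X]mxE.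
by rewrite !trmx_mul !map_mxM !trmxCK mulmxA.
Qed.

Lemma rformC A B : rform T A B = rform T B A.
Proof. by apply: complexI; rewrite -!cform_rc -cformC cform_rc conj_rc -cform_rc. Qed.

Lemma cform_trl phi psi : cform T phi^T psi = - cform T phi psi.
Proof.
rewrite !cformE exchange_big -sumrN; apply: eq_bigr => i _; rewrite -sumrN; apply: eq_bigr => j _.
rewrite -sumrN; apply: eq_bigr => k _; rewrite -sumrN; apply: eq_bigr => l _.
by rewrite mxE (cs12 symT) rmorphN; ring.
Qed.

Lemma cform_trr phi psi : cform T phi psi^T = - cform T phi psi.
Proof. by rewrite -cformC cform_trl rmorphN /= cformC. Qed.

Lemma cform_symr phi psi : psi^T = psi -> cform T phi psi = 0.
Proof.
move=> e; have := cform_trr phi psi; rewrite e => h.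
by move/eqP: h; rewrite eq_sym eqNr => /eqP.
Qed.

Lemma cform_syml phi psi : phi^T = phi -> cform T phi psi = 0.
Proof. by move=> e; rewrite -cformC cform_symr // rmorph0. Qed.

Lemma cform_ReIm A B : cform T (map_mx rc A + 'i *: map_mx rc B) (map_mx rc A + 'i *: map_mx rc B) =
  rc (rform T A A + rform T B B).
Proof.
rewrite !cformDl !cformDr !cformZl !cformZr !cform_rc (rformC B A) conjCi rmorphD.
have := sqrCi C; rewrite expr2 => e.
have -> : 'i * (- 'i * rc (rform T B B)) = rc (rform T B B) by rewrite mulrA mulrN e opprK mul1r.
rewrite mulNr; ring.
Qed.

Lemma cmx_ReIm phi : exists A B, phi = map_mx rc A + 'i *: map_mx rc B.
Proof.
exists (map_mx (@complex.Re R) phi), (map_mx (@complex.Im R) phi).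
by apply/matrixP => i j; rewrite !mxE [LHS]complexE.
Qed.

Lemma rform_antisym A : rform T (A - A^T) (A - A^T) = 4 * rform T A A.
Proof.
have e : map_mx rc (A - A^T) = map_mx rc A - (map_mx rc A)^T.
  by apply/matrixP => i j; rewrite !mxE rmorphB.
apply: complexI; rewrite -cform_rc e cformDl !cformDr !cformNl !cformNr.
rewrite !cform_trl !cform_trr !cform_rc rmorphM rmorph_nat /=; ring.
Qed.

Lemma tensor_nonnegP : tensor_nonneg T <-> forall A, 0 <= rform T A A.
Proof.
split=> [h A|h phi _].
  have /h : forall i j, (map_mx rc (A - A^T)) i j = - (map_mx rc (A - A^T)) j i.
    by move=> i j; rewrite !mxE -rmorphN opprB.
  by rewrite -cformE cform_rc ler0c rform_antisym pmulr_rge0.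
rewrite -cformE; have [A [B ->]] := cmx_ReIm phi.
by rewrite cform_ReIm ler0c addr_ge0.
Qed.

End Sym.

Lemma cform_conj T phi psi : cform T (map_mx conj phi) (map_mx conj psi) = conj (cform T phi psi).
Proof.
rewrite !cformE; do 4![rewrite rmorph_sum; apply: eq_bigr => ? _].
by rewrite !mxE !rmorphM /= conj_rc.
Qed.

End ComplexForm.

Section Adjoint.
Local Open Scope sesquilinear_scope.
Variables (F : numClosedFieldType) (m p : nat).
Implicit Types (A : 'M[F]_(m, p)) (B : 'M[F]_p).

Lemma adjoint_conj A B : B^t* = B -> (A *m B *m A^t* )^t* = A *m B *m A^t*.
Proof. by move=> hB; rewrite !trmx_mul !map_mxM /= trmxCK hB mulmxA. Qed.

Lemma quad_conj k q (y : 'M[F]_(k, q)) (Y : 'M[F]_(q, m)) A B :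
  y *m (Y *m (A *m B *m A^t* ) *m Y^t* ) *m y^t* = (y *m Y *m A) *m B *m (y *m Y *m A)^t*.
Proof. by rewrite !trmx_mul !map_mxM /= !mulmxA. Qed.

End Adjoint.

Section SharpForm.
Local Open Scope sesquilinear_scope.
Variables (R : realType) (n : nat).
Local Notation C := (R[i]).
Implicit Types (T U W : tensor R n) (phi psi X Y : 'M[C]_n).
Local Notation rc := (real_complex R).
Local Notation conj := (@Num.conj C).
Local Notation P := #|{: 'I_n * 'I_n}|.

(** Acting from the right on the row vector of X, this matrix is X -> X phi, and [asym] below is X
    -> X - X^T. *)
Definition rmul phi : 'M[C]_P :=
  \matrix_(x, y) (((enum_val x).1 == (enum_val y).1)%:R * phi (enum_val x).2 (enum_val y).2).

Definition asym : 'M[C]_P :=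
  \matrix_(x, y) ((x == y)%:R - (enum_val x == ((enum_val y).2, (enum_val y).1))%:R).

Lemma mul_rmul m (A : 'M[C]_(m, P)) phi x a j :
  (A *m rmul phi) x (enum_rank (a, j)) = \sum_b A x (enum_rank (a, b)) * phi b j.
Proof.
rewrite mxE sum_pairs exchange_big; apply: eq_bigr => b _.
under eq_bigr do rewrite mxE !enum_rankK /= mulrCA mulrC -mulrA.
rewrite (bigD1 a) //= eqxx mulr1 big1 ?addr0 1?mulrC // => i /negbTE ->.
by rewrite mulr0 mulr0.
Qed.

Lemma cvec_rmul X phi : cvec X *m rmul phi = cvec (X *m phi).
Proof.
apply/rowP => y; rewrite -[y]enum_valK; case: (enum_val y) => a j.
by rewrite mul_rmul cvecE mxE; apply: eq_bigr => b _; rewrite cvecE.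
Qed.

Lemma mul_asym m (A : 'M[C]_(m, P)) x a b :
  (A *m asym) x (enum_rank (a, b)) = A x (enum_rank (a, b)) - A x (enum_rank (b, a)).
Proof.
rewrite mxE; under eq_bigr do rewrite mxE mulrBr enum_rankK /=.
rewrite sumrB sum_delta_r; congr (_ - _).
rewrite (bigD1 (enum_rank (b, a))) //= enum_rankK eqxx mulr1 big1 ?addr0 // => z zn.
case: eqP => [e|_]; last by rewrite mulr0.
by move: zn; rewrite -e enum_valK eqxx.
Qed.

Lemma cvec_asym X : cvec X *m asym = cvec (X - X^T).
Proof.
apply/rowP => y; rewrite -[y]enum_valK; case: (enum_val y) => a b.
by rewrite mul_asym !cvecE !mxE.
Qed.

Lemma asym_tr : asym^t* = asym.
Proof.
apply/matrixP => x y; rewrite !mxE rmorphB !rmorph_nat (eq_sym y x).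
rewrite -[x]enum_valK -[y]enum_valK !enum_rankK.
case: (enum_val x) (enum_val y) => i j [k l] /=.
by rewrite !xpair_eqE (eq_sym k) (eq_sym l) andbC.
Qed.

Lemma rmul_tr phi : (rmul phi)^t* = rmul (phi^t*).
Proof. by apply/matrixP => x y; rewrite !mxE rmorphM rmorph_nat eq_sym. Qed.

Lemma cten_herm U : curvature_symmetries U -> (cten U)^t* = cten U.
Proof.
move=> symU; apply/matrixP => x y; rewrite !mxE conj_rc -[x]enum_valK -[y]enum_valK.
case: (enum_val x) (enum_val y) => i j [k l].
by rewrite -!/(tcoef _ _ _ _ _) (cspair symU).
Qed.

Lemma cten_asym U : curvature_symmetries U -> cten U *m asym = 2 *: cten U.
Proof.
move=> symU; apply/matrixP => x y; rewrite -[x]enum_valK -[y]enum_valK.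
case: (enum_val x) (enum_val y) => i j [k l].
rewrite mul_asym !mxE -!/(tcoef _ _ _ _ _) (cs34 symU i j l k) rmorphN; ring.
Qed.

(** The matrix of the hermitian form X -> U(X phi, X phi). Tracing it against W gives the bilinear
    sharp of W and U at phi, see [cross_form_tr]. *)
Definition sharpN U phi : 'M[C]_P := rmul phi *m cten U *m (rmul phi)^t*.

Definition cross_form W U phi : C :=
  \sum_i \sum_j \sum_k \sum_l rc (sharp_form W U i j k l) * phi i j * conj (phi k l).

Lemma sharpNE U phi p i q k : sharpN U phi (enum_rank (p, i)) (enum_rank (q, k)) =
  \sum_l \sum_j rc (tcoef U p j q l) * phi i j * conj (phi k l).
Proof.
rewrite /sharpN rmul_tr mul_rmul; apply: eq_bigr => l _.
have -> : rmul phi *m cten U = ((cten U)^T *m rmul phi^T)^T.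
  rewrite trmx_mul trmxK; congr (_ *m _); apply/matrixP => x y; rewrite !mxE.
  by rewrite eq_sym.
rewrite mxE mul_rmul mulr_suml; apply: eq_bigr => j _.
by rewrite !mxE.
Qed.

Lemma cross_form_tr W U phi : curvature_symmetries W -> curvature_symmetries U ->
  cross_form W U phi = \tr (cten W *m sharpN U phi).
Proof.
move=> symW symU; rewrite /cross_form /mxtrace sum_pairs.
under [RHS]eq_bigr => q _ do under eq_bigr => k _ do rewrite mxE sum_pairs.
under [RHS]eq_bigr => q _ do under eq_bigr => k _ do under eq_bigr => p _ do under eq_bigr => i _ do rewrite sharpNE.
transitivity (\sum_i \sum_j \sum_k \sum_l \sum_p \sum_q
   rc (tcoef W q k p i) * (rc (tcoef U p j q l) * phi i j * conj (phi k l))).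
  do 4![apply: eq_bigr => ? _]; rewrite rmorph_sum !mulr_suml; apply: eq_bigr => p _.
  rewrite rmorph_sum !mulr_suml; apply: eq_bigr => q _; rewrite rmorphM.
  by rewrite (cspair symW) (csflip symW) (csflip symU); ring.
symmetry.
under eq_bigr => q _ do under eq_bigr => k _ do under eq_bigr => p _ do under eq_bigr => i _ do rewrite mulr_sumr.
under eq_bigr => q _ do under eq_bigr => k _ do under eq_bigr => p _ do under eq_bigr => i _ do under eq_bigr => l _ do rewrite mulr_sumr.
(* The sums, in the order q, k, p, i, l, j, are permuted to i, j, k, l, p, q. *)
under eq_bigr => q _ do under eq_bigr => k _ do rewrite exchange_big /=.
under eq_bigr => q _ do rewrite exchange_big /=.
rewrite exchange_big; apply: eq_bigr => i _ /=.
under eq_bigr => q _ do under eq_bigr => k _ do under eq_bigr => p _ do rewrite exchange_big /=.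
under eq_bigr => q _ do under eq_bigr => k _ do rewrite exchange_big /=.
under eq_bigr => q _ do rewrite exchange_big /=.
rewrite exchange_big; apply: eq_bigr => j _ /=.
rewrite exchange_big; apply: eq_bigr => k _ /=.
under eq_bigr => q _ do rewrite exchange_big /=.
rewrite exchange_big; apply: eq_bigr => l _ /=.
rewrite exchange_big; apply: eq_bigr => p _; apply: eq_bigr => q _.
by rewrite mxE.
Qed.

(** The sharp product is a trace of W against N, the compression of [sharpN] to antisymmetric
    matrices. N is nonnegative by [hU], its image consists of antisymmetrizations of V phi^* with V
    antisymmetric, and there W is nonnegative by [hW]. So [trace_psd_ge0] applies although neither W
    nor U need be nonnegative. The factor 4 appears because [asym] acts on W as 2 on either side. *)
Lemma cross_form_ge0 W U phi : curvature_symmetries W -> curvature_symmetries U ->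
  (forall X, X^T = - X -> 0 <= cform U (X *m phi) (X *m phi)) ->
  (forall V, V^T = - V -> 0 <= cform W (V *m phi^t*) (V *m phi^t*)) ->
  0 <= cross_form W U phi.
Proof.
move=> symW symU hU hW; rewrite cross_form_tr //.
pose N := asym *m sharpN U phi *m asym^t*.
have aT (X : 'M[C]_n) : (X - X^T)^T = - (X - X^T) by rewrite linearB /= trmxK opprB.
have ctN : \tr (cten W *m N) = 4 * \tr (cten W *m sharpN U phi).
  rewrite /N asym_tr !mulmxA mxtrace_mulC !mulmxA.
  have -> : asym *m cten W = 2 *: cten W.
    have := congr1 (fun A : 'M[C]_P => A^t*) (cten_asym symW).
    by rewrite /= trmx_mul map_mxM /= asym_tr cten_herm // linearZ map_mxZ /= cten_herm // rmorph_nat.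
  rewrite -!scalemxAl cten_asym // -!scalemxAl !linearZ /=; ring.
have -> : \tr (cten W *m sharpN U phi) = 4^-1 * \tr (cten W *m N).
  by rewrite ctN mulKf // pnatr_eq0.
rewrite mulr_ge0 ?invr_ge0 //; apply: trace_psd_ge0.
- by do 2![apply: adjoint_conj]; exact: cten_herm.
- move=> y; rewrite (cvec_surj y); move: (\matrix_(_, _) _) => X.
  by rewrite /N /sharpN quad_conj cvec_asym cvec_rmul; exact: hU (aT X).
- move=> y; rewrite (cvec_surj y); move: (\matrix_(_, _) _) => X.
  (* V is the matrix of the row vector (X - X^T) phi U; it is antisymmetric because U is so in its
     last two slots. *)
  have [V aV eV] : exists2 V : 'M[C]_n, V^T = - V & cvec X *m N = cvec (V *m phi^t* - (V *m phi^t*)^T).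
    pose v := cvec ((X - X^T) *m phi) *m cten U.
    exists (\matrix_(i, j) v 0 (enum_rank (i, j))).
      apply/matrixP => i j; rewrite !mxE -sumrN; apply: eq_bigr => x _.
      rewrite -mulrN; congr (_ * _); rewrite !mxE -[x]enum_valK; case: (enum_val x) => k l.
      by rewrite -!/(tcoef _ _ _ _ _) (cs34 symU) rmorphN.
    rewrite -cvec_asym -cvec_rmul -cvec_surj /v -cvec_rmul -cvec_asym.
    by rewrite /N /sharpN asym_tr rmul_tr !mulmxA.
  rewrite eV -/(cform W _ _).
  set Z := V *m _.
  have -> : cform W (Z - Z^T) (Z - Z^T) = 4 * cform W Z Z.
    rewrite cformDl !cformDr !cformNl !cformNr !cform_trl // !cform_trr //; ring.
  by rewrite mulr_ge0 ?hW.
Qed.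

Lemma cform_sharp T phi : curvature_symmetries T -> phi^T = - phi ->
  cform (tensor_sharp T) phi phi = 4 * cross_form T T phi.
Proof.
move=> symT aphi; rewrite cformE /cross_form.
have ephi k l : phi l k = - phi k l by have := congr1 (fun A : 'M[C]_n => A k l) aphi; rewrite !mxE.
rewrite mulr_sumr; apply: eq_bigr => i _; rewrite mulr_sumr; apply: eq_bigr => j _.
have -> : \sum_k \sum_l rc (tcoef (tensor_sharp T) i j k l) * phi i j * conj (phi k l) =
  2 * (\sum_k \sum_l rc (sharp_form T T i j k l) * phi i j * conj (phi k l))
  - 2 * (\sum_k \sum_l rc (sharp_form T T i j l k) * phi i j * conj (phi k l)).
  rewrite !mulr_sumr -sumrB; apply: eq_bigr => k _; rewrite !mulr_sumr -sumrB; apply: eq_bigr => l _.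
  by rewrite tcoef_sharp rmorphM rmorphB rmorph_nat; ring.
have -> : \sum_k \sum_l rc (sharp_form T T i j l k) * phi i j * conj (phi k l) =
   - \sum_k \sum_l rc (sharp_form T T i j k l) * phi i j * conj (phi k l).
  rewrite exchange_big -sumrN; apply: eq_bigr => k _; rewrite -sumrN; apply: eq_bigr => l _.
  by rewrite (ephi k l) rmorphN mulrN.
ring.
Qed.

Lemma cross_formDl W W' U phi : cross_form (W + W') U phi = cross_form W U phi + cross_form W' U phi.
Proof.
rewrite /cross_form -big_split; apply: eq_bigr => i _; rewrite -big_split; apply: eq_bigr => j _.
rewrite -big_split; apply: eq_bigr => k _; rewrite -big_split; apply: eq_bigr => l _ /=.
rewrite -!mulrDl -rmorphD; congr (rc _ * _ * _); rewrite -big_split; apply: eq_bigr => p _.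
by rewrite -big_split; apply: eq_bigr => q _; rewrite tcoefD mulrDl.
Qed.

Lemma cross_formC W U phi : phi^T = - phi -> cross_form W U phi = cross_form U W phi.
Proof.
move=> aphi; have ephi k l : phi l k = - phi k l by have := congr1 (fun A : 'M[C]_n => A k l) aphi; rewrite !mxE.
rewrite /cross_form exchange_big; apply: eq_bigr => i _; apply: eq_bigr => j _.
rewrite exchange_big; apply: eq_bigr => k _; apply: eq_bigr => l _.
by rewrite sharp_formC (ephi i j) (ephi k l) rmorphN; ring.
Qed.

(** This is (U + T)^2 - T^2 = (U + 2 T) U for the symmetric bilinear sharp product. One factor is
    now U, to which the second variation applies. *)
Lemma cform_sharpB U T phi : curvature_symmetries U -> curvature_symmetries T -> phi^T = - phi ->
  cform (tensor_sharp (U + T)) phi phi - cform (tensor_sharp T) phi phi = 4 * cross_form (U + T + T) U phi.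
Proof.
move=> symU symT aphi; rewrite !cform_sharp //; last exact: csD.
rewrite !cross_formDl (cross_formC U (U + T)) // (cross_formC T (U + T)) // !cross_formDl.
by rewrite (cross_formC T U) //; ring.
Qed.

Lemma cform_sharp_ge0 T phi : curvature_symmetries T -> tensor_nonneg T -> phi^T = - phi ->
  0 <= cform (tensor_sharp T) phi phi.
Proof.
move=> symT /(tensor_nonnegP symT) T0 aphi.
have cT0 X : 0 <= cform T X X.
  by have [A [B ->]] := cmx_ReIm X; rewrite cform_ReIm // ler0c addr_ge0.
by rewrite cform_sharp // mulr_ge0 //; apply: cross_form_ge0.
Qed.

End SharpForm.

(** * Second variation over isotropic planes *)

Section Outer.
Variables (K : comPzRingType) (n : nat).
Implicit Types (z w : 'rV[K]_n) (c : K).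

Definition outer z w : 'M[K]_n := z^T *m w.
Definition bdot z w : K := (z *m w^T) 0 0.

Lemma outerE z w i j : outer z w i j = z 0 i * w 0 j.
Proof. by rewrite mxE big_ord1 mxE. Qed.

Lemma outer_tr z w : (outer z w)^T = outer w z.
Proof. by rewrite /outer trmx_mul trmxK. Qed.

Lemma bdotC z w : bdot z w = bdot w z.
Proof. by rewrite /bdot -[z *m w^T]trmxK mxE trmx_mul trmxK. Qed.
Lemma bdotDl z z' w : bdot (z + z') w = bdot z w + bdot z' w.
Proof. by rewrite /bdot mulmxDl mxE. Qed.
Lemma bdotZl c z w : bdot (c *: z) w = c * bdot z w.
Proof. by rewrite /bdot -scalemxAl mxE. Qed.
Lemma bdotNl z w : bdot (- z) w = - bdot z w.
Proof. by rewrite -scaleN1r bdotZl mulN1r. Qed.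
Lemma bdotDr z w w' : bdot z (w + w') = bdot z w + bdot z w'.
Proof. by rewrite bdotC bdotDl !(bdotC _ z). Qed.
Lemma bdotZr c z w : bdot z (c *: w) = c * bdot z w.
Proof. by rewrite bdotC bdotZl bdotC. Qed.
Lemma bdotNr z w : bdot z (- w) = - bdot z w.
Proof. by rewrite bdotC bdotNl bdotC. Qed.

(** The coefficients of c^m in the curve of [outer_curve]. The factor 1 + c rho preserves isotropy
    and adds rho z w^T to the velocity, which makes up for the components of zeta along z and of eta
    along w. *)
Definition curve_coef (z w zeta eta z2 w2 : 'rV[K]_n) (rho : K) (m : nat) : 'M[K]_n := match m with
  | 0 => outer z w
  | 1 => outer zeta w + outer z eta + rho *: outer z w
  | 2 => outer z2 w + outer zeta eta + outer z w2 + rho *: (outer zeta w + outer z eta)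
  | 3 => outer z2 eta + outer zeta w2 + rho *: (outer z2 w + outer zeta eta + outer z w2)
  | 4 => outer z2 w2 + rho *: (outer z2 eta + outer zeta w2)
  | _ => rho *: outer z2 w2 end.

Lemma outer_curve (z w zeta eta z2 w2 : 'rV[K]_n) (rho c : K) :
  \sum_(m < 6) c ^+ m *: curve_coef z w zeta eta z2 w2 rho m =
   (1 + c * rho) *: outer (z + c *: zeta + c ^+ 2 *: z2) (w + c *: eta + c ^+ 2 *: w2).
Proof.
apply/matrixP => i j; rewrite !big_ord_recl big_ord0 /= /bump /= ?add1n.
by do ?rewrite ?outerE mxE; rewrite ?outerE; ring.
Qed.

Lemma outer_tangent (z w zeta eta : 'rV[K]_n) (r r' c c' : K) :
  outer (zeta - r *: z - c *: w) w + outer z (eta - r' *: w - c' *: z) + (r + r') *: outer z w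
  = outer zeta w + outer z eta - c *: outer w w - c' *: outer z z.
Proof. by apply/matrixP => i j; do ?rewrite ?outerE mxE; rewrite ?outerE; ring. Qed.

(** The products of [Z] and [W] have no term of order c by tangency, none of order c^3 because zeta
    and eta are orthogonal to zb and wb, and none of order c^4 because zb and wb are isotropic. The
    numbers p1, p2, p3 are chosen to cancel the order c^2, so the curve is exactly isotropic and
    polynomial. *)
Lemma isotropic_curve (z w zb wb zeta eta : 'rV[K]_n) (c p1 p2 p3 : K) :
  bdot z z = 0 -> bdot z w = 0 -> bdot w w = 0 ->
  bdot zb zb = 0 -> bdot zb wb = 0 -> bdot wb wb = 0 ->
  bdot z zb = 2 -> bdot w wb = 2 -> bdot z wb = 0 -> bdot w zb = 0 ->
  bdot zeta z = 0 -> bdot eta w = 0 -> bdot zeta w + bdot z eta = 0 ->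
  bdot zeta zb = 0 -> bdot zeta wb = 0 -> bdot eta zb = 0 -> bdot eta wb = 0 ->
  bdot zeta zeta = - (4 * p1) -> bdot zeta eta = - (2 * p2) -> bdot eta eta = - (4 * p3) ->
  let Z := z + c *: zeta + c ^+ 2 *: (p1 *: zb + p2 *: wb) in
  let W := w + c *: eta + c ^+ 2 *: (p3 *: wb) in
  [/\ bdot Z Z = 0, bdot Z W = 0 & bdot W W = 0].
Proof.
move=> i1 i2 i3 j1 j2 j3 zzb wwb zwb wzb c1 c2 c3 c4 c5 c6 c7 ep1 ep2 ep3 Z W.
rewrite /Z /W !(bdotDl, bdotDr, bdotZl, bdotZr).
rewrite ?(bdotC zb z) ?(bdotC wb z) ?(bdotC wb w) ?(bdotC zb w) ?(bdotC w z) ?(bdotC eta z) ?(bdotC eta zeta).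
rewrite ?(bdotC wb zb) ?(bdotC zb zeta) ?(bdotC wb zeta) ?(bdotC zb eta) ?(bdotC wb eta) ?(bdotC w eta) ?(bdotC w zeta).
rewrite (bdotC z zeta) i1 i2 i3 j1 j2 j3 zzb wwb zwb wzb ep1 ep2 ep3 c1 c2 c4 c5 c6 c7.
have -> : bdot zeta w = - bdot z eta by apply/eqP; rewrite -addr_eq0 c3.
by split; ring.
Qed.

Lemma tangent_normal (z w zb wb zeta eta : 'rV[K]_n) (r r' c c' : K) :
  bdot z z = 0 -> bdot z w = 0 -> bdot w w = 0 ->
  bdot z zb = 2 -> bdot w wb = 2 -> bdot z wb = 0 -> bdot w zb = 0 ->
  bdot zeta z = 0 -> bdot eta w = 0 -> bdot zeta w + bdot z eta = 0 ->
  bdot zeta zb = r * 2 -> bdot zeta wb = c * 2 -> bdot eta wb = r' * 2 -> bdot eta zb = c' * 2 ->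
  let Z := zeta - r *: z - c *: w in let W := eta - r' *: w - c' *: z in
  [/\ bdot Z z = 0, bdot W w = 0 & bdot Z w + bdot z W = 0] /\
  [/\ bdot Z zb = 0, bdot Z wb = 0, bdot W zb = 0 & bdot W wb = 0].
Proof.
move=> i1 i2 i3 zzb wwb zwb wzb c1 c2 c3 er ec er' ec' Z W.
rewrite /Z /W !(bdotDl, bdotDr, bdotNl, bdotNr, bdotZl, bdotZr) (bdotC w z).
rewrite i1 i2 i3 zzb wwb zwb wzb c1 c2 er ec er' ec' !mulr0 !subr0 c3.
by rewrite !subrr.
Qed.

End Outer.

Section SecondVariation.
Local Open Scope sesquilinear_scope.
Variables (R : realType) (n : nat).
Local Notation C := (R[i]).
Local Notation rc := (real_complex R).
Local Notation conj := (@Num.conj C).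

Lemma poly_sqr_ge0 (A B0 B1 B2 B3 : R) :
  (forall t : R, 0 < t -> t <= 1 ->
     0 <= t ^+ 2 * A + t ^+ 4 * (B0 + t ^+ 2 * B1 + t ^+ 4 * B2 + t ^+ 6 * B3)) -> 0 <= A.
Proof.
move=> h; rewrite leNgt; apply/negP => A0.
pose K := `|B0| + `|B1| + `|B2| + `|B3| + 1.
have K0 : 0 < K by rewrite /K ltr_pwDr // !addr_ge0.
pose t := Num.min 1 (- A / (2 * K)).
have t0 : 0 < t by rewrite lt_min ltr01 divr_gt0 ?mulr_gt0 // oppr_gt0.
have t1 : t <= 1 by rewrite ge_min lexx.
have tK : 2 * (t * K) <= - A.
  have : t <= - A / (2 * K) by rewrite ge_min lexx orbT.
  by rewrite ler_pdivlMr ?mulr_gt0 // mulrCA.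
have := h t t0 t1; apply/negP; rewrite -ltNge.
have -> : t ^+ 2 * A + t ^+ 4 * (B0 + t ^+ 2 * B1 + t ^+ 4 * B2 + t ^+ 6 * B3) =
  t ^+ 2 * (A + t ^+ 2 * (B0 + t ^+ 2 * B1 + t ^+ 4 * B2 + t ^+ 6 * B3)) by ring.
rewrite pmulr_rlt0 ?exprn_gt0 //.
have bX (m : nat) (x : R) : t ^+ m * x <= `|x|.
  have tm : 0 <= t ^+ m by rewrite exprn_ge0 // ltW.
  apply: (le_trans (ler_norm _)); rewrite normrM (ger0_norm tm).
  by rewrite ler_piMl // exprn_ile1 // ltW.
have b : B0 + t ^+ 2 * B1 + t ^+ 4 * B2 + t ^+ 6 * B3 <= K.
  rewrite /K; have := bX 2 B1; have := bX 4 B2; have := bX 6 B3; have := ler_norm B0; lra.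
have : t ^+ 2 * (B0 + t ^+ 2 * B1 + t ^+ 4 * B2 + t ^+ 6 * B3) <= t * K.
  apply: (le_trans (ler_wpM2l _ b)); first by rewrite exprn_ge0 // ltW.
  by rewrite ler_pM2r // expr2 ler_piMl // ltW.
have := mulr_gt0 t0 K0; lra.
Qed.

(* Averaging over [c = t, -t, it, -it] keeps only the terms with
   [m = n] modulo 4. *)
Lemma quartic_average (h : nat -> nat -> C) : (forall m p, h p m = conj (h m p)) ->
  h 0 0 = 0 ->
  (forall c : C, 0 <= \sum_(m < 6) \sum_(p < 6) c ^+ m * conj c ^+ p * h m p) ->
  0 <= h 1 1.
Proof.
move=> hC h00 hpos.
have hR (m : nat) : h m m = rc (complex.Re (h m m)).
  by rewrite RRe_real // CrealE -hC.
have hD (m p : nat) : h m p + h p m = rc (complex.Re (h m p + h p m)).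
  by rewrite RRe_real // CrealE rmorphD /= -!hC addrC.
rewrite (hR 1) ler0c.
apply: (@poly_sqr_ge0 _ (complex.Re (h 2 2) + complex.Re (h 4 0 + h 0 4))
  (complex.Re (h 3 3) + complex.Re (h 5 1 + h 1 5)) (complex.Re (h 4 4)) (complex.Re (h 5 5))).
move=> t t0 t1.
rewrite -ler0c !(rmorphD, rmorphM, rmorphXn) /= -!hD -!hR.
(* Treating conj c as an independent variable d makes the averaging a polynomial identity: c and -c
   leave only c^2, d^2 and c d in [E], and passing from c = t to c = it changes the sign of the
   first two. *)
pose G (c d : C) : C := \sum_(m < 6) \sum_(p < 6) c ^+ m * d ^+ p * h m p.
have G0 (c : C) : 0 <= G c (conj c) by exact: hpos.
pose E (x y z : C) : C := h 0 0 + x * h 2 0 + y * h 0 2 + x * y * h 2 2 + z * h 1 1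
   + x ^+ 2 * h 4 0 + y ^+ 2 * h 0 4 + x ^+ 2 * y * h 4 2 + x * y ^+ 2 * h 2 4
   + x ^+ 2 * y ^+ 2 * h 4 4 + z * (x * h 3 1 + y * h 1 3 + x * y * h 3 3
   + x ^+ 2 * h 5 1 + y ^+ 2 * h 1 5 + x ^+ 2 * y * h 5 3 + x * y ^+ 2 * h 3 5
   + x ^+ 2 * y ^+ 2 * h 5 5).
have GE (c d : C) : G c d + G (- c) (- d) = 2 * E (c ^+ 2) (d ^+ 2) (c * d).
  by rewrite /G !big_ord_recl !big_ord0 /= /bump /= ?add1n /E; ring.
have s1 : 0 <= E (rc t ^+ 2) (rc t ^+ 2) (rc t ^+ 2).
  rewrite -(pmulr_rge0 _ (ltr0n _ 2)) expr2 -[X in E X]expr2 -[X in E _ X]expr2 -GE addr_ge0 //.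
    by have := G0 (rc t); rewrite conj_rc.
  by have := G0 (rc (- t)); rewrite conj_rc rmorphN.
have s2 : 0 <= E (- rc t ^+ 2) (- rc t ^+ 2) (rc t ^+ 2).
  have -> : rc t ^+ 2 = 'i * rc t * (- 'i * rc t).
    by transitivity (- 'i ^+ 2 * rc t ^+ 2); [rewrite sqrCi opprK mul1r|ring].
  have -> : - ('i * rc t * (- 'i * rc t)) = ('i * rc t) ^+ 2 by ring.
  have e : ('i * rc t) ^+ 2 = (- 'i * rc t) ^+ 2 by ring.
  rewrite {2}e -(pmulr_rge0 _ (ltr0n _ 2)) -GE addr_ge0 //.
    by have := G0 ('i * rc t); rewrite rmorphM /= conj_rc conjCi.
  by have := G0 ('i * rc (- t)); rewrite rmorphM /= conj_rc conjCi rmorphN !mulrN.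
have := addr_ge0 s1 s2; rewrite /E h00.
move: (rc t) => x s; rewrite -(pmulr_rge0 _ (ltr0n _ 2)); apply: le_trans s _.
by rewrite le_eqVlt; apply/orP; left; apply/eqP; ring.
Qed.

Definition isotropic (z w : 'rV[C]_n) := [/\ bdot z z = 0, bdot z w = 0 & bdot w w = 0].

Variable U : tensor R n.
Hypothesis symU : curvature_symmetries U.
Hypothesis U_iso : forall z w, isotropic z w -> 0 <= cform U (outer z w) (outer z w).

Section NullPair.
Variables z w zb wb : 'rV[C]_n.
Hypotheses (izw : isotropic z w) (ib : isotropic zb wb).
Hypotheses (zzb : bdot z zb = 2) (wwb : bdot w wb = 2) (zwb : bdot z wb = 0) (wzb : bdot w zb = 0).
Hypothesis null : cform U (outer z w) (outer z w) = 0.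

(* The curve [z + c zeta + c^2 z2, w + c eta + c^2 w2] stays isotropic, and [z2, w2] do not
   contribute to the first derivative. *)
Lemma second_variation_perp zeta eta (rho : C) :
  bdot zeta z = 0 -> bdot eta w = 0 -> bdot zeta w + bdot z eta = 0 ->
  bdot zeta zb = 0 -> bdot zeta wb = 0 -> bdot eta zb = 0 -> bdot eta wb = 0 ->
  0 <= cform U (outer zeta w + outer z eta + rho *: outer z w)
         (outer zeta w + outer z eta + rho *: outer z w).
Proof.
move=> c1 c2 c3 c4 c5 c6 c7; set phi := outer zeta w + _ + _.
have [p1 ep1] : exists p1, bdot zeta zeta = - (4 * p1).
  by exists (- (bdot zeta zeta / 4)); field.
have [p2 ep2] : exists p2, bdot zeta eta = - (2 * p2).
  by exists (- (bdot zeta eta / 2)); field.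
have [p3 ep3] : exists p3, bdot eta eta = - (4 * p3).
  by exists (- (bdot eta eta / 4)); field.
pose z2 := p1 *: zb + p2 *: wb; pose w2 := p3 *: wb.
pose Psi := curve_coef z w zeta eta z2 w2 rho.
apply: (@quartic_average (fun m p => cform U (Psi m) (Psi p))) => //.
  by move=> m p; rewrite cformC.
move=> c.
have -> : \sum_(m < 6) \sum_(p < 6) c ^+ m * conj c ^+ p * cform U (Psi m) (Psi p) =
   cform U (\sum_(m < 6) c ^+ m *: Psi m) (\sum_(m < 6) c ^+ m *: Psi m).
  have suml (F : 'I_6 -> 'M[C]_n) Y : cform U (\sum_m F m) Y = \sum_m cform U (F m) Y.
    apply: (big_morph (fun X => cform U X Y)); last exact: cform0l.
    by move=> X X'; exact: cformDl.
  have sumr (F : 'I_6 -> 'M[C]_n) Y : cform U Y (\sum_m F m) = \sum_m cform U Y (F m).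
    by rewrite -cformC // suml rmorph_sum; apply: eq_bigr => m _; rewrite /= cformC.
  rewrite suml; apply: eq_bigr => m _; rewrite sumr; apply: eq_bigr => p _.
  by rewrite cformZl cformZr rmorphXn; ring.
rewrite /Psi outer_curve cformZl cformZr mulrA mulr_ge0 ?mul_conjC_ge0 //; apply: U_iso.
have [i1 i2 i3] := izw; have [j1 j2 j3] := ib.
exact: isotropic_curve.
Qed.

(** Subtracting from zeta and eta their components in the span of z and w reduces to
    [second_variation_perp]. The velocity changes by a multiple of z w^T, absorbed by rho, and by
    multiples of w w^T and z z^T, which U annihilates since they are symmetric. *)
Lemma second_variation zeta eta :
  bdot zeta z = 0 -> bdot eta w = 0 -> bdot zeta w + bdot z eta = 0 ->
  0 <= cform U (outer zeta w + outer z eta) (outer zeta w + outer z eta).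
Proof.
move=> c1 c2 c3; set phi := outer zeta w + _.
have half (x : C) : exists y, x = y * 2 by exists (x / 2); field.
have [r er] := half (bdot zeta zb); have [c ec] := half (bdot zeta wb).
have [r' er'] := half (bdot eta wb); have [c' ec'] := half (bdot eta zb).
have [i1 i2 i3] := izw.
have [[d1 d2 d3] [d4 d5 d6 d7]] := tangent_normal i1 i2 i3 zzb wwb zwb wzb c1 c2 c3 er ec er' ec'.
have := second_variation_perp (r + r') d1 d2 d3 d4 d5 d6 d7.
rewrite outer_tangent -/phi -addrA.
have symD (Y X : 'M[C]_n) : X^T = X -> cform U (Y + X) (Y + X) = cform U Y Y.
  move=> sX; rewrite !(cformDl, cformDr) (cform_symr symU Y sX) (cform_symr symU X sX).
  by rewrite (cform_syml symU Y sX) !addr0.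
rewrite symD //.
by rewrite linearB linearN !linearZ /= !outer_tr.
Qed.

End NullPair.
End SecondVariation.

Section Dot.
Variables (R : realType) (n : nat).
Implicit Types (u v w z : 'rV[R]_n).

Lemma dotE u v : dot u v = bdot u v.
Proof. by rewrite /bdot mxE; apply: eq_bigr => i _; rewrite mxE. Qed.

Lemma dotuu_ge0 u : 0 <= dot u u.
Proof. by apply: sumr_ge0 => i _; rewrite -expr2 sqr_ge0. Qed.

Lemma dotuu_eq0 u : dot u u = 0 -> u = 0.
Proof.
move=> /eqP; rewrite psumr_eq0 => [/allP h|i _]; last by rewrite -expr2 sqr_ge0.
apply/rowP => i; have := h i (mem_index_enum _); rewrite mulf_eq0 orbb mxE => /eqP; exact.
Qed.

Lemma dot_delta i v : dot (delta_mx 0 i) v = v 0 i.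
Proof.
rewrite /dot (bigD1 i) //= mxE !eqxx mul1r big1 ?addr0 // => j /negbTE ji.
by rewrite mxE ji andbF mul0r.
Qed.

Lemma orthonormal2 (e1 e2 : 'rV[R]_n) : dot e1 e1 = 1 -> dot e2 e2 = 1 -> dot e1 e2 = 0 -> orthonormal [:: e1; e2].
Proof.
move=> h1 h2 h12; have h21 : dot e2 e1 = 0 by rewrite dotE bdotC -dotE.
by do 2?[case=> //]; do 2?[case=> //].
Qed.

Lemma orthonormal4 (e1 e2 e3 e4 : 'rV[R]_n) :
  dot e1 e1 = 1 -> dot e2 e2 = 1 -> dot e3 e3 = 1 -> dot e4 e4 = 1 ->
  dot e1 e2 = 0 -> dot e1 e3 = 0 -> dot e1 e4 = 0 -> dot e2 e3 = 0 -> dot e2 e4 = 0 -> dot e3 e4 = 0 ->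
  orthonormal [:: e1; e2; e3; e4].
Proof.
move=> h1 h2 h3 h4 a b c d e f; have sw u v : dot u v = dot v u by rewrite !dotE bdotC.
have [a' b' c'] : [/\ dot e2 e1 = 0, dot e3 e1 = 0 & dot e4 e1 = 0] by split; rewrite sw.
have [d' e' f'] : [/\ dot e3 e2 = 0, dot e4 e2 = 0 & dot e4 e3 = 0] by split; rewrite sw.
by do 4?[case=> //]; do 4?[case=> //].
Qed.

End Dot.

Section RealForm.
Variables (R : realType) (n : nat).
Implicit Types (T U W : tensor R n) (A B : 'M[R]_n) (u v w z x y : 'rV[R]_n).

Lemma rformDl T A A' B : rform T (A + A') B = rform T A B + rform T A' B.
Proof.
rewrite /rform -big_split; apply: eq_bigr => i _; rewrite -big_split; apply: eq_bigr => j _.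
rewrite -big_split; apply: eq_bigr => k _; rewrite -big_split; apply: eq_bigr => l _ /=.
by rewrite mxE; ring.
Qed.

Lemma rformZl T (c : R) A B : rform T (c *: A) B = c * rform T A B.
Proof.
rewrite /rform mulr_sumr; apply: eq_bigr => i _; rewrite mulr_sumr; apply: eq_bigr => j _.
rewrite mulr_sumr; apply: eq_bigr => k _; rewrite mulr_sumr; apply: eq_bigr => l _.
by rewrite mxE; ring.
Qed.

Lemma rformNl T A B : rform T (- A) B = - rform T A B.
Proof. by rewrite -scaleN1r rformZl mulN1r. Qed.

Lemma rform_outer T x u y v : rform T (outer x u) (outer y v) = teval T x u y v.
Proof.
apply: eq_bigr => i _; apply: eq_bigr => j _; apply: eq_bigr => k _; apply: eq_bigr => l _.
by rewrite !outerE; ring.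
Qed.

Lemma teval_delta T i j k l :
  teval T (delta_mx 0 i) (delta_mx 0 j) (delta_mx 0 k) (delta_mx 0 l) = tcoef T i j k l.
Proof.
have -> : tcoef T i j k l = tcoef (rotT 1%:M T) i j k l by rewrite rot1.
by rewrite tcoef_rot_teval !row1.
Qed.

Lemma tevalZ T (a b c d : R) x u y v :
  teval T (a *: x) (b *: u) (c *: y) (d *: v) = a * b * c * d * teval T x u y v.
Proof.
rewrite /teval mulr_sumr; apply: eq_bigr => i _; rewrite mulr_sumr; apply: eq_bigr => j _.
rewrite mulr_sumr; apply: eq_bigr => k _; rewrite mulr_sumr; apply: eq_bigr => l _.
by rewrite !mxE; ring.
Qed.

Lemma teval34 T : curvature_symmetries T -> forall x u y v, teval T x u y v = - teval T x u v y.
Proof.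
move=> symT x u y v; rewrite /teval -sumrN; apply: eq_bigr => i _; rewrite -sumrN; apply: eq_bigr => j _.
rewrite exchange_big -sumrN; apply: eq_bigr => k _; rewrite -sumrN; apply: eq_bigr => l _.
by rewrite (cs34 symT); ring.
Qed.

(** The value of T at (x + iy) wedge (u + iv) paired with its conjugate, see [cform_outer_cx]; PIC
    is thus nonnegativity on isotropic planes. *)
Definition pic_form T x y u v : R :=
  teval T x u x u + teval T x v x v + teval T y u y u + teval T y v y v
  + 2 * teval T x u v y + 2 * teval T x v y u.

Definition pic_coef T (i j k l : 'I_n) : R :=
  tcoef T i k i k + tcoef T i l i l + tcoef T j k j k + tcoef T j l j l
  + 2 * tcoef T i k l j + 2 * tcoef T i l j k.

Lemma pic_form_delta T i j k l :
  pic_form T (delta_mx 0 i) (delta_mx 0 j) (delta_mx 0 k) (delta_mx 0 l) = pic_coef T i j k l.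
Proof. by rewrite /pic_form !teval_delta. Qed.

Lemma pic_formZ T (a c : R) x y u v :
  pic_form T (a *: x) (a *: y) (c *: u) (c *: v) = (a * c) ^+ 2 * pic_form T x y u v.
Proof. by rewrite /pic_form !tevalZ; ring. Qed.

Lemma pic_form_rform T : curvature_symmetries T -> forall x y u v,
  rform T (outer x u - outer y v) (outer x u - outer y v)
  + rform T (outer x v + outer y u) (outer x v + outer y u) = pic_form T x y u v.
Proof.
move=> symT x y u v; have C := rformC symT.
rewrite !rformDl !rformNl !(C _ (_ + _)) !rformDl !rformNl !rform_outer.
have sw a b c d : teval T a b c d = teval T c d a b by rewrite -!rform_outer C.
rewrite (sw y v x u) (sw y u x v) /pic_form (teval34 symT x u v y); ring.
Qed.

Section Complex.
Local Notation C := (R[i]).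
Local Notation rc := (real_complex R).
Local Notation cx x y := (map_mx rc x + 'i *: map_mx rc y).

Lemma bdot_rc x y : bdot (map_mx rc x) (map_mx rc y) = rc (dot x y).
Proof. by rewrite /bdot mxE rmorph_sum; apply: eq_bigr => i _; rewrite !mxE rmorphM. Qed.

Lemma outer_cx x y u v : outer (cx x y) (cx u v) =
  map_mx rc (outer x u - outer y v) + 'i *: map_mx rc (outer x v + outer y u).
Proof.
apply/matrixP => i j; rewrite outerE !mxE !big_ord1 !mxE !(rmorphD, rmorphN, rmorphM) /=.
have := sqrCi C; rewrite expr2 => e.
rewrite mulrDr !mulrDl -!addrA; congr (_ + _).
rewrite mulrACA e mulN1r; ring.
Qed.

Lemma cform_outer_cx T : curvature_symmetries T -> forall x y u v,
  cform T (outer (cx x y) (cx u v)) (outer (cx x y) (cx u v)) = rc (pic_form T x y u v).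
Proof. by move=> symT x y u v; rewrite outer_cx cform_ReIm // pic_form_rform. Qed.

Lemma rc_i_eq0 (a b : R) : rc a + 'i * rc b = 0 -> a = 0 /\ b = 0.
Proof.
move=> e; have := complexE (a +i* b)%C; rewrite /= -/(rc a) -/(rc b) => e2.
have : (a +i* b)%C = 0 by rewrite e2.
by case.
Qed.

Lemma bdot_cx x y u v : bdot (cx x y) (cx u v) =
  rc (dot x u - dot y v) + 'i * rc (dot x v + dot y u).
Proof.
rewrite !(bdotDl, bdotDr, bdotZl, bdotZr) !bdot_rc !(rmorphD, rmorphN) /=.
have := sqrCi C; rewrite expr2 => e.
by rewrite [X in _ + (_ + X)]mulrA e mulN1r; ring.
Qed.

Lemma cx_surj (z : 'rV[C]_n) : exists x y : 'rV[R]_n, z = cx x y.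
Proof.
exists (map_mx (@complex.Re R) z), (map_mx (@complex.Im R) z).
by apply/rowP => j; rewrite !mxE [LHS]complexE.
Qed.

(** A multiple of z subtracted from w changes z w^T by a symmetric matrix, so w may be taken
    orthogonal to conj z. Isotropy then makes the real and imaginary parts of z and w orthogonal and
    of equal length within each vector, and scaling gives an orthonormal four-frame. *)
Lemma PIC_isotropic U : curvature_symmetries U -> PIC U ->
  forall z w : 'rV[C]_n, isotropic z w -> 0 <= cform U (outer z w) (outer z w).
Proof.
move=> symU picU z w; have [x [y ->]] := cx_surj z => -[zz zw ww].
move: zz; rewrite bdot_cx => /rc_i_eq0[/eqP]; rewrite subr_eq0 => /eqP xx.
have sw (a b : 'rV[R]_n) : dot a b = dot b a by rewrite !dotE bdotC.
rewrite (sw y x) => /eqP; rewrite -mulr2n mulrn_eq0 /= => /eqP xy.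
have [x0|xn0] := eqVneq (dot x x) 0.
  have /dotuu_eq0 -> := x0; have /dotuu_eq0 -> : dot y y = 0 by rewrite -xx.
  by rewrite /outer map_mx0 scaler0 addr0 trmx0 mul0mx cform0l.
have xp : 0 < dot x x by rewrite lt_def xn0 dotuu_ge0.
pose mu := bdot w (cx x (- y)) / bdot (cx x y) (cx x (- y)).
have dNr a b : dot a (- b) = - dot a b by rewrite !dotE bdotNr.
have dz : bdot (cx x y) (cx x (- y)) = rc (2 * dot x x).
  by rewrite bdot_cx !dNr -xx xy (sw y x) xy oppr0 addr0 rmorph0 mulr0 addr0 opprK; congr rc; ring.
have dz0 : bdot (cx x y) (cx x (- y)) != 0.
  by rewrite dz (inj_eq (@complexI R) _ 0) mulf_neq0 // pnatr_eq0.
pose w' := w - mu *: cx x y.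
have symo (t : 'rV[C]_n) : (outer t t)^T = outer t t by rewrite outer_tr.
have -> : cform U (outer (cx x y) w) (outer (cx x y) w) = cform U (outer (cx x y) w') (outer (cx x y) w').
  have -> : outer (cx x y) w' = outer (cx x y) w + (- mu) *: outer (cx x y) (cx x y).
    by apply/matrixP => i j; rewrite /w' !outerE; do ?rewrite ?outerE mxE; rewrite ?outerE; ring.
  have sX : (- mu *: outer (cx x y) (cx x y))^T = - mu *: outer (cx x y) (cx x y) by rewrite linearZ /= symo.
  by rewrite !(cformDl, cformDr) !(cform_symr symU _ sX) (cform_syml symU _ sX) !addr0.
have zz : bdot (cx x y) (cx x y) = 0.
  by rewrite bdot_cx xx subrr (sw y x) xy addr0 rmorph0 mulr0 addr0.
have w1 : bdot (cx x y) w' = 0 by rewrite /w' bdotDr bdotNr bdotZr zw zz mulr0 subr0.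
have w2 : bdot w' w' = 0.
  by rewrite {1}/w' bdotDl bdotNl bdotZl w1 mulr0 subr0 /w' bdotDr bdotNr bdotZr ww bdotC zw mulr0 subr0.
have w3 : bdot (cx x (- y)) w' = 0.
  by rewrite bdotC /w' bdotDl bdotNl bdotZl /mu divfK // subrr.
clearbody w'; have [u [v we]] := cx_surj w'; rewrite we in w1 w2 w3 *.
have /rc_i_eq0[h1 h2] := etrans (esym (bdot_cx x y u v)) w1.
have /rc_i_eq0[h3 h4] := etrans (esym (bdot_cx u v u v)) w2.
have /rc_i_eq0[h5 h6] := etrans (esym (bdot_cx x (- y) u v)) w3.
have dNl a b : dot (- a) b = - dot a b by rewrite !dotE bdotNl.
rewrite !dNl in h5 h6; rewrite (sw v u) in h4.
rewrite cform_outer_cx // ler0c.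
have [u0|un0] := eqVneq (dot u u) 0.
  have /dotuu_eq0 -> := u0; have /dotuu_eq0 -> : dot v v = 0 by lra.
  by have := pic_formZ U 1 0 x y 0 0; rewrite !scaler0 !scale1r => ->; rewrite mulr0 expr0n mul0r.
have up : 0 < dot u u by rewrite lt_def un0 dotuu_ge0.
pose a := Num.sqrt (dot x x); pose c := Num.sqrt (dot u u).
have a0 : a != 0 by rewrite sqrtr_eq0 -ltNge.
have c0 : c != 0 by rewrite sqrtr_eq0 -ltNge.
have aa : a ^+ 2 = dot x x by rewrite sqr_sqrtr // ltW.
have cc : c ^+ 2 = dot u u by rewrite sqr_sqrtr // ltW.
have -> : pic_form U x y u v = (a * c) ^+ 2 * pic_form U (a^-1 *: x) (a^-1 *: y) (c^-1 *: u) (c^-1 *: v).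
  by rewrite -pic_formZ !scalerA !mulfV // !scale1r.
rewrite mulr_ge0 ?sqr_ge0 //; apply: picU.
have dZ (s t : R) p q : dot (s *: p) (t *: q) = s * t * dot p q.
  by rewrite !dotE bdotZl bdotZr mulrA.
have e1 : a^-1 * a^-1 * dot x x = 1 by rewrite -aa; field.
have e2 : c^-1 * c^-1 * dot u u = 1 by rewrite -cc; field.
have vv : dot v v = dot u u by lra.
have [z1 [z2 [z3 [z4 z5]]]] : dot x u = 0 /\ dot x v = 0 /\ dot y u = 0 /\ dot y v = 0 /\ dot u v = 0.
  by move: h1 h2 h3 h4 h5 h6; clear => *; do !split; lra.
by apply: orthonormal4; rewrite !dZ -?xx ?vv ?e1 ?e2 ?xy ?z1 ?z2 ?z3 ?z4 ?z5 ?mulr0.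
Qed.

Lemma nonnegD_PIC U T : curvature_symmetries T -> PIC U -> tensor_nonneg T -> PIC (U + T).
Proof.
move=> symT pU /(tensor_nonnegP symT) T0 e1 e2 e3 e4 o.
have -> : forall X, teval X e1 e3 e1 e3 + teval X e1 e4 e1 e4 + teval X e2 e3 e2 e3 + teval X e2 e4 e2 e4
    + 2 * teval X e1 e3 e4 e2 + 2 * teval X e1 e4 e2 e3 = pic_form X e1 e2 e3 e4 by [].
have tD a b c d : teval (U + T) a b c d = teval U a b c d + teval T a b c d.
  rewrite /teval -big_split; apply: eq_bigr => i _; rewrite -big_split; apply: eq_bigr => j _.
  rewrite -big_split; apply: eq_bigr => k _; rewrite -big_split; apply: eq_bigr => l _ /=.
  by rewrite tcoefD; ring.
have -> : pic_form (U + T) e1 e2 e3 e4 = pic_form U e1 e2 e3 e4 + pic_form T e1 e2 e3 e4.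
  by rewrite /pic_form !tD; ring.
by apply: addr_ge0; [exact: pU|rewrite -pic_form_rform // addr_ge0].
Qed.

(** For antisymmetric complex X, the matrix X phi is the velocity of the isotropic plane (z, w)
    under the infinitesimal rotation X. The second variation at the zero of U therefore gives U >= 0
    on all X phi. This is the hypothesis of [cross_form_ge0] for U, and with T >= 0 also that for W
    = U + T + T. *)
Lemma pic_sharp_ge0 U T i j k l : uniq [:: i; j; k; l] ->
  curvature_symmetries U -> PIC U -> curvature_symmetries T -> tensor_nonneg T ->
  pic_coef U i j k l = 0 ->
  0 <= pic_coef (tensor_sharp (U + T) - tensor_sharp T) i j k l.
Proof.
move=> un symU pU symT T0 null.
have symD := csD symU symT.
pose e (m : 'I_n) : 'rV[R]_n := delta_mx 0 m.
pose z := cx (e i) (e j); pose w := cx (e k) (e l).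
pose zb := cx (e i) (- e j); pose wb := cx (e k) (- e l).
have de p q : dot (e p) (e q) = (p == q)%:R by rewrite dot_delta mxE /= eq_sym.
have dNr a b : dot a (- b) = - dot a b :> R by rewrite !dotE bdotNr.
have dNl a b : dot (- a) b = - dot a b :> R by rewrite !dotE bdotNl.
have [[ij ik il] [jk jl kl]] : [/\ i != j, i != k & i != l] /\ [/\ j != k, j != l & k != l].
  by move: un; rewrite /= !inE !negb_or andbT => /and3P[/and3P[-> -> ->] /andP[-> ->] ->].
have D := (bdot_cx, dNr, dNl, de, eqxx, negbTE ij, negbTE ik, negbTE il, negbTE jk, negbTE jl, negbTE kl,
  eq_sym j i, eq_sym k i, eq_sym l i, eq_sym k j, eq_sym l j, eq_sym l k).
have izw : isotropic z w by split; rewrite /z /w !D !(subrr, addr0, oppr0) /= ?rmorph0 ?mulr0 ?addr0.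
have izb : isotropic zb wb by split; rewrite /zb /wb !D ?(subrr, addr0, oppr0, opprK, addNr) /= ?rmorph0 ?mulr0 ?addr0.
have zzb : bdot z zb = 2.
  by rewrite /z /zb !D ?(subrr, addr0, oppr0, opprK, addNr) rmorph0 mulr0 addr0 -natrD rmorph_nat.
have wwb : bdot w wb = 2.
  by rewrite /w /wb !D ?(subrr, addr0, oppr0, opprK, addNr) rmorph0 mulr0 addr0 -natrD rmorph_nat.
have zwb : bdot z wb = 0.
  by rewrite /z /wb !D ?(subrr, addr0, oppr0, opprK, addNr) rmorph0 mulr0 addr0.
have wzb : bdot w zb = 0.
  by rewrite /w /zb !D ?(subrr, addr0, oppr0, opprK, addNr) rmorph0 mulr0 addr0.
have cz W : curvature_symmetries W -> cform W (outer z w) (outer z w) = rc (pic_coef W i j k l).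
  by move=> symW; rewrite cform_outer_cx // pic_form_delta.
clearbody z w zb wb; clear D.
pose phi := outer z w - outer w z.
have aphi : phi^T = - phi by rewrite /phi linearB /= !outer_tr opprB.
have cphi W : curvature_symmetries W -> cform W phi phi = rc (4 * pic_coef W i j k l).
  move=> symW; rewrite /phi -(outer_tr z w); move: (outer z w) (cz W symW) => Y cY.
  rewrite !(cformDl, cformDr, cformNl, cformNr) !cform_trl // !cform_trr //.
  by rewrite cY rmorphM rmorph_nat; ring.
have nul : cform U (outer z w) (outer z w) = 0.
  by rewrite cz // null rmorph0.
have U_iso := PIC_isotropic symU pU.
have sv X : X^T = - X -> 0 <= cform U (X *m phi) (X *m phi).
  move=> aX.
  have -> : X *m phi = - (outer (z *m X) w - outer (w *m X) z).
    by rewrite /phi /outer mulmxBr !mulmxA !trmx_mul aX !mulNmx opprB opprK addrC.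
  have bX a c : bdot (a *m X) c = - bdot (c *m X) a.
    rewrite /bdot; have -> : c *m X *m a^T = - (a *m X *m c^T)^T.
      by rewrite !trmx_mul trmxK aX mulNmx mulmxN opprK mulmxA.
    by rewrite [X in _ = - X]mxE [X in _ = - - X]mxE opprK.
  have b0 a : bdot (a *m X) a = 0 by apply/eqP; have /eqP := bX a a; rewrite -addr_eq0 -mulr2n mulrn_eq0.
  have -> : cform U (- (outer (z *m X) w - outer (w *m X) z)) (- (outer (z *m X) w - outer (w *m X) z)) =
    cform U (outer (z *m X) w + outer z (w *m X)) (outer (z *m X) w + outer z (w *m X)).
    rewrite -(outer_tr z (w *m X)); move: (outer (z *m X) w) (outer z (w *m X)) => Y Y'.
    by rewrite !(cformDl, cformDr, cformNl, cformNr) !(cform_trl symU) !(cform_trr symU); ring.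
  apply: (second_variation symU U_iso izw izb) => //.
  by rewrite (bdotC z) bX addNr.
have -> : pic_coef (tensor_sharp (U + T) - tensor_sharp T) i j k l =
  pic_coef (tensor_sharp (U + T)) i j k l - pic_coef (tensor_sharp T) i j k l.
  by rewrite /pic_coef !tcoefE; ring.
have sTs := cs_sharp symT; have sDs := cs_sharp symD.
rewrite -(pmulr_rge0 _ (ltr0n _ 4)) -ler0c mulrBr rmorphB /= -(cphi _ sTs) -(cphi _ sDs).
rewrite (cform_sharpB symU symT aphi); apply: mulr_ge0; first exact: ler0n.
apply: (cross_form_ge0 (csD symD symT) symU sv).
move=> V aV.
have cT0 X : 0 <= cform T X X.
  by have [A [B ->]] := cmx_ReIm X; rewrite cform_ReIm // ler0c; apply: addr_ge0; apply: (proj1 (tensor_nonnegP symT) T0).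
have ephi a c : phi a c = - phi c a by have := congr1 (fun M : 'M[C]_n => M c a) aphi; rewrite !mxE.
clear cz cphi nul; clearbody phi.
rewrite !cformDt -addrA; apply: addr_ge0; last by rewrite addr_ge0.
(* V phi^* is, up to sign, the conjugate of (conj V) phi with conj V antisymmetric, and U is real.
   So the second variation [sv] applies again. *)
have -> : V *m map_mx Num.conj phi^T = map_mx Num.conj (- (map_mx Num.conj V *m phi)).
  apply/matrixP => a c; rewrite !mxE rmorphN rmorph_sum -sumrN; apply: eq_bigr => d _.
  by rewrite rmorphM /= !mxE conjCK ephi rmorphN mulrN.
rewrite cform_conj cformNl cformNr opprK conjC_ge0.
by apply: sv; apply/matrixP => a c; rewrite !mxE -rmorphN; congr Num.conj; have := congr1 (fun M : 'M[C]_n => M a c) aV; rewrite !mxE.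
Qed.

End Complex.
End RealForm.

(** * Sectional curvatures of PIC tensors *)

Section PairSums.
Variables (R : realFieldType) (I : finType).
Implicit Types (A : {set I}) (h : I -> R) (g : I -> I -> R).

Lemma sum_setD1 A p h : p \in A -> \sum_(q in A | q != p) h q = \sum_(q in A) h q - h p.
Proof. by move=> Ap; rewrite [\sum_(q in A) h q](bigD1 p) //=; ring. Qed.

Lemma sum_pairs_neq A h : \sum_(p in A) \sum_(q in A | q != p) (h p + h q) =
  2 * (#|A|%:R - 1) * \sum_(p in A) h p.
Proof.
transitivity (\sum_(p in A) ((#|A|%:R - 2) * h p + \sum_(q in A) h q)); last first.
  by rewrite big_split /= -mulr_sumr sumr_const -mulr_natl; ring.
apply: eq_bigr => p Ap; rewrite sum_setD1 // big_split /= sumr_const -mulr_natl; ring.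
Qed.

Lemma pairwise_sum_ge0 A h : (1 < #|A|)%N ->
  (forall p q, p \in A -> q \in A -> q != p -> 0 <= h p + h q) -> 0 <= \sum_(p in A) h p.
Proof.
move=> cA hh; have c0 : 0 < 2 * (#|A|%:R - 1) :> R by rewrite mulr_gt0 // subr_gt0 ltr1n.
rewrite -(pmulr_rge0 _ c0) -sum_pairs_neq; apply: sumr_ge0 => p Ap.
by apply: sumr_ge0 => q /andP[Aq qp]; exact: hh.
Qed.

(* At most one [h p] is negative, and its weight is at most the sum of the others. *)
Lemma pairwise_weighted_ge0 A h (w : I -> R) :
  (forall p q, p \in A -> q \in A -> q != p -> 0 <= h p + h q) ->
  (forall p, p \in A -> 0 <= w p) -> (forall p, p \in A -> 2 * w p <= \sum_(q in A) w q) ->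
  0 <= \sum_(p in A) h p * w p.
Proof.
move=> hh w0 wp.
have [[p Ap hp]|hN] := pselect (exists2 p, p \in A & h p < 0); last first.
  apply: sumr_ge0 => p Ap; rewrite mulr_ge0 ?w0 // leNgt; apply/negP => hp.
  by apply: hN; exists p.
rewrite (bigD1 p) //=.
have : - h p * (\sum_(q in A | q != p) w q) <= \sum_(q in A | q != p) h q * w q.
  rewrite mulr_sumr; apply: ler_sum => q /andP[Aq qp]; rewrite ler_wpM2r ?w0 //.
  by rewrite -subr_ge0 opprK addrC hh.
have := wp p Ap; rewrite sum_setD1 // => h1.
have : 0 <= - h p * (\sum_(q in A) w q - w p - w p) by rewrite mulr_ge0 //; lra.
lra.
Qed.

Section Quadruple.
Variables (A : {set I}) (g : I -> I -> R).
Hypothesis g_sym : forall p q, g p q = g q p.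
Hypothesis g_diag : forall p, g p p = 0.
Hypothesis g_quad : forall p q r t, p \in A -> q \in A -> r \in A -> t \in A ->
  uniq [:: p; q; r; t] -> 0 <= g p r + g p t + g q r + g q t.
Let G p := \sum_(r in A) g p r.

(** For fixed p and q the numbers g p r + g q r, with r among the other indices, have nonnegative
    pairwise sums; hence their total is nonnegative. *)
Lemma quad_row p q : (3 < #|A|)%N -> p \in A -> q \in A -> q != p -> 0 <= G p + G q - 2 * g p q.
Proof.
move=> cA Ap Aq qp.
have -> : G p + G q - 2 * g p q = \sum_(r in A :\ p :\ q) (g p r + g q r).
  have e h : \sum_(r in A :\ p :\ q) h r = \sum_(r in A) h r - h p - h q.
    have Aq' : q \in A :\ p by rewrite !inE qp.
    by rewrite [\sum_(r in A) h r](big_setD1 p Ap) (big_setD1 q Aq') /=; ring.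
  by rewrite big_split /= !e g_diag g_diag (g_sym q p) /G; ring.
apply: pairwise_sum_ge0.
  move: cA; rewrite (cardsD1 p) Ap (cardsD1 q) !inE qp Aq; lia.
move=> r t; rewrite !inE => /and3P[rq rp Ar] /and3P[tq tp At] tr.
have := @g_quad p q r t Ap Aq Ar At; rewrite /= !inE !negb_or andbT.
rewrite (eq_sym p q) qp (eq_sym p r) rp (eq_sym p t) tp (eq_sym q r) rq (eq_sym q t) tq (eq_sym r t) tr.
by move=> /(_ isT); lra.
Qed.

Lemma quad_rows : \sum_(p in A) \sum_(q in A | q != p) (G p + G q - 2 * g p q) =
  2 * (#|A|%:R - 2) * \sum_(p in A) G p.
Proof.
transitivity (\sum_(p in A) \sum_(q in A | q != p) (G p + G q) - 2 * \sum_(p in A) G p).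
  rewrite mulr_sumr -sumrB; apply: eq_bigr => p Ap; rewrite sumrB -mulr_sumr.
  by have -> : \sum_(q in A | q != p) g p q = G p by rewrite sum_setD1 // g_diag subr0.
by rewrite sum_pairs_neq; ring.
Qed.

Lemma quad_sum_ge0 : (3 < #|A|)%N -> 0 <= \sum_(p in A) \sum_(q in A) g p q.
Proof.
move=> cA; have c0 : 0 < 2 * (#|A|%:R - 2) :> R.
  by rewrite mulr_gt0 // subr_gt0 ltr_nat ltnW.
rewrite -(pmulr_rge0 _ c0) -quad_rows; apply: sumr_ge0 => p Ap.
by apply: sumr_ge0 => q /andP[Aq qp]; exact: quad_row.
Qed.

(** A zero total forces equality in every [quad_row], that is G p + G q = 2 g p q. Summing over q
    gives (#|A| - 4) G p = 0, hence the bound on #|A|. *)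
Lemma quad_sum_eq0 : (4 < #|A|)%N -> \sum_(p in A) \sum_(q in A) g p q = 0 ->
  forall p q, p \in A -> q \in A -> g p q = 0.
Proof.
move=> cA s0.
have row p q : p \in A -> q \in A -> q != p -> G p + G q = 2 * g p q.
  move=> Ap Aq qp; have cA' := ltnW cA.
  have := quad_rows; rewrite s0 mulr0 => /eqP; rewrite psumr_eq0; last first.
    by move=> p' Ap'; apply: sumr_ge0 => q' /andP[Aq' qp']; exact: quad_row.
  move=> /allP /(_ p (mem_index_enum _)); rewrite Ap /= psumr_eq0; last first.
    by move=> q' /andP[Aq' qp']; exact: quad_row.
  by move=> /allP /(_ q (mem_index_enum _)); rewrite Aq qp /= => /eqP; lra.
have G0 p : p \in A -> G p = 0.
  move=> Ap.
  have : \sum_(q in A | q != p) (G p + G q) = \sum_(q in A | q != p) (2 * g p q).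
    by apply: eq_bigr => q /andP[Aq qp]; exact: row.
  rewrite -mulr_sumr !sum_setD1 // g_diag subr0 -/(G p) big_split /= sumr_const -mulr_natl.
  rewrite -/(G _) s0 => e.
  have : (#|A|%:R - 4) * G p = 0 by move: e; rewrite /G; lra.
  by move=> /eqP; rewrite mulf_eq0 subr_eq0 (eqr_nat R _ 4) gtn_eqF //= => /eqP.
move=> p q Ap Aq; have [->|qp] := eqVneq q p; first exact: g_diag.
by have := row p q Ap Aq qp; rewrite !G0 //; lra.
Qed.

End Quadruple.
End PairSums.

Section Coordinates.
Variables (R : realType) (n : nat).
Implicit Types (S T U : tensor R n).
Local Notation N := (n%:R : R).

Definition sec S (i j : 'I_n) := tcoef S i j i j.

Lemma sec_sym S : curvature_symmetries S -> forall i j, sec S i j = sec S j i.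
Proof. by move=> symS i j; rewrite /sec (csflip symS). Qed.

Lemma sec_diag S : curvature_symmetries S -> forall i, sec S i i = 0.
Proof. by move=> symS i; rewrite /sec (cs_ii symS). Qed.

Lemma Ric_sec S i : Ric S i i = \sum_p sec S i p.
Proof. by rewrite mxE. Qed.

Lemma scal_sec S : scal S = \sum_i \sum_p sec S i p.
Proof. by apply: eq_bigr => i _; rewrite Ric_sec. Qed.

Let sumT (F : 'I_n -> R) : \sum_(p in [set: 'I_n]) F p = \sum_p F p.
Proof. by apply: eq_bigl => p; rewrite inE. Qed.

Section PIC.
Variable S : tensor R n.
Hypotheses (symS : curvature_symmetries S) (picS : PIC S).

Let orth_delta (c : R) i j k l : c ^+ 2 = 1 -> uniq [:: i; j; k; l] ->
  orthonormal [:: delta_mx 0 i; delta_mx 0 j; delta_mx 0 k; c *: delta_mx 0 l : 'rV[R]_n].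
Proof.
move=> c2; rewrite /= !inE !negb_or andbT => /and3P[/and3P[ij ik il] /andP[jk jl] kl].
have D a b : dot (delta_mx 0 a) (delta_mx 0 b) = (a == b)%:R :> R by rewrite dot_delta mxE /= eq_sym.
have DZ a b : dot (delta_mx 0 a) (c *: delta_mx 0 b) = c * (a == b)%:R :> R by rewrite dotE bdotZr -dotE D.
have DZZ a : dot (c *: delta_mx 0 a) (c *: delta_mx 0 a) = c ^+ 2 :> R by rewrite dotE bdotZl -dotE DZ eqxx mulr1 expr2.
by apply: orthonormal4; rewrite ?(DZZ, DZ, D) ?eqxx ?(negbTE ij, negbTE ik, negbTE il, negbTE jk, negbTE jl, negbTE kl) ?mulr0.
Qed.

Lemma pic_coef_ge0 i j k l : uniq [:: i; j; k; l] -> 0 <= pic_coef S i j k l.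
Proof.
move=> un; rewrite -pic_form_delta.
by have := picS (@orth_delta 1 i j k l (expr1n _ _) un); rewrite scale1r.
Qed.

(** Replacing e_l by -e_l reverses the two mixed terms, so the sum of the two PIC inequalities
    contains sectional curvatures only. *)
Lemma PIC_sec i j k l : uniq [:: i; j; k; l] -> 0 <= sec S i k + sec S i l + sec S j k + sec S j l.
Proof.
move=> un; have := pic_coef_ge0 un.
have := picS (@orth_delta (-1) i j k l (etrans (sqrrN 1) (expr1n _ _)) un).
have e24 (a b c d : 'rV[R]_n) : teval S a (-1 *: b) c (-1 *: d) = teval S a b c d.
  by have := tevalZ S 1 (-1) 1 (-1) a b c d; rewrite !scale1r => ->; ring.
have e3 (a b c d : 'rV[R]_n) : teval S a b (-1 *: c) d = - teval S a b c d.
  by have := tevalZ S 1 1 (-1) 1 a b c d; rewrite !scale1r => ->; ring.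
have e2 (a b c d : 'rV[R]_n) : teval S a (-1 *: b) c d = - teval S a b c d.
  by have := tevalZ S 1 (-1) 1 1 a b c d; rewrite !scale1r => ->; ring.
rewrite !e24 e3 e2 !teval_delta.
rewrite /pic_coef /sec; lra.
Qed.

Lemma PIC_scal_ge0 : (3 < n)%N -> 0 <= scal S.
Proof.
move=> n3; rewrite scal_sec; have := @quad_sum_ge0 R 'I_n [set: 'I_n] (sec S) (sec_sym symS) (sec_diag symS).
rewrite cardsT card_ord => /(_ _ n3) h.
have <- : \sum_(p in [set: 'I_n]) \sum_(q in [set: 'I_n]) sec S p q = \sum_i \sum_p sec S i p.
  by rewrite sumT; apply: eq_bigr => i _; rewrite sumT.
by apply: h => p q r t _ _ _ _; exact: PIC_sec.
Qed.

Lemma PIC_scal_eq0 : (4 < n)%N -> scal S = 0 -> forall i j, sec S i j = 0.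
Proof.
move=> n4; rewrite scal_sec => s0 i j.
have := @quad_sum_eq0 R 'I_n [set: 'I_n] (sec S) (sec_sym symS) (sec_diag symS).
rewrite cardsT card_ord; apply=> //; first by move=> p q r t _ _ _ _; exact: PIC_sec.
by rewrite -[RHS]s0 sumT; apply: eq_bigr => p _; rewrite sumT.
Qed.

(** The sectional curvatures of the pairs avoiding i sum to scal - 2 Ric_ii, to which [quad_sum_ge0]
    applies. *)
Lemma PIC_Ric_le i : (4 < n)%N -> 2 * Ric S i i <= scal S.
Proof.
move=> n4; have := @quad_sum_ge0 R 'I_n [set~ i] (sec S) (sec_sym symS) (sec_diag symS).
rewrite cardsC1 card_ord => h.
have : 0 <= \sum_(p in [set~ i]) \sum_(q in [set~ i]) sec S p q.
  by apply: h; [move=> p q r t _ _ _ _; exact: PIC_sec|case: (n) n4].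
have e (F : 'I_n -> R) : \sum_(p in [set~ i]) F p = \sum_p F p - F i.
  rewrite [\sum_p F p](bigD1 i) //= [F i + _]addrC addrK; apply: eq_bigl => p; by rewrite !inE.
rewrite e; under eq_bigr do rewrite e.
rewrite e sumrB -scal_sec sec_diag // subr0 -Ric_sec.
have -> : \sum_i0 sec S i0 i = Ric S i i by rewrite Ric_sec; apply: eq_bigr => p _; rewrite sec_sym.
lra.
Qed.

Section Pair.
Variables i j : 'I_n.
Hypotheses (ij : j != i) (n6 : (5 < n)%N).

Lemma sum_rest (F : 'I_n -> R) : \sum_(p | (p != i) && (p != j)) F p = \sum_p F p - F i - F j.
Proof.
rewrite [\sum_p F p](bigD1 i) //= [\sum_(p | p != i) F p](bigD1 j) //=.
ring.
Qed.

Lemma in_rest p : (p \in [set q | (q != i) && (q != j)]) = (p != i) && (p != j).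
Proof. by rewrite inE. Qed.

Lemma card_rest : #|[set q | (q != i) && (q != j)]| = (n - 2)%N.
Proof.
have -> : [set q | (q != i) && (q != j)] = [set~ i] :\ j by apply/setP => p; rewrite !inE andbC.
have := cardsD1 j [set~ i]; rewrite !inE ij cardsC1 card_ord; move: n6; lia.
Qed.

(** [PIC_sec] for {i, p} against {j, q} contains the curvature of the plane i, j for all p and q.
    Averaging over p and q in the complement, and using that the total curvature [Gs] of the
    complement is nonnegative, eliminates everything but scal. *)
Lemma PIC_sec_ge : - 2 * sec S i j * (N - 3) <= scal S.
Proof.
pose B := [set q | (q != i) && (q != j)].
have cB : (#|B|%:R : R) = N - 2 by rewrite card_rest natrB // ; move: n6; lia.
have n6' : 6 <= N by rewrite (ler_nat R 6).
have eB (F : 'I_n -> R) : \sum_(p in B) F p = \sum_p F p - F i - F j.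
  by rewrite -sum_rest; apply: eq_bigl => p; rewrite in_rest.
pose Gs := \sum_(p in B) \sum_(q in B) sec S p q.
have G0 : 0 <= Gs.
  apply: quad_sum_ge0; [exact: sec_sym|exact: sec_diag|by move=> p q r t _ _ _ _; exact: PIC_sec|].
  by rewrite card_rest; move: n6; lia.
have h : 0 <= \sum_(p in B) \sum_(q in B | q != p) (sec S i j + sec S i q + sec S p j + sec S p q).
  apply: sumr_ge0 => p; rewrite in_rest => /andP[pi pj]; apply: sumr_ge0 => q.
  rewrite in_rest => /andP[/andP[qi qj] qp].
  have := @PIC_sec i p j q; apply.
  by rewrite /= !inE !negb_or eq_sym pi eq_sym ij eq_sym qi pj (eq_sym p) qp (eq_sym j) qj.
have sc (x : R) : \sum_(q in B) x = (N - 2) * x by rewrite sumr_const -[LHS]mulr_natl cB.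
have [a ea0] : exists a, a = \sum_(q in B) sec S i q by eexists.
have [c ec0] : exists c, c = \sum_(p in B) sec S p j by eexists.
have e : \sum_(p in B) \sum_(q in B | q != p) (sec S i j + sec S i q + sec S p j + sec S p q)
  = (N - 2) * (N - 3) * sec S i j + (N - 3) * (a + c) + Gs.
  transitivity (\sum_(p in B) ((N - 3) * sec S i j + (a - sec S i p) + (N - 3) * sec S p j + \sum_(q in B) sec S p q)).
    apply: eq_bigr => p Bp; rewrite (sum_setD1 _ Bp) big_split /= big_split /= big_split /=.
    rewrite !sc -ea0 (sec_diag symS p); ring.
  rewrite big_split /= big_split /= big_split /= sumrB !sc -ea0 -mulr_sumr -ec0 -/Gs; ring.
have ea : a = Ric S i i - sec S i j by rewrite ea0 eB -Ric_sec (sec_diag symS); ring.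
have ec : c = Ric S j j - sec S i j.
  rewrite ec0 eB (sec_diag symS) Ric_sec; have -> : \sum_p sec S p j = \sum_p sec S j p.
    by apply: eq_bigr => p _; rewrite (sec_sym symS).
  ring.
have eG : Gs = scal S - 2 * Ric S i i - 2 * Ric S j j + 2 * sec S i j.
  rewrite /Gs eB; under eq_bigr do rewrite eB; rewrite !sumrB -scal_sec !eB (sec_diag symS i) (sec_diag symS j).
  have e1 x : \sum_p sec S p x = Ric S x x by rewrite Ric_sec; apply: eq_bigr => p _; rewrite (sec_sym symS).
  rewrite !e1 -!Ric_sec (sec_sym symS j i); ring.
move: h; rewrite e.
have -> : a + c = (scal S - 2 * sec S i j - Gs) / 2 by rewrite ea ec eG; field.
clear e eG; clearbody Gs; move: (sec S i j) (scal S) Gs G0 => K s G G0 h.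
have : 0 <= (N - 3) * ((N - 3) * (2 * K) + s) - (N - 5) * G by lra.
have : 0 <= (N - 5) * G by rewrite mulr_ge0 //; lra.
move=> p1 p2; have : 0 <= (N - 3) * ((N - 3) * (2 * K) + s) by lra.
rewrite pmulr_rge0; lra.
Qed.

End Pair.
End PIC.
End Coordinates.

(** * Compactness and orthonormal frames *)

Section Continuity.
Local Open Scope classical_set_scope.
Local Open Scope ring_scope.
Variables (R : realType).

Lemma continuous_sumr (X : topologicalType) (I : finType) (P : pred I) (f : I -> X -> R) :
  (forall i, continuous (f i)) -> continuous (fun x => \sum_(i | P i) f i x).
Proof.
move=> cf; apply: (continuous_big (op := +%R)) => [|i _]; last exact: cf.
by move=> z; apply: cvgD; [exact: cvg_fst|exact: cvg_snd].
Qed.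

Lemma continuousDr (X : topologicalType) (f g : X -> R) :
  continuous f -> continuous g -> continuous (fun x => f x + g x).
Proof. by move=> cf cg x; apply: continuousD; [exact: cf|exact: cg]. Qed.

Lemma continuousMr (X : topologicalType) (f g : X -> R) :
  continuous f -> continuous g -> continuous (fun x => f x * g x).
Proof. by move=> cf cg x; apply: continuousM; [exact: cf|exact: cg]. Qed.

Lemma continuousNr (X : topologicalType) (f : X -> R) :
  continuous f -> continuous (fun x => - f x).
Proof. by move=> cf x; apply: continuousN; exact: cf. Qed.

Lemma continuous_entry (X : topologicalType) m n (f : X -> 'M[R]_(m, n)) i j :
  continuous f -> continuous (fun x => f x i j).
Proof. by move=> cf x; apply: (@continuous_comp _ _ _ f (fun M : 'M[R]_(m, n) => M i j)); [exact: cf|exact: coord_continuous]. Qed.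

Lemma continuous_mx (X : topologicalType) m n (f : X -> 'M[R]_(m, n)) :
  (forall i j, continuous (fun x => f x i j)) -> continuous f.
Proof.
move=> cf x; rewrite /continuous_at => A [P hP sPA].
rewrite /fmap /nbhs_simpl /=.
have : \forall y \near x, forall i j, P i j (f y i j).
  apply: filter_forall => i; apply: filter_forall => j.
  exact: (cf i j x _ (hP i j)).
by apply: filterS => y hy; exact: sPA.
Qed.

Lemma closed_eqs (X : topologicalType) (I : Type) (f : I -> X -> R) (c : I -> R) :
  (forall i, continuous (f i)) -> closed [set x | forall i, f i x = c i].
Proof.
move=> cf; rewrite (_ : [set x | _] = \bigcap_i (f i @^-1` [set y | y = c i])); last first.
  by apply/seteqP; split => x /= h i; [move=> _|]; exact: h.
by apply: closed_bigI => i _; apply: preimage_closed; [move=> x _; exact: cf|exact: closed_eq].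
Qed.

Lemma compact_unit_box n (A : set 'rV[R]_n) : closed A ->
  (forall v, A v -> forall i, -1 <= v 0 i <= 1) -> compact A.
Proof.
move=> cA bA.
have cB : compact [set v : 'rV[R]_n | forall i, `[(-1 : R), 1]%classic (v ord0 i)].
  exact: (@rV_compact R n (fun=> `[(-1 : R), 1]%classic) (fun i => @segment_compact R (-1) 1)).
apply: (subclosed_compact cA cB).
by move=> v /bA h i; rewrite /= in_itv /=; exact: h.
Qed.

(** Near a zero of f the sum is nonnegative because g > 0 there; elsewhere f > 0 dominates for small
    t. The neighbourhood is joint in t and w, so that the step is uniform over nearby directions
    w. *)
Lemma compact_first_order (X W : topologicalType) (K : set X) (f : X -> R) (g : X * W -> R) (w0 : W) :
  compact K -> continuous f -> continuous g -> (forall x, K x -> 0 <= f x) ->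
  (forall x, K x -> f x = 0 -> 0 < g (x, w0)) ->
  \forall tw \near ((0 : R), w0), forall x, K x -> 0 <= tw.1 -> 0 <= f x + tw.1 * g (x, tw.2).
Proof.
move=> cK cf cg f0 g0.
have /compact_near_coveringP/near_covering_withinP := cK.
move=> /(_ _ (nbhs ((0 : R), w0)) (fun tw x => 0 <= tw.1 -> 0 <= f x + tw.1 * g (x, tw.2)) _); apply.
move=> x Kx.
have cg' : continuous (fun z : X * (R * W) => g (z.1, z.2.2)).
  move=> z; apply: (@continuous_comp _ _ _ (fun z : X * (R * W) => (z.1, z.2.2)) g); last exact: cg.
  apply: cvg_pair; first exact: cvg_fst.
  apply: (@continuous_comp _ _ _ snd snd); [exact: cvg_snd|exact: cvg_snd].
have cf' : continuous (fun z : X * (R * W) => f z.1).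
  by move=> z; apply: (@continuous_comp _ _ _ fst f); [exact: cvg_fst|exact: cf].
have ct : continuous (fun z : X * (R * W) => z.2.1).
  by move=> z; apply: (@continuous_comp _ _ _ snd fst); [exact: cvg_snd|exact: cvg_fst].
have := f0 _ Kx; rewrite le_eqVlt => /orP[/eqP fx|fx].
  have gx : 0 < g (x, w0) by apply: g0.
  have : \forall z \near (x, ((0 : R), w0)), 0 < g (z.1, z.2.2).
    exact: (@cvgr_gt R _ (nbhs (x, ((0 : R), w0))) _ _ _ (cg' (x, ((0 : R), w0))) 0 gx).
  apply: filterS => -[x' [t w]] /= gp Kx' t0.
  by rewrite addr_ge0 ?f0 // mulr_ge0 // ltW.
have cF : continuous (fun z : X * (R * W) => f z.1 + z.2.1 * g (z.1, z.2.2)).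
  by apply: continuousDr => //; apply: continuousMr.
have : \forall z \near (x, ((0 : R), w0)), 0 < f z.1 + z.2.1 * g (z.1, z.2.2).
  apply: (@cvgr_gt R _ (nbhs (x, ((0 : R), w0))) _ _ _ (cF (x, ((0 : R), w0))) 0).
  by rewrite /= mul0r addr0.
by apply: filterS => -[x' [t w]] /= gp _ _; exact: ltW.
Qed.

End Continuity.

Section Frames.
Local Open Scope classical_set_scope.
Local Open Scope ring_scope.
Variables (R : realType) (n : nat).
Implicit Types (A P : 'M[R]_n) (u v w : 'rV[R]_n) (s : seq 'rV[R]_n).

Lemma orthonormal_rcons s v : orthonormal s -> dot v v = 1 ->
  (forall i, (i < size s)%N -> dot v s`_i = 0) -> orthonormal (rcons s v).
Proof.
move=> os vv vs i j; rewrite size_rcons !ltnS !nth_rcons => hi hj.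
have sw (a b : 'rV[R]_n) : dot a b = dot b a by rewrite !dotE bdotC.
case: (ltngtP i (size s)) hi => // hi _; case: (ltngtP j (size s)) hj => // hj _.
- exact: os.
- by rewrite sw vs // ltn_eqF // hj.
- by rewrite vs // hi gtn_eqF.
- by rewrite vv hi hj eqxx.
Qed.

Lemma exists_unit_orth s : (size s < n)%N ->
  exists v, dot v v = 1 /\ forall i, (i < size s)%N -> dot v s`_i = 0.
Proof.
move=> sn; pose M := \matrix_(i < size s, j < n) s`_i 0 j.
pose K := kermx M^T.
have K0 : K != 0.
  rewrite -mxrank_eq0 mxrank_ker -lt0n subn_gt0; apply: leq_ltn_trans sn.
  by rewrite mxrank_tr rank_leq_row.
pose u := nz_row K.
have u0 : u != 0 by rewrite nz_row_eq0.
have uM : u *m M^T = 0 by apply/sub_kermxP; exact: nz_row_sub.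
have uu : 0 < dot u u.
  rewrite lt_def dotuu_ge0 andbT; apply/eqP => /dotuu_eq0 e; by rewrite e eqxx in u0.
exists ((Num.sqrt (dot u u))^-1 *: u); split.
  rewrite dotE bdotZl bdotZr -dotE mulrA -invfM -expr2 sqr_sqrtr ?ltW //.
  by rewrite mulVf // gt_eqF.
move=> i hi; rewrite dotE bdotZl -dotE.
have := congr1 (fun X : 'M[R]_(1, size s) => X 0 (Ordinal hi)) uM; rewrite !mxE => e.
rewrite (_ : dot u s`_i = 0) ?mulr0 // -[RHS]e; apply: eq_bigr => j _.
by rewrite !mxE.
Qed.

Lemma dot_mulmx A u v : A^T = A -> dot (u *m A) v = dot u (v *m A).
Proof.
move=> sA; rewrite !dotE /bdot -mulmxA -{1}sA -trmx_mul.
by [].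
Qed.

(** The vector v maximizes the quadratic form of A on the unit vectors orthogonal to s. The first
    variation makes v A - c v orthogonal to every admissible u; it is itself admissible because s
    consists of eigenvectors, hence zero. *)
Lemma eigen_extend A s : A^T = A -> orthonormal s -> (size s < n)%N ->
  (forall i, (i < size s)%N -> exists c : R, s`_i *m A = c *: s`_i) ->
  exists v, orthonormal (rcons s v) /\ exists c : R, v *m A = c *: v.
Proof.
move=> sA os sn eig.
pose K := [set v : 'rV[R]_n | forall o : option 'I_(size s),
   (if o is Some i then dot v s`_i else dot v v) = (if o is Some _ then 0 else 1)].
have cdot (f g : 'rV[R]_n -> 'rV[R]_n) : continuous f -> continuous g -> continuous (fun v => dot (f v) (g v)).
  by move=> cf cg; apply: continuous_sumr => i; apply: continuousMr; apply: continuous_entry.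
have cid : continuous (fun v : 'rV[R]_n => v) by move=> v.
have ccst u : continuous (fun v : 'rV[R]_n => u) by exact: cst_continuous.
have K_orth v : K v -> dot v v = 1 /\ forall i, (i < size s)%N -> dot v s`_i = 0.
  by move=> Kv; split; [exact: (Kv None)|move=> i hi; exact: (Kv (Some (Ordinal hi)))].
have clK : closed K.
  apply: (closed_eqs (f := fun o v => if o is Some i then dot v s`_(nat_of_ord i) else dot v v)).
  by case=> [i|]; apply: cdot.
have cK : compact K.
  apply: compact_unit_box => // v /K_orth[vv _] i.
  rewrite -ler_norml -(@ler_pXn2r _ 2) ?nnegrE // expr1n -vv real_normK ?num_real // /dot (bigD1 i) //= -expr2.
  by rewrite lerDl sumr_ge0 // => j _; rewrite -expr2 sqr_ge0.
have K0 : K !=set0.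
  have [v [vv vs]] := exists_unit_orth sn.
  by exists v => -[i|] //=; apply: vs.
have cq : {within K, continuous (fun v : 'rV[R]_n => dot (v *m A) v)}.
  apply: continuous_subspaceT; apply: cdot => //; apply: continuous_mx => i j.
  rewrite (_ : (fun _ => _) = (fun v : 'rV[R]_n => \sum_k v i k * A k j)); last by apply/funext => v; rewrite mxE.
  by apply: continuous_sumr => k; apply: continuousMr; [apply: continuous_entry|exact: cst_continuous].
have [v Kv vmax] := compact_EVT_max K0 cK cq.
have [vv vs] : dot v v = 1 /\ forall i, (i < size s)%N -> dot v s`_i = 0 by apply: K_orth; rewrite inE in Kv.
exists v; split; first exact: orthonormal_rcons.
pose c := dot (v *m A) v; exists c.
have sw (a b : 'rV[R]_n) : dot a b = dot b a by rewrite !dotE bdotC.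
have hom u : (forall i, (i < size s)%N -> dot u s`_i = 0) -> dot (u *m A) u <= c * dot u u.
  move=> us; have [u0|un0] := eqVneq (dot u u) 0.
    by rewrite (dotuu_eq0 u0) mul0mx !dotE /bdot !mul0mx !mxE mulr0.
  have up : 0 < dot u u by rewrite lt_def un0 dotuu_ge0.
  pose r := Num.sqrt (dot u u).
  have rr : r ^+ 2 = dot u u by rewrite sqr_sqrtr // ltW.
  have r0 : r != 0 by rewrite sqrtr_eq0 -ltNge.
  have : r^-1 *: u \in K.
    rewrite inE => -[i|] /=; rewrite dotE bdotZl ?bdotZr -dotE; first by rewrite us ?mulr0.
    by rewrite -rr; field.
  move=> /vmax; rewrite -/c -scalemxAl dotE bdotZl bdotZr -dotE mulrA -invfM -expr2 rr.
  by rewrite mulrC ler_pdivrMr.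
have first u : dot u v = 0 -> (forall i, (i < size s)%N -> dot u s`_i = 0) -> dot (v *m A) u = 0.
  move=> uv us.
  have q t : 0 <= t * (- 2 * dot (v *m A) u) + t ^+ 2 * (c * dot u u - dot (u *m A) u).
    have := hom (v + t *: u); rewrite mulmxDl -scalemxAl !dotE !(bdotDl, bdotDr, bdotZl, bdotZr) -!dotE.
    have e : dot (u *m A) v = dot (v *m A) u by rewrite dot_mulmx // sw.
    rewrite e (sw v u) uv vv -/c => h.
    have : forall i, (i < size s)%N -> dot (v + t *: u) s`_i = 0.
      by move=> i hi; rewrite dotE bdotDl bdotZl -!dotE vs // us // mulr0 addr0.
    move=> /h; lra.
  have l (x y : R) : (forall t, 0 <= t * x + t ^+ 2 * y) -> x = 0.
    move=> hq; apply/eqP; apply: contraT => xn0.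
    have := hq (- x / (2 * (`|y| + 1))); have y1 : 0 < `|y| + 1 by rewrite ltr_pwDr.
    set d := `|y| + 1 in y1 *.
    have -> : - x / (2 * d) * x + (- x / (2 * d)) ^+ 2 * y = x ^+ 2 / (4 * d ^+ 2) * (y - 2 * d) by field; rewrite gt_eqF.
    have xx : 0 < x ^+ 2 / (4 * d ^+ 2).
      by apply: divr_gt0; [rewrite exprn_even_gt0|rewrite mulr_gt0 ?exprn_gt0].
    by rewrite pmulr_rge0 // /d; have := ler_norm y; have := normr_ge0 y; lra.
  have := l _ _ q; lra.
pose u := v *m A - c *: v.
have uv : dot u v = 0.
  by rewrite dotE bdotDl bdotNl bdotZl -!dotE vv mulr1 subrr.
have us i : (i < size s)%N -> dot u s`_i = 0.
  move=> hi; rewrite dotE bdotDl bdotNl bdotZl -!dotE vs // mulr0 subr0 dot_mulmx //.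
  by have [d ->] := eig i hi; rewrite dotE bdotZr -dotE vs // mulr0.
have : dot u u = 0.
  by rewrite {1}/u dotE bdotDl bdotNl bdotZl -!dotE first // (sw v u) uv mulr0 subr0.
by move=> /dotuu_eq0/eqP; rewrite subr_eq0 => /eqP.
Qed.

(** The prescribed eigenvectors remain the first rows, since [evol_ric] needs a given invariant
    plane spanned by the first two. *)
Lemma orthonormal_eigenbasis A s : A^T = A -> orthonormal s -> (size s <= n)%N ->
  (forall i, (i < size s)%N -> exists c : R, s`_i *m A = c *: s`_i) ->
  exists2 P : 'M[R]_n, P *m P^T = 1%:M &
    forall i : 'I_n, ((i < size s)%N -> row i P = s`_i) /\ exists c : R, row i P *m A = c *: row i P.
Proof.
move=> sA; have [k hk] := ubnP (n - size s); elim: k => // k IH in s hk *.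
move=> os; rewrite leq_eqVlt => /orP[/eqP sn|sn] eig.
  exists (\matrix_(i < n) s`_i).
    apply/matrixP => i j; rewrite !mxE.
    transitivity (dot s`_i s`_j); last by rewrite os ?sn.
    by apply: eq_bigr => p _; rewrite !mxE.
  by move=> i; rewrite rowK; split => //; apply: eig; rewrite sn.
have [v [ov vA]] := eigen_extend sA os sn eig.
have [||i|P PP hP] := IH (rcons s v) _ ov.
- by rewrite size_rcons; move: hk sn; lia.
- by rewrite size_rcons.
- rewrite size_rcons ltnS nth_rcons => hi.
  by case: (ltngtP i (size s)) hi => // hi _; exact: eig.
exists P => // i; have [h1 h2] := hP i; split => // hi.
by rewrite h1 ?size_rcons ?ltnS ?nth_rcons ?hi // ltnW.
Qed.

Lemma orthonormal_basis s : orthonormal s -> (size s <= n)%N ->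
  exists2 P : 'M[R]_n, P *m P^T = 1%:M & forall i : 'I_n, (i < size s)%N -> row i P = s`_i.
Proof.
(* Every vector is an eigenvector of the zero matrix. *)
move=> os sn; have [|P PP h] := @orthonormal_eigenbasis 0 s (trmx0 _ _ _) os sn.
  by move=> i _; exists 0; rewrite mulmx0 scale0r.
by exists P => // i hi; have [->] := h i.
Qed.

Lemma orthogonal_rows P i j : P *m P^T = 1%:M -> dot (row i P) (row j P) = (i == j)%:R.
Proof.
move=> PP; have := congr1 (fun X : 'M[R]_n => X i j) PP; rewrite !mxE => <-.
by apply: eq_bigr => k _; rewrite !mxE.
Qed.

Lemma orthonormal_map P s : P *m P^T = 1%:M -> orthonormal s -> orthonormal [seq u *m P | u <- s].
Proof.
move=> PP os i j; rewrite size_map => hi hj; rewrite !(nth_map 0) //.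
by rewrite -os // !dotE /bdot trmx_mul mulmxA -(mulmxA _ P) PP mulmx1.
Qed.

End Frames.

(** * The conditions defining E(b) in orthonormal coordinates *)

Section Equivariance.
Variables (R : realType) (n : nat).
Implicit Types (S T U : tensor R n) (A P : 'M[R]_n) (u v w z : 'rV[R]_n).

Lemma rformE T A B : rform T A B = ((colvec A)^T *m T *m colvec B) 0 0.
Proof.
rewrite mxE sum_pairs.
under [RHS]eq_bigr => k _ do under eq_bigr => l _ do rewrite mxE sum_pairs mulr_suml.
under [RHS]eq_bigr => k _ do rewrite exchange_big /=.
rewrite [RHS]exchange_big; apply: eq_bigr => i _ /=.
under [RHS]eq_bigr => k _ do under eq_bigr => l _ do rewrite mulr_suml.
under [RHS]eq_bigr => k _ do rewrite exchange_big /=.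
rewrite [RHS]exchange_big; apply: eq_bigr => j _ /=.
apply: eq_bigr => k _; apply: eq_bigr => l _.
by rewrite mxE !colvecE /tcoef; ring.
Qed.

Lemma rform_rot P T A B : rform (rotT P T) A B = rform T (P^T *m A *m P) (P^T *m B *m P).
Proof.
have e X : (kron P)^T *m colvec X = colvec (P^T *m X *m P).
  by rewrite kron_tr kron_colvec trmxK.
rewrite !rformE -!e /rotT !trmx_mul trmxK !mulmxA; congr ((_ *m _) 0 0).
Qed.

Lemma teval_rot P T u v w z : teval (rotT P T) u v w z = teval T (u *m P) (v *m P) (w *m P) (z *m P).
Proof. by rewrite -!rform_outer rform_rot /outer !trmx_mul !mulmxA. Qed.

Lemma bevalE A u v : beval A u v = (u *m A *m v^T) 0 0.
Proof.
rewrite mxE /beval exchange_big; apply: eq_bigr => j _; rewrite !mxE mulr_suml.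
by apply: eq_bigr => i _; ring.
Qed.

Lemma beval_conj P A u v : beval (P *m A *m P^T) u v = beval A (u *m P) (v *m P).
Proof. by rewrite !bevalE trmx_mul !mulmxA. Qed.

Lemma beval_delta A i j : beval A (delta_mx 0 i) (delta_mx 0 j) = A i j.
Proof. by rewrite bevalE -rowE -trmx_delta trmxK -colE !mxE. Qed.

Lemma orthonormal_deltas (s : seq 'I_n) : uniq s -> orthonormal [seq delta_mx 0 i : 'rV[R]_n | i <- s].
Proof.
move=> us i j; rewrite size_map => hi hj.
have i0 : 'I_n by case: s hi {us hj} => [|x s].
by rewrite !(nth_map i0) // dot_delta mxE /= nth_uniq.
Qed.

(** Conditions (i)-(iv) for a chosen T, convertible to the body of the existential in [Econe]. *)
Definition pair_cond (b : R) S T : Prop :=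
    [/\ curvature_symmetries T /\ tensor_nonneg T,
        PIC (S - T),
        forall e1 e2 : 'rV[R]_n, orthonormal [:: e1; e2] ->
          0 <= beval (Ric S) e1 e1 + beval (Ric S) e2 e2
             + 2 * gamma_of n b / n%:R * scal S
      & forall (e1 e2 : 'rV[R]_n) (f : seq 'rV[R]_n),
          size [:: e1, e2 & f] = n -> orthonormal [:: e1, e2 & f] ->
          let sigma := \sum_(p <- f) (teval T e1 p e1 p + teval T e2 p e2 p) in
          beval (Ric S) e2 e2 - beval (Ric S) e1 e1
            <= Num.sqrt (omega_of n b) * Num.sqrt (scal S) * Num.sqrt sigma
             + 2 * (n%:R - 2) * b * sigma].

Lemma pair_cond_rot b S T P : P *m P^T = 1%:M -> pair_cond b S T ->
  pair_cond b (rotT P S) (rotT P T).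
Proof.
move=> PP [[symT T0] pic h3 h4].
have symT' := cs_rot P symT.
split.
- split=> //; apply/(tensor_nonnegP symT') => A; rewrite rform_rot.
  exact: (proj1 (tensor_nonnegP symT) T0).
- rewrite -rotB => e1 e2 e3 e4 /(orthonormal_map PP) /= o; rewrite !teval_rot; exact: pic.
- by move=> e1 e2 /(orthonormal_map PP) /= o; rewrite Ric_rot // scal_rot // !beval_conj; exact: h3.
- move=> e1 e2 f sf /(orthonormal_map PP) /= o; rewrite Ric_rot // scal_rot // !beval_conj.
  have := h4 _ _ [seq u *m P | u <- f] _ o; rewrite /= size_map => /(_ sf).
  rewrite big_map; under [in X in X -> _]eq_bigr do rewrite -!teval_rot.
  exact.
Qed.

Definition sigma T (i j : 'I_n) : R := \sum_(p | (p != i) && (p != j)) (sec T i p + sec T j p).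

Lemma sum_two (F : 'I_n -> R) i j : i != j -> \sum_p F p = F i + F j + \sum_(p | (p != i) && (p != j)) F p.
Proof. by move=> ij; rewrite (bigD1 i) //= (bigD1 j) /= 1?eq_sym // addrA. Qed.

Section Coordinate.
Variables (b : R) (S T : tensor R n).
Hypothesis pc : pair_cond b S T.

Lemma pair_cond_ric i j : i != j -> 0 <= Ric S i i + Ric S j j + 2 * gamma_of n b / n%:R * scal S.
Proof.
move=> ij; have [_ _ h3 _] := pc; rewrite -!beval_delta; apply: h3.
by apply: (@orthonormal_deltas [:: i; j]); rewrite /= inE ij.
Qed.

Lemma pair_cond_pinch i j : i != j ->
  Ric S j j - Ric S i i <= Num.sqrt (omega_of n b) * Num.sqrt (scal S) * Num.sqrt (sigma T i j)
             + 2 * (n%:R - 2) * b * sigma T i j.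
Proof.
move=> ij; have [_ _ _ h4] := pc.
pose s := [seq p <- enum 'I_n | (p != i) && (p != j)].
have := h4 (delta_mx 0 i) (delta_mx 0 j) [seq delta_mx 0 p | p <- s].
rewrite /= big_map !beval_delta.
have -> : \sum_(p <- s) (teval T (delta_mx 0 i) (delta_mx 0 p) (delta_mx 0 i) (delta_mx 0 p) +
   teval T (delta_mx 0 j) (delta_mx 0 p) (delta_mx 0 j) (delta_mx 0 p)) = sigma T i j.
  rewrite big_filter big_enum_cond /=; apply: eq_bigr => p _; by rewrite !teval_delta.
have us : uniq (i :: j :: s).
  by rewrite /= !inE negb_or ij !mem_filter !eqxx andbF /= filter_uniq ?enum_uniq.
have pe : perm_eq (i :: j :: s) (enum 'I_n).
  apply: uniq_perm => //; first exact: enum_uniq.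
  by move=> p; rewrite !inE mem_filter mem_enum andbT; case: (p == i); case: (p == j).
apply; last exact: (@orthonormal_deltas (i :: j :: s)).
by rewrite -[RHS](size_enum_ord n) -(perm_size pe) /= size_map.
Qed.

(** The homogeneous form of (iii): variations of the two directions can then be polynomial, without
    normalization. *)
Lemma pair_cond_two_nonneg u v : dot u u = dot v v -> dot u v = 0 ->
  0 <= beval (Ric S) u u + beval (Ric S) v v + 2 * gamma_of n b / n%:R * scal S * dot u u.
Proof.
move=> uv ouv; have [_ _ h3 _] := pc.
have [u0|un0] := eqVneq (dot u u) 0.
  have v0 : dot v v = 0 by rewrite -uv.
  by rewrite (dotuu_eq0 u0) (dotuu_eq0 v0) !bevalE !mul0mx !mxE dotE /bdot mul0mx mxE mulr0 !addr0.
have up : 0 < dot u u by rewrite lt_def un0 dotuu_ge0.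
pose r := Num.sqrt (dot u u).
have rr : r ^+ 2 = dot u u by rewrite sqr_sqrtr // ltW.
have r0 : r != 0 by rewrite sqrtr_eq0 -ltNge.
have bZ (A : 'M[R]_n) x : beval A (r^-1 *: x) (r^-1 *: x) = r^-1 ^+ 2 * beval A x x.
  by rewrite !bevalE linearZ /= -!scalemxAl -scalemxAr scalerA mxE expr2.
have := h3 (r^-1 *: u) (r^-1 *: v); rewrite !bZ => h.
have o : orthonormal [:: r^-1 *: u; r^-1 *: v].
  by apply: orthonormal2; rewrite !dotE !bdotZl !bdotZr -!dotE -?uv -?rr ?ouv ?mulr0 //; field.
have := mulr_ge0 (ltW up) (h o); rewrite -rr.
move: (2 * gamma_of n b / n%:R * scal S) => c.
by congr (0 <= _); field.
Qed.

End Coordinate.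

End Equivariance.

(** * Nonzero elements of E(b) have positive scalar curvature *)

Section ScalarPositive.
Variables (R : realType) (n : nat).
Implicit Types (S T U : tensor R n).

(** Polarization gives antisymmetry in the first and third slots; together with the Bianchi identity
    this leaves only S = 0. *)
Lemma teval_sqr_eq0 S : curvature_tensor S -> (forall x y : 'rV[R]_n, teval S x y x y = 0) -> S = 0.
Proof.
move=> [symS bS] h; have C := rformC symS.
have h1 (x y w : 'rV[R]_n) : rform S (outer x y) (outer x w) = 0.
  have := h x (y + w); rewrite -rform_outer.
  have -> : outer x (y + w) = outer x y + outer x w by rewrite /outer mulmxDr.
  rewrite rformDl (C _ (_ + _)) (C _ (_ + _)) !rformDl !rform_outer !h.
  have := C (outer x y) (outer x w); rewrite !rform_outer; lra.
have h2 (x y z w : 'rV[R]_n) : teval S x y z w = - teval S z y x w.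
  have := h1 (x + z) y w.
  have e t : outer (x + z) t = outer x t + outer z t by rewrite /outer linearD mulmxDl.
  rewrite !e rformDl (C _ (_ + _)) (C _ (_ + _)) !rformDl !(C _ (outer _ y)) !h1 !rform_outer; lra.
have h3 i j k l : tcoef S i j k l = - tcoef S k j i l by rewrite -!teval_delta h2.
apply: tensorP => i j k l; rewrite tcoef0.
have := bS i j k l; have := h3 i j k l; have := h3 j k i l; have := cs12 symS k j i l.
have := cs12 symS i k j l; lra.
Qed.

(** By [quad_sum_eq0], applied in a frame containing them, any orthonormal pair has zero sectional
    curvature; Gram-Schmidt reduces arbitrary x and y to such a pair. *)
Lemma PIC_scal_eq0_eq0 S : (4 < n)%N -> curvature_tensor S -> PIC S -> scal S = 0 -> S = 0.
Proof.
move=> n4 ctS pS s0; have symS := ctS.1.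
have on (e1 e2 : 'rV[R]_n) : orthonormal [:: e1; e2] -> teval S e1 e2 e1 e2 = 0.
  move=> o; have n2 : (2 <= n)%N by lia.
  have [P PP rows] := orthonormal_basis o n2.
  have p0 : (0 < n)%N by lia.
  have p1 : (1 < n)%N by lia.
  have r0 : row (Ordinal p0) P = e1 by exact: rows.
  have r1 : row (Ordinal p1) P = e2 by exact: rows.
  rewrite -r0 -r1 -tcoef_rot_teval.
  apply: (PIC_scal_eq0 (cs_rot P symS)) => //; last by rewrite scal_rot.
  by move=> f1 f2 f3 f4 /(orthonormal_map PP) /= of4; rewrite !teval_rot; exact: pS.
have C := rformC symS.
apply: teval_sqr_eq0 => // x y.
have [x0|xn0] := eqVneq (dot x x) 0.
  by rewrite (dotuu_eq0 x0); have := tevalZ S 0 1 0 1 0 y 0 y; rewrite !scale0r !scale1r !mul0r.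
have xp : 0 < dot x x by rewrite lt_def xn0 dotuu_ge0.
pose y' := y - (dot x y / dot x x) *: x.
have xy' : dot x y' = 0 by rewrite dotE bdotDr bdotNr bdotZr -!dotE divfK // subrr.
have -> : teval S x y x y = teval S x y' x y'.
  rewrite -!rform_outer.
  have -> : outer x y' = outer x y + - (dot x y / dot x x) *: outer x x.
    by apply/matrixP => i j; do ?rewrite ?outerE mxE; rewrite ?outerE; ring.
  have z A : rform S (outer x x) A = 0.
    apply: complexI; rewrite -cform_rc cform_syml ?rmorph0 //.
    by apply/matrixP => i j; rewrite !mxE !big_ord1 !mxE mulrC.
  by rewrite rformDl !(C _ (_ + _)) !rformDl !rformZl (C (outer x y) (_ *: _)) rformZl !z !mulr0 !addr0.
have [y0|yn0] := eqVneq (dot y' y') 0.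
  by rewrite (dotuu_eq0 y0); have := tevalZ S 1 0 1 0 x 0 x 0; rewrite !scale0r !scale1r !mulr0 !mul0r.
have yp : 0 < dot y' y' by rewrite lt_def yn0 dotuu_ge0.
pose r := Num.sqrt (dot x x); pose t := Num.sqrt (dot y' y').
have rr : r ^+ 2 = dot x x by rewrite sqr_sqrtr // ltW.
have tt : t ^+ 2 = dot y' y' by rewrite sqr_sqrtr // ltW.
have r0 : r != 0 by rewrite sqrtr_eq0 -ltNge.
have t0 : t != 0 by rewrite sqrtr_eq0 -ltNge.
have o : orthonormal [:: r^-1 *: x; t^-1 *: y'].
  apply: orthonormal2; rewrite !dotE !bdotZl !bdotZr -!dotE ?xy' ?mulr0 // -?rr -?tt; field; assumption.
have := on _ _ o; rewrite tevalZ => /eqP; rewrite !mulf_eq0 !invr_eq0.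
by rewrite (negbTE r0) (negbTE t0) /= => /eqP.
Qed.

Lemma pair_cond_PIC b S T : pair_cond b S T -> PIC S.
Proof. by move=> [[symT T0] pU _ _]; rewrite -(subrK T S); exact: nonnegD_PIC. Qed.

Lemma pair_cond_scal_gt0 b S T : (4 < n)%N -> curvature_tensor S -> pair_cond b S T -> S <> 0 -> 0 < scal S.
Proof.
move=> n4 ctS /pair_cond_PIC pS S0; rewrite lt_def PIC_scal_ge0 ?andbT //; [|exact: ctS.1|lia].
by apply/eqP => s0; apply: S0; exact: PIC_scal_eq0_eq0.
Qed.

End ScalarPositive.

Section Bilinear.
Variables (R : realType) (n : nat) (A : 'M[R]_n).
Implicit Types u v w : 'rV[R]_n.

Lemma bevalDl u v w : beval A (u + v) w = beval A u w + beval A v w.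
Proof. by rewrite !bevalE !mulmxDl mxE. Qed.

Lemma bevalDr u v w : beval A w (u + v) = beval A w u + beval A w v.
Proof. by rewrite !bevalE linearD /= mulmxDr mxE. Qed.

Lemma bevalZl c u w : beval A (c *: u) w = c * beval A u w.
Proof. by rewrite !bevalE -!scalemxAl mxE. Qed.

Lemma bevalZr c u w : beval A w (c *: u) = c * beval A w u.
Proof. by rewrite !bevalE linearZ /= -scalemxAr mxE. Qed.

End Bilinear.

Lemma natr_ge12 (R : realType) n : (12 <= n)%N -> 12 <= n%:R :> R.
Proof. by rewrite (ler_nat R 12). Qed.

Lemma b_max_bound (R : realType) n (b : R) : (12 <= n)%N -> b <= b_max R n -> 4 * (n%:R * b) <= 1.
Proof.
move=> n12; have n0 : 0 < 4 * n%:R :> R by rewrite mulr_gt0 // (lt_le_trans _ (natr_ge12 R n12)).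
by rewrite /b_max -[(4 * _)^-1]mul1r ler_pdivlMr // mulrC -mulrA.
Qed.

(** * The tensor D S at PIC frames *)

Section Boundary.
Variables (R : realType) (n : nat) (b : R).
Implicit Types (S T U : tensor R n) (A P : 'M[R]_n).
Local Notation N := (n%:R : R).
Local Notation a := (a_of n b).
Local Notation gam := (gamma_of n b).
Local Notation kap := (kappa_param N b a).
Local Notation KN := (@kulkarni_nomizu R n).
Hypotheses (n12 : (12 <= n)%N) (b0 : 0 < b) (bmax : b <= b_max R n).

Let hN : 12 <= N := natr_ge12 R n12.
Let hNb : 4 * (N * b) <= 1 := b_max_bound n12 bmax.

Lemma tr_sqr_sum A : A^T = A -> \tr (A *m A) = \sum_i \sum_p A i p ^+ 2.
Proof.
move=> sA; apply: eq_bigr => i _; rewrite mxE; apply: eq_bigr => p _.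
by rewrite expr2 -{2}sA mxE.
Qed.

Lemma sqr_diag_sum A i : A^T = A -> (A *m A) i i = \sum_p A i p ^+ 2.
Proof. by move=> sA; rewrite mxE; apply: eq_bigr => p _; rewrite expr2 -{2}sA mxE. Qed.

Lemma tr_sqr_ge0 A : A^T = A -> 0 <= \tr (A *m A).
Proof. by move=> sA; rewrite tr_sqr_sum // sumr_ge0 // => i _; rewrite sumr_ge0 // => p _; exact: sqr_ge0. Qed.

Lemma tr_sqr_eq0 A : A^T = A -> \tr (A *m A) = 0 -> A = 0.
Proof.
move=> sA; rewrite tr_sqr_sum // => /eqP; rewrite psumr_eq0; last first.
  by move=> i _; rewrite sumr_ge0 // => p _; exact: sqr_ge0.
move=> /allP h; apply/matrixP => i p; have := h i (mem_index_enum _).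
rewrite psumr_eq0; last by move=> q _; exact: sqr_ge0.
by move=> /allP /(_ p (mem_index_enum _)); rewrite sqrf_eq0 mxE => /eqP.
Qed.

Lemma sum_ge4 (F : 'I_n -> R) i j k l : (forall p, 0 <= F p) -> uniq [:: i; j; k; l] ->
  F i + F j + F k + F l <= \sum_p F p.
Proof.
move=> F0.
rewrite /= !inE !negb_or andbT => /and3P[/and3P[ij ik il] /andP[jk jl] kl].
rewrite (bigD1 i) //= (bigD1 j) 1?eq_sym //= (bigD1 k) /=; last by rewrite eq_sym ik eq_sym jk.
rewrite (bigD1 l) /=; last by rewrite (eq_sym l i) il (eq_sym l j) jl eq_sym kl.
by rewrite !addrA lerDl sumr_ge0.
Qed.

Lemma pic_kn_kn A i j k l : A^T = A -> pic_coef (KN A A) i j k l =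
  2 * ((A i i + A j j) * (A k k + A l l) - (A i k + A j l) ^+ 2 - (A i l - A j k) ^+ 2).
Proof.
move=> sA; have eA x y : A x y = A y x by rewrite -{1}sA mxE.
rewrite /pic_coef !tcoefE ?(eA k j) ?(eA l j) ?(eA k i) ?(eA l i) ?(eA j i) ?(eA l k); ring.
Qed.

Lemma pic_kn_1 A i j k l : uniq [:: i; j; k; l] -> pic_coef (KN A 1%:M) i j k l =
  2 * (A i i + A j j + A k k + A l l).
Proof.
rewrite /= !inE !negb_or andbT => /and3P[/and3P[ij ik il] /andP[jk jl] kl].
have d (x y : 'I_n) : (1%:M : 'M[R]_n) x y = (x == y)%:R by rewrite mxE.
have [ji ki li] : [/\ (j == i) = false, (k == i) = false & (l == i) = false].
  by rewrite !(eq_sym _ i) (negbTE ij) (negbTE ik) (negbTE il).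
have [kj lj lk] : [/\ (k == j) = false, (l == j) = false & (l == k) = false].
  by rewrite !(eq_sym _ j) (eq_sym l) (negbTE jk) (negbTE jl) (negbTE kl).
rewrite /pic_coef !tcoefE !d !eqxx ?ji ?ki ?li ?kj ?lj ?lk ?(negbTE ij) ?(negbTE ik) ?(negbTE il) ?(negbTE jk) ?(negbTE jl) ?(negbTE kl) /=; ring.
Qed.

(* Any rotation-invariant function satisfying [eps_gt0] and [ellD_pic_gt] would do. *)
Definition eps S : R :=
  if \tr (ric0 S *m ric0 S) == 0 then a * (scal S / N) ^+ 2 else kap * \tr (ric0 S *m ric0 S) / 2.

Lemma eps_rot P S : P *m P^T = 1%:M -> eps (rotT P S) = eps S.
Proof.
move=> PP; have PtP := mulmx1C PP; rewrite /eps scal_rot // ric0_rot //.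
have -> // : \tr (P *m ric0 S *m P^T *m (P *m ric0 S *m P^T)) = \tr (ric0 S *m ric0 S).
by rewrite !mulmxA -(mulmxA _ P^T P) PtP mulmx1 mxtrace_mulC !mulmxA PtP mul1mx.
Qed.

Lemma eps_gt0 S : curvature_symmetries S -> 0 < scal S -> 0 < eps S.
Proof.
move=> symS s0; rewrite /eps; case: eqP => [_|/eqP t0].
  by rewrite mulr_gt0 ?exprn_gt0 ?divr_gt0 // ?(param_a_gt0 hN b0 hNb) // (lt_le_trans _ hN).
rewrite divr_gt0 // mulr_gt0 // ?(param_kappa_gt0 hN b0 hNb) // lt_def t0.
by rewrite tr_sqr_ge0 // ric0_sym.
Qed.

(** The discriminant condition of the form in p and q, with y = 0 treated apart; it is applied with
    m a sum of two squares. *)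
Lemma quadratic_le (x y m : R) : 0 <= y -> 0 <= m ->
  (forall p q : R, 0 <= p ^+ 2 * x + q ^+ 2 * m * y - 2 * p * q * m) -> m <= x * y.
Proof.
move=> y0 m0 h; have [yz|yn] := eqVneq y 0.
  have := h 1 ((x + 1) / (2 * m)); rewrite yz !mulr0 addr0 expr1n mul1r mulr1.
  have [->|mn] := eqVneq m 0; first by [].
  have -> : x - 2 * ((x + 1) / (2 * m)) * m = -1 by field.
  lra.
have yp : 0 < y by rewrite lt_def yn.
have := h y 1; rewrite (_ : _ - _ = y * (x * y - m)); last by ring.
by rewrite pmulr_rge0 // subr_ge0.
Qed.

(** With d = 2 b + (N - 2) b^2, the relation 2 a s = d c completes X Y and X + Y to the product (X +
    2c)(Y + 2c), which dominates m1^2 + m2^2 by (iii). The defect in c^2 is made up for by the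
    squared Ricci term. Half of the kappa term, or of the scal^2 term in the Einstein case, remains
    as the strict gain over 8 eps. *)
Lemma ellD_pic_gt S T i j k l : curvature_tensor S -> pair_cond b S T -> 0 < scal S ->
  uniq [:: i; j; k; l] -> 8 * eps S < pic_coef (ellD a b S) i j k l.
Proof.
move=> ctS pc s0 un; have symS := ctS.1; have sP := ric0_sym symS.
have N0 : 0 < N by rewrite (lt_le_trans _ hN).
have a0 : 0 < a by exact: (param_a_gt0 hN b0 hNb).
have kp : 0 < kap by exact: (param_kappa_gt0 hN b0 hNb).
pose s := scal S / N; have sp : 0 < s by rewrite divr_gt0.
have picD : pic_coef (ellD a b S) i j k l =
  (2 * b + (N - 2) * b ^+ 2) * pic_coef (KN (ric0 S) (ric0 S)) i j k l
  + (4 * a * s) * pic_coef (KN (ric0 S) 1%:M) i j k l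
  + (2 * b ^+ 2) * pic_coef (KN (ric0 S *m ric0 S) 1%:M) i j k l
  + (2 * a * s ^+ 2 + kap * \tr (ric0 S *m ric0 S)) * pic_coef (KN 1%:M 1%:M) i j k l.
  by rewrite /ellD -/s /pic_coef !(tcoefD, tcoefZ); ring.
have pic1 : pic_coef (KN 1%:M 1%:M) i j k l = 8.
  by rewrite pic_kn_1 // !mxE !eqxx !mulr1n; ring.
rewrite picD pic1 !pic_kn_1 // pic_kn_kn // /eps.
case: eqP => [t0|/eqP tn0].
  rewrite t0 (tr_sqr_eq0 sP t0) mul0mx !mxE.
  have := mulr_gt0 a0 (exprn_gt0 2 sp); rewrite -/s; lra.
set t := \tr _ in tn0 *.
have tp : 0 < t by rewrite lt_def tn0 tr_sqr_ge0.
pose X := ric0 S i i + ric0 S j j; pose Y := ric0 S k k + ric0 S l l.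
pose c := (1 + gam) * s.
pose m1 := ric0 S i k + ric0 S j l; pose m2 := ric0 S i l - ric0 S j k.
pose Bs := (ric0 S *m ric0 S) i i + (ric0 S *m ric0 S) j j + (ric0 S *m ric0 S) k k + (ric0 S *m ric0 S) l l.
have eP x y : ric0 S x y = ric0 S y x by rewrite -{1}sP mxE.
have Bs_ge : (X ^+ 2 + Y ^+ 2) / 2 + (m1 ^+ 2 + m2 ^+ 2) <= Bs.
  have g x : ric0 S x i ^+ 2 + ric0 S x j ^+ 2 + ric0 S x k ^+ 2 + ric0 S x l ^+ 2 <= (ric0 S *m ric0 S) x x.
    by rewrite sqr_diag_sum //; apply: (sum_ge4 (F := fun p => ric0 S x p ^+ 2)) => // p; exact: sqr_ge0.
  have := g i; have := g j; have := g k; have := g l.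
  rewrite (eP k i) (eP k j) (eP l i) (eP l j) /Bs /X /Y /m1 /m2.
  have := sqr_ge0 (ric0 S i i - ric0 S j j); have := sqr_ge0 (ric0 S k k - ric0 S l l).
  have := sqr_ge0 (ric0 S i k - ric0 S j l); have := sqr_ge0 (ric0 S i l + ric0 S j k).
  have := sqr_ge0 (ric0 S i j); have := sqr_ge0 (ric0 S j i); have := sqr_ge0 (ric0 S k l); have := sqr_ge0 (ric0 S l k).
  move: (_ i i) (_ j j) (_ k k) (_ l l) => *; lra.
have RicE p q : Ric S p q = ric0 S p q + s * (p == q)%:R by rewrite {1}Ric_decomp !mxE.
have gs : 2 * gam / N * scal S = 2 * gam * s by rewrite /s; field; rewrite gt_eqF.
have [ij kl] : i != j /\ k != l by move: un; rewrite /= !inE !negb_or andbT => /and3P[/and3P[-> _ _] _ ->].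
have x0 : 0 <= X + 2 * c.
  have := pair_cond_ric pc ij; rewrite gs !RicE !eqxx /= /X /c; lra.
have y0 : 0 <= Y + 2 * c.
  have := pair_cond_ric pc kl; rewrite gs !RicE !eqxx /= /Y /c; lra.
have m_le : m1 ^+ 2 + m2 ^+ 2 <= (X + 2 * c) * (Y + 2 * c).
  apply: quadratic_le => //; first by rewrite addr_ge0 ?sqr_ge0.
  move=> p q.
  pose e (m : 'I_n) : 'rV[R]_n := delta_mx 0 m.
  (* u + iv is the isotropic vector p (e_i + i e_j) - q (m1 - i m2)(e_k + i e_l), so u and v are
     orthogonal of equal length. The phase of m1 - i m2 extracts m1^2 + m2^2 as cross term. *)
  pose u := p *: e i + (- q * m1) *: e k + (- q * m2) *: e l.
  pose v := p *: e j + (- q * m1) *: e l + (q * m2) *: e k.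
  have de x y : dot (e x) (e y) = (x == y)%:R by rewrite dot_delta mxE /= eq_sym.
  have [[ij' ik il] [jk jl kl']] : [/\ i != j, i != k & i != l] /\ [/\ j != k, j != l & k != l].
    by move: un; rewrite /= !inE !negb_or andbT => /and3P[/and3P[-> -> ->] /andP[-> ->] ->].
  have D := (de, eqxx, negbTE ij', negbTE ik, negbTE il, negbTE jk, negbTE jl, negbTE kl',
    eq_sym j i, eq_sym k i, eq_sym l i, eq_sym k j, eq_sym l j, eq_sym l k).
  have uu : dot u u = p ^+ 2 + q ^+ 2 * (m1 ^+ 2 + m2 ^+ 2).
    rewrite /u !dotE !(bdotDl, bdotDr, bdotZl, bdotZr) -!dotE !D /=; ring.
  have vv : dot v v = p ^+ 2 + q ^+ 2 * (m1 ^+ 2 + m2 ^+ 2).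
    rewrite /v !dotE !(bdotDl, bdotDr, bdotZl, bdotZr) -!dotE !D /=; ring.
  have uv : dot u v = 0.
    rewrite /u /v !dotE !(bdotDl, bdotDr, bdotZl, bdotZr) -!dotE !D /=; ring.
  have := pair_cond_two_nonneg pc (etrans uu (esym vv)) uv; rewrite gs uu.
  have bE w1 w2 w3 x1 x2 x3 : beval (Ric S) (w1 *: e x1 + w2 *: e x2 + w3 *: e x3) (w1 *: e x1 + w2 *: e x2 + w3 *: e x3) =
     w1 ^+ 2 * Ric S x1 x1 + w2 ^+ 2 * Ric S x2 x2 + w3 ^+ 2 * Ric S x3 x3
     + w1 * w2 * (Ric S x1 x2 + Ric S x2 x1) + w1 * w3 * (Ric S x1 x3 + Ric S x3 x1) + w2 * w3 * (Ric S x2 x3 + Ric S x3 x2).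
    by rewrite !(bevalDl, bevalDr, bevalZl, bevalZr) !beval_delta; ring.
  rewrite /u /v !bE !RicE !D /=.
  rewrite (eP k i) (eP l i) (eP l j) (eP k j) (eP l k) => h; apply: (le_trans h).
  by rewrite le_eqVlt; apply/orP; left; apply/eqP; rewrite /X /Y /c /m1 /m2; ring.
have L2 := param_L_gt2 hN b0 hNb; have L0 := param_L_neq0 hN b0 hNb.
have cE : c = (2 + (N - 2) * b) / (2 + (N - 3) * b) * s by rewrite /c /gamma_of (param_gammaD1 hN b0 hNb).
(* [as1] and [as2] express the choice of a and gamma: 2 a = d (1 + gamma) and d = (d - b^2)(1 +
   gamma). *)
have as1 : 2 * a * s = (2 * b + (N - 2) * b ^+ 2) * c by rewrite cE /a_of; field.
have as2 : (2 * b + (N - 2) * b ^+ 2) * c * s = (2 * b + (N - 2) * b ^+ 2 - b ^+ 2) * c ^+ 2 by rewrite cE; field.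
have d2 : 0 <= 2 * b + (N - 2) * b ^+ 2 - 2 * b ^+ 2.
  have := hN; have := b0; have := hNb => *; nra.
rewrite -/X -/Y -/Bs -/m1 -/m2.
have sq := sqr_ge0 b.
have main : 0 <= (2 * b + (N - 2) * b ^+ 2) * (2 * (X * Y - m1 ^+ 2 - m2 ^+ 2)) + 4 * a * s * (2 * (X + Y)) + 2 * b ^+ 2 * (2 * Bs) + 2 * a * s ^+ 2 * 8.
  have -> : 4 * a * s = 2 * ((2 * b + (N - 2) * b ^+ 2) * c) by rewrite -as1; ring.
  have -> : 2 * a * s ^+ 2 = (2 * b + (N - 2) * b ^+ 2 - b ^+ 2) * c ^+ 2 by rewrite -as2 -as1; ring.
  move: (2 * b + (N - 2) * b ^+ 2) d2 => d d2.
  have p1 : 0 <= b ^+ 2 * (Bs - ((X ^+ 2 + Y ^+ 2) / 2 + (m1 ^+ 2 + m2 ^+ 2))) by rewrite mulr_ge0 // subr_ge0.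
  have p2 : 0 <= (d - 2 * b ^+ 2) * ((X + 2 * c) * (Y + 2 * c) - (m1 ^+ 2 + m2 ^+ 2)) by rewrite mulr_ge0 // subr_ge0.
  (* The expression is at least 2 [p2] + 4 [p1] + 2 [p3]: raising d to 2 b^2 turns the lower bound
     of [Bs] into this square. *)
  have p3 : 0 <= b ^+ 2 * (X + Y + 2 * c) ^+ 2 by rewrite mulr_ge0 ?sqr_ge0.
  lra.
have := mulr_gt0 kp tp.
rewrite (_ : ric0 S i i + ric0 S j j + ric0 S k k + ric0 S l l = X + Y); last by rewrite /X /Y; ring.
lra.
Qed.

End Boundary.

(** * Conditions (i) and (ii) *)

Section Evolution.
Variables (R : realType) (n : nat) (b : R).
Implicit Types (S T U : tensor R n) (A P : 'M[R]_n).
Local Notation N := (n%:R : R).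
Local Notation a := (a_of n b).
Local Notation KN := (@kulkarni_nomizu R n).

Definition evolS S : tensor R n := hamiltonQ S + ellD a b S.
Definition evolT S T : tensor R n := tensor_square S + tensor_sharp T + eps b S *: KN 1%:M 1%:M.

Lemma rformDt T U A B : rform (T + U) A B = rform T A B + rform U A B.
Proof. by rewrite !rformE mulmxDr mulmxDl mxE. Qed.

Lemma rformZt c T A B : rform (c *: T) A B = c * rform T A B.
Proof. by rewrite !rformE -scalemxAr -scalemxAl mxE. Qed.

Lemma rform_square_ge0 S A : 0 <= rform (tensor_square S) A A.
Proof.
rewrite squareE; have -> : rform (S *m S^T) A A = ((S^T *m colvec A)^T *m (S^T *m colvec A)) 0 0.
  by rewrite rformE trmx_mul trmxK !mulmxA.
rewrite mxE sumr_ge0 // => x _; rewrite [X in X * _]mxE -expr2; exact: sqr_ge0.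
Qed.

Lemma rform_kn1 A : A^T = - A -> rform (KN 1%:M 1%:M) A A = 4 * \sum_i \sum_j A i j ^+ 2.
Proof.
move=> sA; have eA i j : A j i = - A i j by have := congr1 (fun M : 'M[R]_n => M i j) sA; rewrite !mxE.
have d (x y : 'I_n) : (1%:M : 'M[R]_n) x y = (x == y)%:R by rewrite mxE.
rewrite /rform mulr_sumr; apply: eq_bigr => i _; rewrite mulr_sumr; apply: eq_bigr => j _.
transitivity (\sum_k \sum_l ((2 * A i j) * (k == i)%:R * A k l * (l == j)%:R
   - (2 * A i j) * (k == j)%:R * A k l * (l == i)%:R)).
  apply: eq_bigr => k _; apply: eq_bigr => l _; rewrite !tcoefE !d !(eq_sym i) !(eq_sym j); ring.
under eq_bigr => k _ do rewrite sumrB !sum_delta_r.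
rewrite sumrB.
under eq_bigr => k _ do rewrite mulrAC.
rewrite sum_delta_r.
under eq_bigr => k _ do rewrite mulrAC.
rewrite sum_delta_r (eA i j); ring.
Qed.

Lemma pic_coefD S T i j k l : pic_coef (S + T) i j k l = pic_coef S i j k l + pic_coef T i j k l.
Proof. by rewrite /pic_coef !tcoefD; ring. Qed.

Lemma pic_coefZ c S i j k l : pic_coef (c *: S) i j k l = c * pic_coef S i j k l.
Proof. by rewrite /pic_coef !tcoefZ; ring. Qed.

Hypotheses (n12 : (12 <= n)%N) (b0 : 0 < b) (bmax : b <= b_max R n).
Variables S T : tensor R n.
Hypotheses (ctS : curvature_tensor S) (pc : pair_cond b S T) (s0 : 0 < scal S).

Lemma evolT_nonneg A : A^T = - A -> A != 0 -> 0 < rform (evolT S T) A A.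
Proof.
move=> sA An0; have [[symT T0] _ _ _] := pc.
have h1 := rform_square_ge0 S A.
have h2 : 0 <= rform (tensor_sharp T) A A.
  rewrite -ler0c -cform_rc; apply: cform_sharp_ge0 => //.
  apply/matrixP => i j; have := congr1 (fun M : 'M[R]_n => M i j) sA; rewrite !mxE => ->.
  exact: rmorphN.
have h3 : 0 < \sum_i \sum_j A i j ^+ 2.
  rewrite lt_def sumr_ge0 ?andbT; last by move=> i _; rewrite sumr_ge0 // => j _; exact: sqr_ge0.
  apply: contraNneq An0 => /eqP; rewrite psumr_eq0; last first.
    by move=> i _; rewrite sumr_ge0 // => p _; exact: sqr_ge0.
  move=> /allP h; apply/eqP/matrixP => i p; have := h i (mem_index_enum _).
  rewrite psumr_eq0; last by move=> q _; exact: sqr_ge0.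
  by move=> /allP /(_ p (mem_index_enum _)); rewrite sqrf_eq0 mxE => /eqP.
have := mulr_gt0 (eps_gt0 n12 b0 bmax ctS.1 s0) h3.
rewrite /evolT !rformDt rformZt rform_kn1 //; lra.
Qed.

(** In S' - T' the squares cancel. The difference of the sharps is nonnegative at the zero of S - T,
    and D S exceeds 8 eps, the value of eps id (.) id at a PIC frame. *)
Lemma evol_pic i j k l : uniq [:: i; j; k; l] -> pic_coef (S - T) i j k l = 0 ->
  0 < pic_coef (evolS S - evolT S T) i j k l.
Proof.
move=> un null; have [[symT T0] pU _ _] := pc.
have symU : curvature_symmetries (S - T).
  by rewrite -scaleN1r; apply: csD; [exact: ctS.1|exact: csZ].
have := pic_sharp_ge0 un symU pU symT T0 null; rewrite subrK => h.
have := ellD_pic_gt n12 b0 bmax ctS pc s0 un.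
have p1 : pic_coef (KN 1%:M 1%:M) i j k l = 8.
  by rewrite pic_kn_1 // !mxE !eqxx !mulr1n; ring.
have -> : evolS S - evolT S T = (tensor_sharp S - tensor_sharp T) + ellD a b S + (- eps b S) *: KN 1%:M 1%:M.
  by apply: tensorP => p q r t; rewrite /evolS /evolT /hamiltonQ !(tcoefD, tcoefN, tcoefZ); ring.
rewrite (pic_coefD (_ + _)) (pic_coefD (_ - _)) (pic_coefZ (- _)) p1; lra.
Qed.

End Evolution.

(** * Condition (iii) *)

Section RicciInequality.
Variable R : rcfType.
Variables N b om s dl sg w : R.
Hypotheses (hN : 12 <= N) (hb : 0 < b) (hNb : 4 * (N * b) <= 1).
Local Notation L := (2 + (N - 3) * b).
Local Notation M := (2 + (N - 2) * b).
Local Notation q := (1 - 4 * (N - 2) * b ^+ 2).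
Hypotheses (om0 : 0 <= om)
  (omE : om ^+ 2 = 27 * M / 8 * (q ^+ 4 * (1 + (N - 2) * b) ^+ 2 / (N ^+ 2 * b ^+ 2 * L ^+ 2))).
Hypotheses (s0 : 0 < s) (dl0 : 0 <= dl) (w0 : 0 <= w) (w2 : w ^+ 2 = om * (N * s) * sg).
Hypothesis pinch : 2 * dl <= w + 2 * (N - 2) * b * sg.

(* With [z] as below the pinching condition reads [4 b dl^2 <= z sg], and the quadratic
   expression is bounded below by a multiple of [(dl - 2z/3)^2 (dl + z/3)]; this is how
   the constant [27/8] in [omega^2] arises. *)
Lemma pinched_reaction_ge0 :
  0 <= 4 * b * M * ((1 + (N - 2) * b) * s / L) ^+ 2 - 8 * b * dl ^+ 2 + 2 * dl * sg.
Proof.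
have q0 := param_q_gt hN hb hNb; have L2 := param_L_gt2 hN hb hNb.
have [M0 qp Lp bM] : [/\ 0 < M, 0 < q, 0 < L & 0 < N] by split; move: hN hb hNb => *; nra.
have [big|small] := leP (4 * b * dl) sg.
  have : 0 <= 2 * dl * (sg - 4 * b * dl) by rewrite mulr_ge0 ?mulr_ge0 // subr_ge0.
  have : 0 <= 4 * b * M * ((1 + (N - 2) * b) * s / L) ^+ 2 by apply: mulr_ge0 (sqr_ge0 _); rewrite ltW // !mulr_gt0.
  lra.
(* The factor q^4 of omega^2 is split off, as it compensates exactly for the q lost in [h1]; what
   remains of omega defines z. *)
have [om1 om1E om10] : exists2 o, om = q ^+ 2 * o & 0 < o.
  exists (om / q ^+ 2); first by rewrite mulrC divfK // gt_eqF // exprn_gt0.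
  by rewrite divr_gt0 ?exprn_gt0 // (lt_le_trans _ (param_om_ge hN hb hNb om0 omE)).
pose z := om1 * N * s * b.
have z0 : 0 < z by rewrite /z !mulr_gt0.
have zE : 8 * z ^+ 2 = 27 * M * ((1 + (N - 2) * b) * s / L) ^+ 2.
  have q4 : q ^+ 4 != 0 by rewrite gt_eqF // exprn_gt0.
  apply: (mulIf q4); transitivity (8 * (om * N * s * b) ^+ 2); first by rewrite /z om1E; ring.
  by rewrite !exprMn omE; field; rewrite !gt_eqF.
have sgz : 4 * b * dl ^+ 2 <= z * sg.
  (* As sg < 4 b dl, the linear term of the pinching condition is at most 8 (N - 2) b^2 dl, and 2 dl
     - 8 (N - 2) b^2 dl = 2 dl q. *)
  have h1 : 2 * dl * q <= w.
    have : 0 <= 2 * (N - 2) * b * (4 * b * dl - sg) by rewrite !mulr_ge0 //; move: hN hb => *; lra.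
    move: pinch; lra.
  have h2 : (2 * dl * q) ^+ 2 <= w ^+ 2 by rewrite ler_pXn2r ?nnegrE // !mulr_ge0 // ltW.
  have : q ^+ 2 * (4 * b * dl ^+ 2) <= q ^+ 2 * (z * sg).
    have := ler_wpM2l (ltW hb) h2; rewrite w2 om1E /z => h; apply: le_trans (le_trans h _).
      by rewrite le_eqVlt; apply/orP; left; apply/eqP; ring.
    by rewrite le_eqVlt; apply/orP; left; apply/eqP; ring.
  by rewrite ler_pM2l ?exprn_gt0.
rewrite -(pmulr_rge0 _ z0).
have h1 := mulr_ge0 dl0 (_ : 0 <= z * sg - 4 * b * dl ^+ 2); rewrite subr_ge0 in h1; have {}h1 := h1 sgz.
have h2 : 0 <= (dl - 2 * z / 3) ^+ 2 * (dl + z / 3) by rewrite mulr_ge0 ?sqr_ge0 // addr_ge0 // divr_ge0 // ltW.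
have h3 := mulr_ge0 (ltW hb) h2.
have e : 4 * b * M * ((1 + (N - 2) * b) * s / L) ^+ 2 = 4 * b * (8 * z ^+ 2) / 27 by rewrite zE; field; rewrite gt_eqF.
rewrite e; lra.
Qed.

End RicciInequality.

Section RicciEvolution.
Variables (R : realType) (n : nat) (b : R).
Implicit Types (S T U : tensor R n) (A P : 'M[R]_n).
Local Notation N := (n%:R : R).
Local Notation a := (a_of n b).
Local Notation gam := (gamma_of n b).
Local Notation kap := (kappa_param N b a).
Hypotheses (n12 : (12 <= n)%N) (b0 : 0 < b) (bmax : b <= b_max R n).

Let hN : 12 <= N := natr_ge12 R n12.
Let hNb : 4 * (N * b) <= 1 := b_max_bound n12 bmax.
Let n0 : (0 < n)%N. Proof. by apply: leq_trans n12. Qed.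

Lemma nonneg_sec T k p : curvature_symmetries T -> tensor_nonneg T -> 0 <= sec T k p.
Proof.
move=> symT T0; have := (tensor_nonnegP symT).1 T0 (outer (delta_mx 0 k) (delta_mx 0 p)).
by rewrite rform_outer teval_delta.
Qed.

Lemma Ric_evolS S i j : curvature_tensor S -> Ric (evolS b S) i j =
  2 * ric_contract S (Ric S) i j - 4 * b * (ric0 S *m ric0 S) i j
  + 4 * a * (N - 2) * (scal S / N) * ric0 S i j
  + (4 * (N - 1) * a * (scal S / N) ^+ 2 + 2 * (b ^+ 2 + (N - 1) * kap) * \tr (ric0 S *m ric0 S)) * (i == j)%:R.
Proof.
move=> ctS; rewrite /evolS linearD /= Ric_hamiltonQ // Ric_ellD //.
move: (ric0 S *m ric0 S) (ric_contract S _) => A B; rewrite !mxE; ring.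
Qed.

Lemma scal_evolS S : curvature_tensor S -> scal (evolS b S) =
  2 * N * (scal S / N) ^+ 2 + 4 * N * (N - 1) * a * (scal S / N) ^+ 2
  + (2 - 4 * b + 2 * N * (b ^+ 2 + (N - 1) * kap)) * \tr (ric0 S *m ric0 S).
Proof. by move=> ctS; rewrite /evolS linearD /= scal_hamiltonQ // scal_ellD //; ring. Qed.

Lemma omega_ge0 : 0 <= omega_of n b.
Proof. exact: sqrtr_ge0. Qed.

Lemma omega_sqr : omega_of n b ^+ 2 = 27 * (2 + (N - 2) * b) / 8
    * ((1 - 4 * (N - 2) * b ^+ 2) ^+ 4 * (1 + (N - 2) * b) ^+ 2
       / (N ^+ 2 * b ^+ 2 * (2 + (N - 3) * b) ^+ 2)).
Proof. by rewrite sqr_sqrtr // (param_om2_ge0 hN b0 hNb). Qed.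

Section Eigenframe.
Variables S T : tensor R n.
Hypotheses (ctS : curvature_tensor S) (pc : pair_cond b S T) (s0 : 0 < scal S).
Hypothesis Ric_diag : forall p q, p != q -> Ric S p q = 0.

(** Up to explicit terms the derivative is twice the sum of f p * al p, where al p >= dl by (iii)
    for the pair i, p. The part of T in f contributes at least dl * sigma, that of S - T is
    nonnegative, and what results is the expression of [pinched_reaction_ge0]. *)
Lemma evol_ric_eigenframe i j : j != i -> Ric S i i <= Ric S j j ->
  Ric S i i + Ric S j j + 2 * gam / N * scal S = 0 ->
  0 < Ric (evolS b S) i i + Ric (evolS b S) j j + 2 * gam / N * scal (evolS b S).
Proof.
move=> ij le_ij null; have [[symT T0] pU h3 _] := pc; have symS := ctS.1; have sP := ric0_sym symS.
have N0 : 0 < N by rewrite (lt_le_trans _ hN).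
have Nn0 : N != 0 by rewrite gt_eqF.
have n5 : (5 < n)%N by apply: leq_trans n12.
set s := scal S / N; have sp : 0 < s by rewrite divr_gt0.
have Ns : scal S = N * s by rewrite mulrC divfK.
have gs : 2 * gam / N * scal S = 2 * gam * s by rewrite Ns; field.
have g0 : 0 < gam := param_gamma_gt0 hN b0 hNb.
have kp : 0 < kap := param_kappa_gt0 hN b0 hNb.
have k0 : 0 < b ^+ 2 + (N - 1) * kap.
  by apply: addr_gt0; [exact: exprn_gt0|apply: mulr_gt0 kp; have := hN; lra].
have g1 : 0 < 1 - 2 * b by have := param_b_le hN b0 hNb; lra.
have g2 : 0 < 1 + gam by rewrite addr_gt0.
have g4 : 0 < 4 * gam / N by apply: divr_gt0 N0; exact: mulr_gt0.
pose rho p := Ric S p p; pose dl := (rho j - rho i) / 2.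
have dl0 : 0 <= dl by rewrite divr_ge0 // subr_ge0.
have ri : rho i = - (gam * s) - dl by rewrite /dl; move: null; rewrite gs /rho; lra.
have rj : rho j = - (gam * s) + dl by rewrite /dl; move: null; rewrite gs /rho; lra.
have sumrho : \sum_p rho p = N * s by rewrite -Ns.
pose al p := rho p + gam * s.
have rest (F : 'I_n -> R) : \sum_(p in [set q | (q != i) && (q != j)]) F p = \sum_p F p - F i - F j.
  by rewrite -(sum_rest ij); apply: eq_bigl => p; rewrite in_rest.
have al_ge p : p != i -> dl <= al p.
  move=> pi; have := pair_cond_ric pc pi; rewrite gs -!/(rho _) ri /al; lra.
have sum_al : \sum_(p in [set q | (q != i) && (q != j)]) al p = N * (1 + gam) * s.
  rewrite rest big_split /= sumrho sumr_const card_ord -mulr_natl /al ri rj; ring.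
pose f p := sec S i p + sec S j p; pose g p := sec (S - T) i p + sec (S - T) j p.
(* No weight exceeds half of the total because 2 Ric_pp <= scal; so a single negative g p is
   outweighed. *)
have gal : 0 <= \sum_(p in [set q | (q != i) && (q != j)]) g p * al p.
  apply: pairwise_weighted_ge0.
  - move=> p q; rewrite !inE => /andP[pi pj] /andP[qi qj] qp.
    have un : uniq [:: i; j; p; q].
      by rewrite /= !inE !negb_or (eq_sym i j) (eq_sym i p) (eq_sym i q) (eq_sym j p) (eq_sym j q) (eq_sym p q) ij pi pj qi qj qp.
    have := PIC_sec pU un; rewrite /g; lra.
  - by move=> p; rewrite !inE => /andP[pi pj]; apply: le_trans (al_ge p pi).
  - move=> p _; rewrite sum_al.
    have pS := pair_cond_PIC pc.
    have := PIC_Ric_le symS pS p (ltnW n5); rewrite Ns -/(rho p) /al.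
    have : 0 <= (N - 2) * (gam * s) by apply: mulr_ge0; [have := hN; lra|exact: ltW (mulr_gt0 g0 sp)].
    lra.
have tau0 p q : 0 <= sec T p q by exact: nonneg_sec.
have sg0 : 0 <= sigma T i j by apply: sumr_ge0 => p _; rewrite addr_ge0.
have sgE : sigma T i j = \sum_(p in [set q | (q != i) && (q != j)]) (sec T i p + sec T j p).
  by apply: eq_bigl => p; rewrite in_rest.
have fal : dl * sigma T i j <= \sum_(p in [set q | (q != i) && (q != j)]) f p * al p.
  have -> : \sum_(p in [set q | (q != i) && (q != j)]) f p * al p =
    \sum_(p in [set q | (q != i) && (q != j)]) (sec T i p + sec T j p) * al p
    + \sum_(p in [set q | (q != i) && (q != j)]) g p * al p.
    by rewrite -big_split; apply: eq_bigr => p _ /=; rewrite /f /g /sec !tcoefB; ring.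
  rewrite -[leLHS]addr0; apply: lerD gal; rewrite sgE mulr_sumr; apply: ler_sum => p.
  by rewrite inE mulrC => /andP[pi pj]; rewrite ler_wpM2l ?addr_ge0 ?al_ge.
have contr k : ric_contract S (Ric S) k k = \sum_p sec S k p * rho p.
  rewrite mxE; apply: eq_bigr => p _; rewrite (bigD1 p) //= big1 ?addr0 // => q qp.
  by rewrite Ric_diag ?mulr0 // eq_sym.
have sum_contr : ric_contract S (Ric S) i i + ric_contract S (Ric S) j j =
   2 * (gam * s) ^+ 2 + \sum_(p in [set q | (q != i) && (q != j)]) f p * al p.
  rewrite !contr -big_split rest.
  have -> : \sum_p f p * al p = \sum_p (sec S i p * rho p + sec S j p * rho p) + gam * s * (rho i + rho j).
    rewrite /rho !Ric_sec -big_split mulr_sumr -big_split; apply: eq_bigr => p _.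
    by rewrite /= /f /al /rho; ring.
  rewrite /f /al !(sec_diag symS) (sec_sym symS j i) ri rj; ring.
have r0 p q : ric0 S p q = (rho p - s) * (p == q)%:R.
  have e : Ric S p q = ric0 S p q + s * (p == q)%:R by rewrite {1}Ric_decomp !mxE.
  have [pq|pq] := eqVneq p q; first by move: e; rewrite pq eqxx mulr1n /rho; lra.
  by move: e; rewrite Ric_diag // (negbTE pq) mulr0n; lra.
have r0sq k : (ric0 S *m ric0 S) k k = (rho k - s) ^+ 2.
  by rewrite mxE; under eq_bigr => p _ do rewrite {1}r0; under eq_bigr => p _ do rewrite mulrAC; rewrite sum_delta_r' r0 eqxx mulr1n mulr1.
(* S is not Einstein, as Ric_ii + Ric_jj = -2 gam s is negative while scal is positive. This is the
   source of the strict inequality. *)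
have t0 : 0 < \tr (ric0 S *m ric0 S).
  rewrite lt_def tr_sqr_ge0 // andbT; apply/negP => /eqP /(tr_sqr_eq0 sP) z.
  have := r0 i i; have := r0 j j; rewrite z !mxE !eqxx !mulr1n !mulr1 ri rj.
  have := mulr_gt0 g0 sp; move: sp; lra.
have L2 := param_L_gt2 hN b0 hNb; have Ln0 := param_L_neq0 hN b0 hNb.
have pinch : 2 * dl <= Num.sqrt (omega_of n b) * Num.sqrt (scal S) * Num.sqrt (sigma T i j) + 2 * (N - 2) * b * sigma T i j.
  have := pair_cond_pinch pc (_ : i != j); rewrite eq_sym ij => /(_ isT); rewrite -!/(rho _) /dl; lra.
have w2 : (Num.sqrt (omega_of n b) * Num.sqrt (scal S) * Num.sqrt (sigma T i j)) ^+ 2 = omega_of n b * (N * s) * sigma T i j.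
  by rewrite !exprMn !sqr_sqrtr ?omega_ge0 // ?Ns // ltW // mulr_gt0.
have w0 : 0 <= Num.sqrt (omega_of n b) * Num.sqrt (scal S) * Num.sqrt (sigma T i j) by rewrite !mulr_ge0 ?sqrtr_ge0.
have := pinched_reaction_ge0 hN b0 hNb omega_ge0 omega_sqr sp dl0 w0 w2 pinch.
rewrite !Ric_evolS // scal_evolS // -/s !eqxx !r0sq !r0 !eqxx !mulr1n !mulr1.
set t := \tr _ in t0 *.
have ct : 0 < (4 * (b ^+ 2 + (N - 1) * kap) * (1 + gam) + 4 * gam / N * (1 - 2 * b)) * t.
  apply: mulr_gt0 t0; apply: addr_gt0 (mulr_gt0 g4 g1); apply: mulr_gt0 g2; exact: mulr_gt0.
set F := \sum_(p in _) _ * _ in fal sum_contr.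
move=> main.
have e : 2 * gam / N * (2 * N * s ^+ 2 + 4 * N * (N - 1) * a * s ^+ 2 + (2 - 4 * b + 2 * N * (b ^+ 2 + (N - 1) * kap)) * t)
  = 4 * gam * s ^+ 2 + 8 * gam * (N - 1) * a * s ^+ 2 + (4 * (b ^+ 2 + (N - 1) * kap) * gam + 4 * gam / N * (1 - 2 * b)) * t by field.
rewrite e ri rj.
(* All terms in s^2 collapse to the first term of [pinched_reaction_ge0] by the choice of a and
   gamma. *)
have es : 4 * (gam * s) ^+ 2 - 8 * b * ((1 + gam) * s) ^+ 2 - 8 * a * (N - 2) * (1 + gam) * s ^+ 2 + 8 * (N - 1) * a * s ^+ 2 + 4 * gam * s ^+ 2 + 8 * gam * (N - 1) * a * s ^+ 2
  = 4 * b * (2 + (N - 2) * b) * ((1 + (N - 2) * b) * s / (2 + (N - 3) * b)) ^+ 2.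
  by rewrite /a_of /gamma_of; field.
move: sum_contr; move: (ric_contract _ _ i i) (ric_contract _ _ j j) => ci cj sum_contr.
lra.
Qed.

End Eigenframe.

End RicciEvolution.

Section EvolutionRotation.
Variables (R : realType) (n : nat) (b : R).
Implicit Types (S T U : tensor R n) (A P : 'M[R]_n).

Lemma evolS_rot P S : P *m P^T = 1%:M -> evolS b (rotT P S) = rotT P (evolS b S).
Proof. by move=> PP; rewrite /evolS rotD rot_hamiltonQ // rot_ellD. Qed.

Lemma evolT_rot P S T : P *m P^T = 1%:M -> evolT b (rotT P S) (rotT P T) = rotT P (evolT b S T).
Proof.
by move=> PP; rewrite /evolT !rotD rotZ rot_square // rot_sharp // rot_kn // !mulmx1 PP eps_rot.
Qed.

Lemma linear_term_eq0 (x y : R) : (forall t : R, 0 <= 2 * t * x + y) -> x = 0.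
Proof.
move=> h; apply/eqP; apply: contraT => xn.
have := h (- (y + 1) / (2 * x)); rewrite (_ : _ + y = -1); first by lra.
by field.
Qed.

(** The second equation says that the symmetric block with entries x, y, z becomes diagonal in the
    rotated frame; the root t used in the proof is the tangent of the angle. *)
Lemma exists_rotation (x y z : R) : exists c s : R, c ^+ 2 + s ^+ 2 = 1 /\ (z - x) * c * s + y * (c ^+ 2 - s ^+ 2) = 0.
Proof.
have [->|y0] := eqVneq y 0; first by exists 1, 0; split; ring.
pose w := Num.sqrt ((z - x) ^+ 2 + 4 * y ^+ 2).
have w2 : w ^+ 2 = (z - x) ^+ 2 + 4 * y ^+ 2 by rewrite sqr_sqrtr // addr_ge0 ?sqr_ge0 // mulr_ge0 ?sqr_ge0.
pose t := (z - x + w) / (2 * y).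
have t_root : y * t ^+ 2 = (z - x) * t + y.
  by apply/eqP; rewrite -subr_eq0; apply/eqP; rewrite /t; transitivity ((w ^+ 2 - ((z - x) ^+ 2 + 4 * y ^+ 2)) / (4 * y)); [field|rewrite w2 subrr mul0r].
have r0 : 0 < 1 + t ^+ 2 by rewrite ltr_pwDl ?sqr_ge0.
pose c := (Num.sqrt (1 + t ^+ 2))^-1.
have c2 : c ^+ 2 * (1 + t ^+ 2) = 1 by rewrite exprVn sqr_sqrtr ?ltW // mulVf // gt_eqF.
exists c, (t * c); split; first by rewrite -c2; ring.
transitivity (c ^+ 2 * ((z - x) * t + y - y * t ^+ 2)); first by ring.
by rewrite t_root subrr mulr0.
Qed.

Hypotheses (n12 : (12 <= n)%N) (b0 : 0 < b) (bmax : b <= b_max R n).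
Local Notation gam := (gamma_of n b).
Local Notation N := (n%:R : R).

Section Minimum.
Variables S T : tensor R n.
Hypotheses (ctS : curvature_tensor S) (pc : pair_cond b S T).

(** Tilting e_i towards e_p with e_j fixed gives a polynomial in t that is nonnegative by (iii), and
    whose t^2 coefficient is the vanishing quantity. So its linear coefficient, twice Ric_ip, is
    zero. *)
Lemma null_ric_offdiag i j p : j != i -> p != i -> p != j ->
  Ric S i i + Ric S j j + 2 * gam / N * scal S = 0 -> Ric S i p = 0.
Proof.
move=> ij pi pj null; have symS := ctS.1.
have eR x y : Ric S x y = Ric S y x by rewrite -{1}(Ric_sym symS) mxE.
apply: (@linear_term_eq0 _ (Ric S p p + Ric S j j + 2 * gam / N * scal S)) => t.
pose e (m : 'I_n) : 'rV[R]_n := delta_mx 0 m.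
have de x y : dot (e x) (e y) = (x == y)%:R by rewrite dot_delta mxE /= eq_sym.
pose r := Num.sqrt (t ^+ 2 + 1).
have rr : r ^+ 2 = t ^+ 2 + 1 by rewrite sqr_sqrtr // addr_ge0 ?sqr_ge0.
pose u := t *: e i + e p; pose v := r *: e j.
have uu : dot u u = t ^+ 2 + 1.
  rewrite /u !dotE !(bdotDl, bdotDr, bdotZl, bdotZr) -!dotE !de !eqxx (negbTE pi) (eq_sym i) (negbTE pi) /=; ring.
have uv : dot u u = dot v v by rewrite uu /v !dotE bdotZl bdotZr -dotE de eqxx -rr /=; ring.
have ouv : dot u v = 0.
  rewrite /u /v !dotE !(bdotDl, bdotDr, bdotZl, bdotZr) -!dotE !de (negbTE pj) (eq_sym i) (negbTE ij) /=; ring.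
have := pair_cond_two_nonneg pc uv ouv; rewrite uu /u /v.
rewrite !(bevalDl, bevalDr, bevalZl, bevalZr) !beval_delta (eR p i) => h; apply: (le_trans h).
have -> : r * (r * Ric S j j) = (t ^+ 2 + 1) * Ric S j j by rewrite mulrA -expr2 rr.
have -> : Ric S i i = - (Ric S j j + 2 * gam / N * scal S) by move: null; lra.
by rewrite le_eqVlt; apply/orP; left; apply/eqP; ring.
Qed.

Hypothesis s0 : 0 < scal S.

(** At a minimum the plane of e_i and e_j is invariant under Ric S. Diagonalizing inside this plane
    and extending to an eigenframe reduces to [evol_ric_eigenframe], because all quantities involved
    are traces over the plane. *)
Lemma evol_ric i j : j != i -> Ric S i i + Ric S j j + 2 * gam / N * scal S = 0 ->
  0 < Ric (evolS b S) i i + Ric (evolS b S) j j + 2 * gam / N * scal (evolS b S).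
Proof.
move=> ij null; have symS := ctS.1.
have eR x y : Ric S x y = Ric S y x by rewrite -{1}(Ric_sym symS) mxE.
have Ri p : p != i -> p != j -> Ric S i p = 0 by move=> pi pj; exact: null_ric_offdiag null.
have Rj p : p != i -> p != j -> Ric S j p = 0.
  by move=> pi pj; apply: (@null_ric_offdiag j i) => //; rewrite 1?eq_sym // (addrC (Ric S j j)).
have [c [s [cs1 cs0]]] := exists_rotation (Ric S i i) (Ric S i j) (Ric S j j).
pose e (m : 'I_n) : 'rV[R]_n := delta_mx 0 m.
have de x y : dot (e x) (e y) = (x == y)%:R by rewrite dot_delta mxE /= eq_sym.
pose f1 := c *: e i + s *: e j; pose f2 := (- s) *: e i + c *: e j.
have o : orthonormal [:: f1; f2].
  have d := (bdotDl, bdotDr, bdotZl, bdotZr).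
  by apply: orthonormal2; rewrite -?[RHS]cs1 /f1 /f2 !dotE !d -!dotE !de !eqxx (eq_sym i) (negbTE ij) /=; ring.
have blk (A : 'M[R]_n) k : (forall p, p != i -> p != j -> A k p = 0) -> e k *m A = A k i *: e i + A k j *: e j.
  move=> h; apply/rowP => p; rewrite -rowE !mxE /=.
  have [->|pi] := eqVneq p i; first by rewrite (eq_sym i) (negbTE ij) /=; ring.
  have [->|pj] := eqVneq p j; first by rewrite /=; ring.
  by rewrite h //=; ring.
pose l1 := c ^+ 2 * Ric S i i + 2 * c * s * Ric S i j + s ^+ 2 * Ric S j j.
pose l2 := s ^+ 2 * Ric S i i - 2 * c * s * Ric S i j + c ^+ 2 * Ric S j j.
have x1 : c * Ric S i i + s * Ric S i j = l1 * c.
  have := congr1 ( *%R (- s)) cs0; have := congr1 ( *%R^~ (c * Ric S i i + s * Ric S i j)) cs1; rewrite /l1; lra.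
have x2 : c * Ric S i j + s * Ric S j j = l1 * s.
  have := congr1 ( *%R c) cs0; have := congr1 ( *%R^~ (c * Ric S i j + s * Ric S j j)) cs1; rewrite /l1; lra.
have x3 : - s * Ric S i i + c * Ric S i j = l2 * - s.
  have := congr1 ( *%R c) cs0; have := congr1 ( *%R^~ (- s * Ric S i i + c * Ric S i j)) cs1; rewrite /l2; lra.
have x4 : - s * Ric S i j + c * Ric S j j = l2 * c.
  have := congr1 ( *%R s) cs0; have := congr1 ( *%R^~ (- s * Ric S i j + c * Ric S j j)) cs1; rewrite /l2; lra.
have eig x y : (x *: e i + y *: e j) *m Ric S = (x * Ric S i i + y * Ric S i j) *: e i + (x * Ric S i j + y * Ric S j j) *: e j.
  rewrite mulmxDl -!scalemxAl !blk // (eR j i) !scalerDr !scalerA addrACA -!scalerDl; congr (_ *: _ + _ *: _); ring.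
have eig1 : f1 *m Ric S = l1 *: f1 by rewrite /f1 eig x1 x2 scalerDr !scalerA.
have eig2 : f2 *m Ric S = l2 *: f2 by rewrite /f2 eig x3 x4 scalerDr !scalerA.
have n2 : (size [:: f1; f2] <= n)%N by apply: leq_trans n12.
have [|P PP rows] := orthonormal_eigenbasis (Ric_sym symS) o n2.
  by case=> [|[|//]] _; [exists l1|exists l2].
have p0 : (0 < n)%N by apply: leq_trans n12.
have p1 : (1 < n)%N by apply: leq_trans n12.
have r0 : row (Ordinal p0) P = f1 by have [h _] := rows (Ordinal p0); exact: h.
have r1 : row (Ordinal p1) P = f2 by have [h _] := rows (Ordinal p1); exact: h.
have ePA (A : 'M[R]_n) x y : (P *m A *m P^T) x y = beval A (row x P) (row y P).
  by rewrite -beval_delta beval_conj -!rowE.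
have diag p q : p != q -> Ric (rotT P S) p q = 0.
  move=> pq; rewrite Ric_rot // ePA bevalE; have [_ [l ->]] := rows p.
  have := orthogonal_rows p q PP; rewrite (negbTE pq) dotE /bdot => h.
  by rewrite -scalemxAl mxE h mulr0.
have sumf (A : 'M[R]_n) : beval A f1 f1 + beval A f2 f2 = A i i + A j j.
  rewrite /f1 /f2 !(bevalDl, bevalDr, bevalZl, bevalZr) !beval_delta.
  transitivity ((c ^+ 2 + s ^+ 2) * (A i i + A j j)); first by ring.
  by rewrite cs1 mul1r.
have sum01 (A : 'M[R]_n) : (P *m A *m P^T) (Ordinal p0) (Ordinal p0) + (P *m A *m P^T) (Ordinal p1) (Ordinal p1) = A i i + A j j.
  by rewrite !ePA r0 r1 sumf.
have null' : Ric (rotT P S) (Ordinal p0) (Ordinal p0) + Ric (rotT P S) (Ordinal p1) (Ordinal p1) + 2 * gam / N * scal (rotT P S) = 0.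
  by rewrite Ric_rot // scal_rot // sum01.
have ct' := ct_rot P ctS; have pc' := pair_cond_rot PP pc.
have s0' : 0 < scal (rotT P S) by rewrite scal_rot.
have fin : Ric (evolS b (rotT P S)) (Ordinal p0) (Ordinal p0) + Ric (evolS b (rotT P S)) (Ordinal p1) (Ordinal p1) + 2 * gam / N * scal (evolS b (rotT P S))
   = Ric (evolS b S) i i + Ric (evolS b S) j j + 2 * gam / N * scal (evolS b S).
  by rewrite evolS_rot // Ric_rot // scal_rot // sum01.
rewrite -fin.
have p10 : Ordinal p1 != Ordinal p0 by [].
have p01 : Ordinal p0 != Ordinal p1 by [].
have [le01|/ltW le10] := leP (Ric (rotT P S) (Ordinal p0) (Ordinal p0)) (Ric (rotT P S) (Ordinal p1) (Ordinal p1)).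
  exact: (evol_ric_eigenframe n12 b0 bmax ct' pc' s0' diag p10 le01 null').
rewrite (addrC (Ric _ (Ordinal p0) _)).
rewrite (addrC (Ric _ (Ordinal p0) _)) in null'.
exact: (evol_ric_eigenframe n12 b0 bmax ct' pc' s0' diag p01 le10 null').
Qed.

End Minimum.

End EvolutionRotation.

(** * Condition (iv) *)

Section PinchingInequality.
Variable R : rcfType.
Variables N b om s lm sg : R.
Hypotheses (hN : 12 <= N) (hb : 0 < b) (hNb : 4 * (N * b) <= 1).
Local Notation L := (2 + (N - 3) * b).
Local Notation M := (2 + (N - 2) * b).
Local Notation gam := (b / L).
Local Notation a := (M ^+ 2 / (2 * L) * b).
Local Notation q := (1 - 4 * (N - 2) * b ^+ 2).
Hypotheses (om0 : 0 <= om)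
  (omE : om ^+ 2 = 27 * M / 8 * (q ^+ 4 * (1 + (N - 2) * b) ^+ 2 / (N ^+ 2 * b ^+ 2 * L ^+ 2))).
Hypotheses (s0 : 0 < s) (lm0 : 0 < lm) (sg0 : 0 < sg) (lmE : 4 * lm ^+ 2 * sg = om * N * s).
Local Notation C := (2 + N / (N - 3) + 4 * a * (N - 2) + (2 / (N - 2) + 4 * b) * (2 * (1 + gam))).

(** C s bounds the coefficient of Dl in the derivative of Ric_jj - Ric_ii. After dividing by 2 sg s
    lm, with t = (N - 2) b / lm, the claim is a cubic inequality in t. *)
Lemma pinched_trace_le (Dl := 2 * sg * (lm + (N - 2) * b)) :
  Dl * s * C <= (lm + 2 * (N - 2) * b) * (Dl ^+ 2 / (N - 2)) + om / (4 * lm) * ((2 * N + 4 * N * (N - 1) * a) * s ^+ 2).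
Proof.
have gtC := param_om_gtC hN hb hNb om0 omE.
have a0 := param_a_gt0 hN hb hNb; have g0 := param_gamma_gt0 hN hb hNb.
have L0 := param_L_gt2 hN hb hNb.
have N0 : 0 < N by move: hN; lra.
have N2 : 0 < N - 2 by move: hN; lra.
have N3 : 0 < N - 3 by move: hN; lra.
move: gtC a0 g0; rewrite /Dl; move: (a) (gam) => a' g' gtC a0 g0.
pose C' := om * N / (2 * (N - 2)); pose v := (N - 2) * b.
have v0 : 0 < v by rewrite mulr_gt0.
pose C1 := 2 + N / (N - 3) + 4 * a' * (N - 2) + (2 / (N - 2) + 4 * b) * (2 * (1 + g')).
have h1 : C1 < C' + 1 + 2 * (N - 1) * a'.
  have -> : C1 = 1 + N / (N - 3) + 2 * a' * (N - 3) + (4 / (N - 2) + 8 * b) * (1 + g') + 1 + 2 * (N - 1) * a'.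
    by rewrite /C1; field; rewrite !gt_eqF.
  by rewrite -/C' in gtC; lra.
have h2 : 2 + 2 * a' * (N - 3) < C'.
  apply: le_lt_trans gtC.
  have : 1 <= N / (N - 3) by rewrite ler_pdivlMr //; move: hN; lra.
  have : 0 <= (4 / (N - 2) + 8 * b) * (1 + g').
    by rewrite mulr_ge0 ?addr_ge0 ?divr_ge0 ?mulr_ge0 // ltW.
  lra.
have h3 : C1 <= 4 * C' by have : 0 <= a' * (N - 12) by [rewrite mulr_ge0 ?subr_ge0 // ltW]; lra.
have lmn : lm != 0 by rewrite gt_eqF.
have e1 : om / (4 * lm) * ((2 * N + 4 * N * (N - 1) * a') * s ^+ 2) = 2 * sg * s * (lm * (1 + 2 * (N - 1) * a')).
  transitivity ((om * N * s) * s / (4 * lm) * (2 + 4 * (N - 1) * a')); first by field.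
  by rewrite -lmE; field.
have e2 : (lm + 2 * (N - 2) * b) * ((2 * sg * (lm + (N - 2) * b)) ^+ 2 / (N - 2)) = 2 * sg * s * (C' * (lm + v) ^+ 2 * (lm + 2 * v) / lm ^+ 2).
  transitivity (2 * sg * ((4 * lm ^+ 2 * sg) / (2 * (N - 2)) * (lm + v) ^+ 2 * (lm + 2 * v) / lm ^+ 2)).
    by rewrite /v; field; rewrite lmn gt_eqF.
  by rewrite lmE /C' /v; field; rewrite lmn gt_eqF.
rewrite e1 e2 -mulrDr -/C1 -/v.
rewrite [leLHS](_ : _ = 2 * sg * s * ((lm + v) * C1)); last by ring.
rewrite ler_pM2l ?mulr_gt0 //.
pose t := v / lm; have t0 : 0 < t by rewrite divr_gt0.
have -> : v = t * lm by rewrite divfK.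
rewrite [leRHS](_ : _ = lm * (C' * (1 + t) ^+ 2 * (1 + 2 * t) + (1 + 2 * (N - 1) * a'))); last by field.
rewrite [leLHS](_ : _ = lm * ((1 + t) * C1)); last by ring.
rewrite ler_pM2l //.
have C0 : 0 < C' by have := mulr_gt0 a0 N3; lra.
(* C' (1 + t)^2 (1 + 2t) = C' (1 + 4t + 5t^2 + 2t^3): [h1] settles the constant term and [h3] the
   linear one. *)
have : 0 <= t * (4 * C' - C1) by rewrite mulr_ge0 ?subr_ge0 // ltW.
have : 0 <= C' * (5 * t ^+ 2 + 2 * t ^+ 3) by apply: mulr_ge0 (ltW C0) _; rewrite addr_ge0 // mulr_ge0 // exprn_ge0 // ltW.
lra.
Qed.

(* [Dl'], [sg'], [sc'] are the time derivatives of the three quantities in the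
   pinching condition; [Bs], [Ps], [Y] and [E] are squared norms. *)
Lemma pinched_combination (C1 K Dl Dl' sg' sc' Bs Ps BP xi xj Xi Xj Yi Yj Ei Ej br : R) :
  b <= 48^-1 -> 24 / 5 <= om ->
  (lm + 2 * (N - 2) * b) * (Dl ^+ 2 / (N - 2)) + om / (4 * lm) * K >= Dl * s * C1 ->
  0 <= Dl -> br <= s * C1 ->
  Dl' = 2 * BP + Dl * br + 4 * (xi - xj) - 4 * b * (Yj - Yi) ->
  0 <= Bs -> 0 <= Ps -> 0 <= Yi -> 0 <= Yj -> 0 <= Ej ->
  2 * BP <= lm * Bs + lm^-1 * Ps ->
  2 * xi <= lm * Xi + lm^-1 * Yi -> - 2 * xj <= lm * Xj + lm^-1 * Yj ->
  2 * Xi <= Ei -> 2 * Xj <= Ej -> 2 * Yi <= (N - 2) * Ei ->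
  Bs + Dl ^+ 2 / (N - 2) + Ei + Ej < sg' ->
  K + (2 - 4 * b) * (Ps + 2 * Yi + 2 * Yj) <= sc' ->
  0 < lm * sg' + om / (4 * lm) * sc' - (Dl' - 2 * (N - 2) * b * sg').
Proof.
move=> b48 om5 tr Dl0 hbr -> Bs0 Ps0 Yi0 Yj0 Ej0 hBP hxi hxj hXi hXj hYi hsg hsc.
have N2 : 0 < N - 2 by move: hN; lra.
have bt : 0 < lm + 2 * (N - 2) * b by rewrite addr_gt0 // !mulr_gt0.
have mu0 : 0 <= om / (4 * lm) by rewrite divr_ge0 // mulr_ge0 // ltW.
(* The share of |Ric0|^2 in scal' must pay for the terms with weight 1/lm left by Young's
   inequality, which amounts to om (2 - 4b) >= 4. *)
have mu1 : lm^-1 <= om / (4 * lm) * (2 - 4 * b).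
  have -> : om / (4 * lm) * (2 - 4 * b) = lm^-1 * (om * (2 - 4 * b) / 4) by field; rewrite gt_eqF.
  rewrite ler_peMr ?invr_ge0 ?(ltW lm0) //.
  have : 0 <= (om - 24 / 5) * (2 - 4 * b) by rewrite mulr_ge0 ?subr_ge0 //; lra.
  lra.
have p1 : 0 < (lm + 2 * (N - 2) * b) * (sg' - (Bs + Dl ^+ 2 / (N - 2) + Ei + Ej)) by rewrite mulr_gt0 // subr_gt0.
have p2 : 0 <= om / (4 * lm) * (sc' - (K + (2 - 4 * b) * (Ps + 2 * Yi + 2 * Yj))) by rewrite mulr_ge0 // subr_ge0.
have p3 : 0 <= (om / (4 * lm) * (2 - 4 * b) - lm^-1) * (Ps + 2 * Yi + 2 * Yj).
  by rewrite mulr_ge0 ?subr_ge0 // !addr_ge0 // mulr_ge0.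
have p4 : 0 <= 2 * (N - 2) * b * Bs by rewrite !mulr_ge0 // ltW.
(* The surplus 2 (N - 2) b Ei pays for the term 4 b Yi of Dl'. *)
have p5 : 0 <= 2 * b * ((N - 2) * Ei - 2 * Yi) by rewrite !mulr_ge0 ?subr_ge0 // ltW.
have p6 : 0 <= 2 * (N - 2) * b * Ej by rewrite !mulr_ge0 // ltW.
have p7 : 0 <= Dl * (s * C1 - br) by rewrite mulr_ge0 // subr_ge0.
have p8 : 0 <= lm * (Ei - 2 * Xi) by rewrite mulr_ge0 ?subr_ge0 // ltW.
have p9 : 0 <= lm * (Ej - 2 * Xj) by rewrite mulr_ge0 ?subr_ge0 // ltW.
have p10 : 0 <= b * Yj by rewrite mulr_ge0 // ltW.
move: (om / (4 * lm)) (lm^-1) (Dl ^+ 2 / (N - 2)) tr p1 p2 p3 hBP hxi hxj {hsg hsc hbr mu0 mu1} => mu li D2 *.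
lra.
Qed.

End PinchingInequality.

Section FiniteSums.
Variables (R : realFieldType) (I : finType).

Lemma sqr_sum_le (P : pred I) (F : I -> R) : (\sum_(p | P p) F p) ^+ 2 <= #|P|%:R * \sum_(p | P p) F p ^+ 2.
Proof.
have [m0|m0] := eqVneq #|P| 0%N.
  have P0 p : P p = false by have := fintype.card0_eq m0 p; rewrite inE.
  by rewrite !big_pred0 // expr0n mulr0.
have mp : 0 < #|P|%:R :> R by rewrite ltr0n lt0n.
set S1 := \sum_(p | P p) F p; set m := #|P|%:R in mp *.
have : 0 <= \sum_(p | P p) (m * F p - S1) ^+ 2 by apply: sumr_ge0 => p _; exact: sqr_ge0.
have -> : \sum_(p | P p) (m * F p - S1) ^+ 2 = m * (m * \sum_(p | P p) F p ^+ 2 - S1 ^+ 2).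
  transitivity (\sum_(p | P p) (m ^+ 2 * F p ^+ 2 - (2 * m * S1) * F p + S1 ^+ 2)).
    by apply: eq_bigr => p _; ring.
  rewrite big_split sumrB -!mulr_sumr sumr_const -/S1 -mulr_natl -/m /=; ring.
by rewrite pmulr_rge0 // subr_ge0.
Qed.

Lemma sum_cond_delta (P : pred I) (F : I -> R) p : P p -> \sum_(q | P q) F q * (p == q)%:R = F p.
Proof.
move=> Pp; rewrite (bigD1 p) //= eqxx mulr1 big1 ?addr0 // => q /andP[_ /negbTE qp].
by rewrite eq_sym qp mulr0.
Qed.

Lemma sum_shift_delta (P : pred I) (A B : I -> I -> R) u v :
  \sum_(p | P p) \sum_(q | P q) (A p q - u * (p == q)%:R) * (B p q - v * (p == q)%:R) =
  \sum_(p | P p) \sum_(q | P q) A p q * B p q - u * \sum_(p | P p) B p p - v * \sum_(p | P p) A p p + #|P|%:R * (u * v).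
Proof.
rewrite !mulr_sumr mulr_natl -sumr_const -!sumrB -big_split /=; apply: eq_bigr => p Pp.
transitivity (\sum_(q | P q) (A p q * B p q - (u * B p q + v * A p q - u * v) * (p == q)%:R)); last first.
  by rewrite sumrB sum_cond_delta //; ring.
by apply: eq_bigr => q _; case: eqP => _ /=; ring.
Qed.

End FiniteSums.

Section TensorEstimates.
Variables (R : realType) (n : nat).
Implicit Types (S T U : tensor R n) (A P : 'M[R]_n).
Variables i j : 'I_n.
Hypothesis ij : j != i.
Local Notation rest := (fun p => (p != i) && (p != j)).

Lemma sum_sum_two (F : 'I_n -> 'I_n -> R) : \sum_p \sum_q F p q =
  F i i + F i j + F j i + F j j + \sum_(q | rest q) (F i q + F q i + F j q + F q j)
  + \sum_(p | rest p) \sum_(q | rest q) F p q.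
Proof.
have ij' : i != j by rewrite eq_sym.
transitivity (\sum_p (F p i + F p j + \sum_(q | rest q) F p q)).
  by apply: eq_bigr => p _; exact: sum_two.
rewrite (sum_two _ ij') !big_split /=; ring.
Qed.

Lemma card_rest_two : (2 <= n)%N -> #|(rest : pred 'I_n)|%:R = n%:R - 2 :> R.
Proof.
move=> n2; have := sum_rest (R := R) ij (fun=> 1); rewrite !sumr_const card_ord => ->; ring.
Qed.

(* The pairs [{k, q}], [{p, q}] and [{i, j}] are distinct. *)
Lemma sum_sym_ge (F : 'I_n -> 'I_n -> R) p : (forall q r, 0 <= F q r) -> (forall q r, F q r = F r q) ->
  F i i = 0 -> F j j = 0 -> F p p = 0 -> rest p ->
  2 * F i j + 2 * \sum_(q | rest q) F i q + 2 * \sum_(q | rest q) F j q + 2 * \sum_(q | rest q) F p q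
  <= \sum_q \sum_r F q r.
Proof.
move=> F0 Fs Fi Fj Fp rp; rewrite sum_sum_two Fi Fj (Fs j i).
have h : 2 * \sum_(q | rest q) F p q <= \sum_(q | rest q) \sum_(r | rest r) F q r.
  rewrite [leRHS](bigD1 p) //= [\sum_(q | rest q) F p q](bigD1 p) //= Fp add0r mulr_natl mulr2n.
  rewrite lerD2l; apply: ler_sum => q /andP[rq qp].
  by rewrite (bigD1 p) //= (Fs q) lerDl sumr_ge0.
have -> : \sum_(q | rest q) (F i q + F q i + F j q + F q j) = 2 * \sum_(q | rest q) F i q + 2 * \sum_(q | rest q) F j q.
  by rewrite !mulr_sumr -big_split; apply: eq_bigr => q _ /=; rewrite (Fs q i) (Fs q j); ring.
lra.
Qed.

Section Symmetric.
Variable S : tensor R n.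
Hypothesis symS : curvature_symmetries S.

Lemma sec_square k p : sec (tensor_square S) k p = \sum_q \sum_r tcoef S k p q r ^+ 2.
Proof. by rewrite /sec tcoef_square. Qed.

Lemma sec_square_ge k p : rest p ->
  2 * tcoef S k p i j ^+ 2 + 2 * \sum_(q | rest q) tcoef S k p i q ^+ 2
  + 2 * \sum_(q | rest q) tcoef S k p j q ^+ 2 + 2 * \sum_(q | rest q) tcoef S k p p q ^+ 2
  <= sec (tensor_square S) k p.
Proof.
move=> rp; rewrite sec_square; apply: (@sum_sym_ge (fun q r => tcoef S k p q r ^+ 2)) => //.
- by move=> q r; exact: sqr_ge0.
- by move=> q r; rewrite (cs34 symS) sqrrN.
- by rewrite (cs_kk symS) expr0n.
- by rewrite (cs_kk symS) expr0n.
- by rewrite (cs_kk symS) expr0n.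
Qed.

Definition normal_diff p q : R := tcoef S j p j q - tcoef S i p i q.
(** The squares of the components whose sums over p are the off-diagonal Ricci entries Ric_kq. *)
Definition mixed_norm k : R := 2 * \sum_(q | rest q) \sum_p tcoef S k p q p ^+ 2.

(** The sectional curvatures of S^2 are full norms of slices of S. The components S_ipiq and S_jpjq
    dominate [normal_diff]; the others are regrouped across slices, the p = j terms of
    [mixed_norm i] coming from the slices of j and conversely. *)
Lemma sigma_square_ge :
  \sum_(p | rest p) \sum_(q | rest q) normal_diff p q ^+ 2 + mixed_norm i + mixed_norm j
  <= sigma (tensor_square S) i j.
Proof.
have ij' : i != j by rewrite eq_sym.
have hi := fun p (rp : rest p) => @sec_square_ge i p rp; have hj := fun p (rp : rest p) => @sec_square_ge j p rp.
have mi : mixed_norm i = \sum_(q | rest q) (2 * tcoef S j q i j ^+ 2 + 2 * \sum_(p | rest p) tcoef S i q q p ^+ 2).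
  rewrite /mixed_norm mulr_sumr.
  transitivity (\sum_(q | rest q) 2 * tcoef S j q i j ^+ 2 + 2 * \sum_(q | rest q) \sum_(p | rest p) tcoef S i p q p ^+ 2).
    rewrite mulr_sumr -big_split; apply: eq_bigr => q _ /=; rewrite (sum_two _ ij') (cs_ii symS) expr0n add0r mulrDr.
    by rewrite (cspair symS i j q j) (cs12 symS q j) sqrrN.
  rewrite big_split /=; congr (_ + _); rewrite -mulr_sumr; congr (_ * _).
  rewrite exchange_big; apply: eq_bigr => q _; apply: eq_bigr => p _.
  by rewrite (cs34 symS i q p) sqrrN.
have mj : mixed_norm j = \sum_(q | rest q) (2 * tcoef S i q i j ^+ 2 + 2 * \sum_(p | rest p) tcoef S j q q p ^+ 2).
  rewrite /mixed_norm mulr_sumr.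
  transitivity (\sum_(q | rest q) 2 * tcoef S i q i j ^+ 2 + 2 * \sum_(q | rest q) \sum_(p | rest p) tcoef S j p q p ^+ 2).
    rewrite mulr_sumr -big_split; apply: eq_bigr => q _ /=; rewrite (sum_two _ ij') (cs_ii symS j) expr0n addr0 mulrDr.
    by rewrite (cspair symS j i q i) (cs34 symS q i) sqrrN (cs12 symS q i) sqrrN.
  rewrite big_split /=; congr (_ + _); rewrite -mulr_sumr; congr (_ * _).
  rewrite exchange_big; apply: eq_bigr => q _; apply: eq_bigr => p _.
  by rewrite (cs34 symS j q p) sqrrN.
rewrite mi mj -!big_split /sigma; apply: ler_sum => p rp /=.
apply: le_trans (lerD (hi p rp) (hj p rp)).
have h : \sum_(q | rest q) normal_diff p q ^+ 2 <= 2 * \sum_(q | rest q) tcoef S i p i q ^+ 2 + 2 * \sum_(q | rest q) tcoef S j p j q ^+ 2.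
  rewrite !mulr_sumr -big_split; apply: ler_sum => q _ /=; rewrite /normal_diff.
  have := sqr_ge0 (tcoef S j p j q + tcoef S i p i q); lra.
have z1 : 0 <= \sum_(q | rest q) tcoef S i p j q ^+ 2 by apply: sumr_ge0 => q _; exact: sqr_ge0.
have z2 : 0 <= \sum_(q | rest q) tcoef S j p i q ^+ 2 by apply: sumr_ge0 => q _; exact: sqr_ge0.
lra.
Qed.

(** Cauchy-Schwarz: Ric_kq is the sum of the n - 2 terms S_kpqp with p different from k and q. *)
Lemma sqr_offdiag_ric0_le k : k = i \/ k = j -> (2 <= n)%N ->
  2 * \sum_(q | rest q) ric0 S k q ^+ 2 <= (n%:R - 2) * mixed_norm k.
Proof.
move=> kij n2; rewrite /mixed_norm mulrCA ler_pM2l // mulr_sumr; apply: ler_sum => q /andP[qi qj].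
have qk : q != k by case: kij => ->.
have RicE : ric0 S k q = \sum_(p | (p != k) && (p != q)) tcoef S k p q p.
  have e : Ric S k q = ric0 S k q + (scal S / n%:R) * (k == q)%:R by rewrite {1}Ric_decomp !mxE.
  move: e; rewrite (eq_sym k) (negbTE qk) mulr0 addr0 => <-.
  by rewrite mxE (sum_two _ (_ : k != q)) 1?eq_sym // (cs_ii symS) (cs_kk symS) !add0r.
rewrite RicE; apply: le_trans (sqr_sum_le _ _) _.
have -> : #|(fun p : 'I_n => (p != k) && (p != q))|%:R = n%:R - 2 :> R.
  have := sum_rest (R := R) qk (fun=> 1); rewrite !sumr_const card_ord => ->; ring.
rewrite ler_wpM2l ?subr_ge0 ?(ler_nat R 2) //.
rewrite [leRHS](sum_two _ (_ : k != q)) 1?eq_sym // lerDr addr_ge0 ?sqr_ge0 //.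
Qed.

End Symmetric.

Lemma tr_sqr_ge A : A^T = A ->
  \sum_(p | rest p) \sum_(q | rest q) A p q ^+ 2 + 2 * \sum_(q | rest q) A i q ^+ 2 + 2 * \sum_(q | rest q) A j q ^+ 2
  <= \tr (A *m A).
Proof.
move=> sA; have eA x y : A x y = A y x by rewrite -{1}sA mxE.
rewrite tr_sqr_sum // sum_sum_two.
have -> : \sum_(q | rest q) (A i q ^+ 2 + A q i ^+ 2 + A j q ^+ 2 + A q j ^+ 2) = 2 * \sum_(q | rest q) A i q ^+ 2 + 2 * \sum_(q | rest q) A j q ^+ 2.
  by rewrite !mulr_sumr -big_split; apply: eq_bigr => q _ /=; rewrite (eA q i) (eA q j); ring.
have := sqr_ge0 (A i i); have := sqr_ge0 (A i j); have := sqr_ge0 (A j i); have := sqr_ge0 (A j j); lra.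
Qed.

Lemma contract_diff S A : curvature_symmetries S -> A^T = A ->
  ric_contract S A j j - ric_contract S A i i =
  \sum_(p | rest p) \sum_(q | rest q) normal_diff S p q * A p q - sec S i j * (A j j - A i i)
  + 2 * (\sum_(q | rest q) tcoef S i j q j * A i q - \sum_(q | rest q) tcoef S j i q i * A j q).
Proof.
move=> symS sA; have eA x y : A x y = A y x by rewrite -{1}sA mxE.
rewrite !mxE !sum_sum_two !(cs_ii symS) !(cs_kk symS) !mul0r.
have ej : \sum_(q | rest q) (tcoef S j i j q * A i q + tcoef S j q j i * A q i + tcoef S j j j q * A j q + tcoef S j q j j * A q j) = 2 * \sum_(q | rest q) tcoef S i j q j * A i q.
  rewrite mulr_sumr; apply: eq_bigr => q _; rewrite (cs_ii symS) (cs_kk symS) (eA q i) (cspair symS j q) (csflip symS j i); ring.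
have ei : \sum_(q | rest q) (tcoef S i i i q * A i q + tcoef S i q i i * A q i + tcoef S i j i q * A j q + tcoef S i q i j * A q j) = 2 * \sum_(q | rest q) tcoef S j i q i * A j q.
  rewrite mulr_sumr; apply: eq_bigr => q _; rewrite (cs_ii symS) (cs_kk symS) (eA q j) (cspair symS i q) (csflip symS i j); ring.
have eB : \sum_(p | rest p) \sum_(q | rest q) normal_diff S p q * A p q =
  \sum_(p | rest p) \sum_(q | rest q) tcoef S j p j q * A p q - \sum_(p | rest p) \sum_(q | rest q) tcoef S i p i q * A p q.
  rewrite -sumrB; apply: eq_bigr => p _; rewrite -sumrB; apply: eq_bigr => q _; rewrite /normal_diff; ring.
rewrite ej ei eB /sec (csflip symS j i j i); ring.
Qed.

Lemma normal_diff_trace S : curvature_symmetries S ->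
  \sum_(p | rest p) normal_diff S p p = Ric S j j - Ric S i i.
Proof.
move=> symS; have ij' : i != j by rewrite eq_sym.
rewrite !mxE !(sum_two _ ij') !(cs_ii symS) (csflip symS j i) sumrB; ring.
Qed.

Lemma sqr_diff A : A^T = A -> (A *m A) j j - (A *m A) i i =
  (A j j - A i i) * (A i i + A j j) + (\sum_(q | rest q) A j q ^+ 2 - \sum_(q | rest q) A i q ^+ 2).
Proof.
move=> sA; have eA x y : A x y = A y x by rewrite -{1}sA mxE.
have ij' : i != j by rewrite eq_sym.
rewrite !sqr_diag_sum // !(sum_two _ ij') (eA j i); ring.
Qed.

End TensorEstimates.

Section PinchEvolution.
Variables (R : realType) (n : nat) (b : R).
Implicit Types (S T U : tensor R n) (A P : 'M[R]_n).
Local Notation N := (n%:R : R).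
Local Notation a := (a_of n b).
Local Notation gam := (gamma_of n b).
Local Notation kap := (kappa_param N b a).
Local Notation om := (omega_of n b).

(* Nonnegativity for all [t] in [0, 1] is equivalent to the pinching condition, but
   this expression is linear in [(S, T)]. *)
Lemma young (l x y : R) : 0 < l -> 2 * (x * y) <= l * x ^+ 2 + l^-1 * y ^+ 2.
Proof.
move=> l0; have : 0 <= l^-1 * (l * x - y) ^+ 2 by rewrite mulr_ge0 ?sqr_ge0 // invr_ge0 ltW.
have -> : l^-1 * (l * x - y) ^+ 2 = l * x ^+ 2 + l^-1 * y ^+ 2 - 2 * (x * y) by field; rewrite gt_eqF.
by rewrite subr_ge0.
Qed.

Definition pinch_form (t : R) S T i j : R :=
  t ^+ 2 * (om * scal S) + (1 - t) ^+ 2 * sigma T i j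
  - 2 * t * (1 - t) * (Ric S j j - Ric S i i - 2 * (N - 2) * b * sigma T i j).

Lemma sharp_nonneg T : curvature_symmetries T -> tensor_nonneg T -> tensor_nonneg (tensor_sharp T).
Proof.
move=> symT T0 phi aphi; rewrite -cformE; apply: cform_sharp_ge0 => //.
by apply/matrixP => i j; rewrite !mxE aphi.
Qed.

Lemma nonneg_sigma T i j : curvature_symmetries T -> tensor_nonneg T -> 0 <= sigma T i j.
Proof. by move=> symT T0; apply: sumr_ge0 => p _; rewrite addr_ge0 // nonneg_sec. Qed.

Hypotheses (n12 : (12 <= n)%N) (b0 : 0 < b) (bmax : b <= b_max R n).

Let hN : 12 <= N := natr_ge12 R n12.
Let hNb : 4 * (N * b) <= 1 := b_max_bound n12 bmax.

Section Evolve.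
Variables S T : tensor R n.
Hypotheses (ctS : curvature_tensor S) (pc : pair_cond b S T) (s0 : 0 < scal S).
Variables i j : 'I_n.
Hypothesis ij : j != i.
Local Notation rest := (fun p => (p != i) && (p != j)).

Lemma sigma_evolT_gt : sigma (tensor_square S) i j < sigma (evolT b S T) i j.
Proof.
have [[symT T0] _ _ _] := pc; have e0 := eps_gt0 n12 b0 bmax ctS.1 s0.
have n2 : (2 <= n)%N by apply: leq_trans n12.
have secE k p : rest p -> k = i \/ k = j -> sec (evolT b S T) k p = sec (tensor_square S) k p + sec (tensor_sharp T) k p + 2 * eps b S.
  move=> /andP[pi pj] kij; have pk : p != k by case: kij => ->.
  rewrite /sec /evolT !(tcoefD, tcoefZ) tcoef_kn !mxE !eqxx (eq_sym k) (negbTE pk) /=; ring.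
have h1 : sigma (evolT b S T) i j = sigma (tensor_square S) i j + sigma (tensor_sharp T) i j + (N - 2) * (4 * eps b S).
  rewrite -(card_rest_two R ij n2) mulr_natl -sumr_const -!big_split; apply: eq_bigr => p rp /=.
  rewrite !secE //; [ring|by right|by left].
rewrite h1 -addrA ltrDl; apply: ltr_pwDr.
  by rewrite !mulr_gt0 //; have := hN; lra.
by apply: nonneg_sigma; [exact: cs_sharp|exact: sharp_nonneg].
Qed.

Lemma scal_evolS_ge (x : R) : x <= \tr (ric0 S *m ric0 S) ->
  (2 * N + 4 * N * (N - 1) * a) * (scal S / N) ^+ 2 + (2 - 4 * b) * x <= scal (evolS b S).
Proof.
have sP := ric0_sym ctS.1; rewrite scal_evolS // => x_le.
have b1 : 0 < 2 - 4 * b by have := param_b_le hN b0 hNb; lra.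
have h1 := ler_wpM2l (ltW b1) x_le.
have h2 : 0 <= 2 * N * (b ^+ 2 + (N - 1) * kap) * \tr (ric0 S *m ric0 S).
  apply: mulr_ge0 (tr_sqr_ge0 sP); apply: mulr_ge0; first by rewrite mulr_ge0.
  apply: addr_ge0; [exact: sqr_ge0|apply: mulr_ge0 (ltW (param_kappa_gt0 hN b0 hNb)); have := hN; lra].
move: (\tr _) (kap) h1 h2 => t k {x_le}; lra.
Qed.

(** With X = sqrt(om scal) and Y = sqrt(sigma) the form is at least (t X - (1 - t) Y)^2, so a zero
    forces t X = (1 - t) Y and equality in the pinching condition. Then lm is the derivative of X Y
    in sigma, and om / (4 lm) that in scal. *)
Lemma pinch_form_eq0 t : 0 < t -> t < 1 -> pinch_form t S T i j = 0 ->
  let lm := (1 - t) / (2 * t) in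
  [/\ 0 < lm, 0 < sigma T i j, 4 * lm ^+ 2 * sigma T i j = om * scal S
    & Ric S j j - Ric S i i = 2 * sigma T i j * (lm + (N - 2) * b)].
Proof.
move=> t0 t1 null lm; have [[symT T0] _ _ _] := pc.
have t1' : 0 < 1 - t by rewrite subr_gt0.
have lm0 : 0 < lm by rewrite divr_gt0 // mulr_gt0.
have om0 : 0 < om.
  apply: lt_le_trans (param_om_ge hN b0 hNb (omega_ge0 n b) (omega_sqr n12 b0 bmax)).
  by rewrite divr_gt0.
have sg0 := nonneg_sigma i j symT T0.
have := pair_cond_pinch pc (_ : i != j); rewrite eq_sym ij => /(_ isT).
set X := Num.sqrt om * Num.sqrt (scal S); set Y := Num.sqrt (sigma T i j).
have X2 : X ^+ 2 = om * scal S by rewrite exprMn !sqr_sqrtr // ltW.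
have Y2 : Y ^+ 2 = sigma T i j by rewrite sqr_sqrtr.
move=> pinch; have X0 : 0 < X by rewrite mulr_gt0 // sqrtr_gt0.
have tX : t * X = (1 - t) * Y.
  apply/eqP; rewrite -subr_eq0 -sqrf_eq0 eq_le sqr_ge0 andbT.
  have : 0 <= 2 * t * (1 - t) * (X * Y - (Ric S j j - Ric S i i - 2 * (N - 2) * b * sigma T i j)).
    by apply: mulr_ge0; [rewrite !mulr_ge0 // ltW|rewrite subr_ge0; lra].
  by move: null; rewrite /pinch_form -X2 -Y2; lra.
have tX2 : t ^+ 2 * (om * scal S) = (1 - t) ^+ 2 * sigma T i j by rewrite -X2 -Y2 -!exprMn tX.
have tn : t != 0 by rewrite gt_eqF.
split=> //.
- rewrite lt_def sg0 andbT; apply: contraTneq (mulr_gt0 (exprn_gt0 2 t0) (mulr_gt0 om0 s0)).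
  by rewrite tX2 => ->; rewrite mulr0 ltxx.
- by rewrite /lm; transitivity ((1 - t) ^+ 2 * sigma T i j / t ^+ 2); [|rewrite -tX2]; field.
- have tt : 2 * t * (1 - t) != 0 by rewrite gt_eqF // !mulr_gt0.
  apply: (mulfI tt); move: null; rewrite /pinch_form tX2 /lm => null.
  transitivity (2 * (1 - t) ^+ 2 * sigma T i j + 2 * t * (1 - t) * (2 * (N - 2) * b * sigma T i j)); first by lra.
  by field.
Qed.

(** The expression is the time derivative of the gap in the pinching condition. Everything
    proportional to Dl is collected in [br]; the trace-free and mixed products are estimated by
    Young's inequality with weight lm, matching the weights of sigma' and scal'. *)
Lemma evol_pinch_gt0 lm : 0 < lm -> 0 < sigma T i j -> 4 * lm ^+ 2 * sigma T i j = om * scal S ->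
  Ric S j j - Ric S i i = 2 * sigma T i j * (lm + (N - 2) * b) ->
  0 < lm * sigma (evolT b S T) i j + om / (4 * lm) * scal (evolS b S)
    - (Ric (evolS b S) j j - Ric (evolS b S) i i - 2 * (N - 2) * b * sigma (evolT b S T) i j).
Proof.
move=> lm0 sg0 lmE DlE; have symS := ctS.1; have sP := ric0_sym symS; have pS := pair_cond_PIC pc.
have N0 : 0 < N by rewrite (lt_le_trans _ hN).
have Nn0 : N != 0 by rewrite gt_eqF.
have N2 : 0 < N - 2 by have := hN; lra.
have N3 : 0 < N - 3 by have := hN; lra.
have n2 : (2 <= n)%N by apply: leq_trans n12.
have n0 : (0 < n)%N by apply: leq_trans n12.
have ij' : i != j by rewrite eq_sym.
set s := scal S / N; have sp : 0 < s by rewrite divr_gt0.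
have Ns : scal S = N * s by rewrite mulrC divfK.
have a0 : 0 < a := param_a_gt0 hN b0 hNb.
have g0 : 0 < gam := param_gamma_gt0 hN b0 hNb.
have omE := omega_sqr n12 b0 bmax.
have om5 := param_om_ge hN b0 hNb (omega_ge0 n b) omE.
set Dl := Ric S j j - Ric S i i in DlE.
have Dl0 : 0 <= Dl by rewrite DlE !mulr_ge0 ?addr_ge0 ?mulr_ge0 // ltW.
(* The upper bound of br / s, obtained from the PIC bound for K and from (iii) for r2. *)
pose C1 := 2 + N / (N - 3) + 4 * a * (N - 2) + (2 / (N - 2) + 4 * b) * (2 * (1 + gam)).
have RicE p q : Ric S p q = ric0 S p q + s * (p == q)%:R by rewrite {1}Ric_decomp !mxE.
have DlE0 : Dl = ric0 S j j - ric0 S i i by rewrite /Dl !RicE !eqxx /=; ring.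
pose r2 := ric0 S i i + ric0 S j j.
have r2_ge : - (2 * ((1 + gam) * s)) <= r2.
  have := pair_cond_ric pc ij'; rewrite !RicE !eqxx Ns /r2 /=.
  have -> : 2 * gam / N * (N * s) = 2 * gam * s by field.
  lra.
pose K := sec S i j.
have K_le : - 2 * K <= s * (N / (N - 3)).
  have n6 : (6 <= n)%N by apply: leq_trans n12.
  by have := PIC_sec_ge symS pS ij n6; rewrite Ns mulrA (mulrC s) ler_pdivlMr.
pose br := 2 * s - 2 * K - 2 / (N - 2) * r2 - 4 * b * r2 + 4 * a * (N - 2) * s.
have br_le : br <= s * C1.
  have : 0 <= (2 / (N - 2) + 4 * b) * (r2 + 2 * ((1 + gam) * s)).
    apply: mulr_ge0; last by move: r2_ge; lra.
    by rewrite addr_ge0 ?divr_ge0 ?mulr_ge0 // ltW.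
  by rewrite /br /C1; move: K_le; lra.
(* The averages of the diagonals of [nd] and [ric0] over the n - 2 remaining indices, so that the
   shifted matrices below are trace-free. *)
pose y := Dl / (N - 2); pose z := - r2 / (N - 2).
have cR := card_rest_two R ij n2.
have trB := normal_diff_trace ij symS; rewrite -/Dl in trB.
have trP : \sum_(p | rest p) ric0 S p p = - r2.
  have := tr_ric0 n0 S; rewrite /mxtrace (sum_two _ ij') /r2; lra.
pose nd := normal_diff i j S; rewrite -/nd in trB.
pose Bs := \sum_(p | rest p) \sum_(q | rest q) (nd p q - y * (p == q)%:R) * (nd p q - y * (p == q)%:R).
pose Ps := \sum_(p | rest p) \sum_(q | rest q) (ric0 S p q - z * (p == q)%:R) * (ric0 S p q - z * (p == q)%:R).
pose BP := \sum_(p | rest p) \sum_(q | rest q) (nd p q - y * (p == q)%:R) * (ric0 S p q - z * (p == q)%:R).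
have N2n : N - 2 != 0 by rewrite gt_eqF.
have BsE : Bs + Dl ^+ 2 / (N - 2) = \sum_(p | rest p) \sum_(q | rest q) nd p q ^+ 2.
  have -> : \sum_(p | rest p) \sum_(q | rest q) nd p q ^+ 2 = \sum_(p | rest p) \sum_(q | rest q) nd p q * nd p q.
    by apply: eq_bigr => p _; apply: eq_bigr => q _; rewrite expr2.
  rewrite /Bs sum_shift_delta trB cR /y; move: (\sum_(p | _) _) => Q; by field.
have PsE : Ps <= \sum_(p | rest p) \sum_(q | rest q) ric0 S p q ^+ 2.
  have -> : \sum_(p | rest p) \sum_(q | rest q) ric0 S p q ^+ 2 = \sum_(p | rest p) \sum_(q | rest q) ric0 S p q * ric0 S p q.
    by apply: eq_bigr => p _; apply: eq_bigr => q _; rewrite expr2.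
  rewrite /Ps sum_shift_delta trP cR /z; move: (\sum_(p | _) _) => Q.
  have -> : Q - - r2 / (N - 2) * - r2 - - r2 / (N - 2) * - r2 + (N - 2) * (- r2 / (N - 2) * (- r2 / (N - 2))) = Q - r2 ^+ 2 / (N - 2) by field.
  by rewrite gerBl divr_ge0 ?sqr_ge0 // ltW.
have BPE : \sum_(p | rest p) \sum_(q | rest q) nd p q * ric0 S p q = BP - Dl * r2 / (N - 2).
  rewrite /BP sum_shift_delta trP trB cR /y /z; move: (\sum_(p | _) _) => Q; by field.
pose xi := \sum_(q | rest q) tcoef S i j q j * ric0 S i q; pose xj := \sum_(q | rest q) tcoef S j i q i * ric0 S j q.
pose Xi := \sum_(q | rest q) tcoef S i j q j ^+ 2; pose Xj := \sum_(q | rest q) tcoef S j i q i ^+ 2.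
pose Yi := \sum_(q | rest q) ric0 S i q ^+ 2; pose Yj := \sum_(q | rest q) ric0 S j q ^+ 2.
have BP_le : 2 * BP <= lm * Bs + lm^-1 * Ps.
  rewrite /BP /Bs /Ps !mulr_sumr -big_split; apply: ler_sum => p _ /=.
  rewrite !mulr_sumr -big_split; apply: ler_sum => q _ /=; rewrite -!expr2; exact: young.
have xi_le : 2 * xi <= lm * Xi + lm^-1 * Yi.
  by rewrite /xi /Xi /Yi !mulr_sumr -big_split; apply: ler_sum => q _; exact: young.
have xj_le : - 2 * xj <= lm * Xj + lm^-1 * Yj.
  rewrite /xj /Xj /Yj !mulr_sumr -big_split; apply: ler_sum => q _ /=.
  by have := young (tcoef S j i q i) (- ric0 S j q) lm0; rewrite sqrrN !mulrN -mulNr.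
have Xi_le : 2 * Xi <= mixed_norm i j S i.
  rewrite /mixed_norm ler_pM2l //; apply: ler_sum => q _.
  by rewrite (bigD1 j) //= lerDl; apply: sumr_ge0 => p _; exact: sqr_ge0.
have Xj_le : 2 * Xj <= mixed_norm i j S j.
  rewrite /mixed_norm ler_pM2l //; apply: ler_sum => q _.
  by rewrite (bigD1 i) //= lerDl; apply: sumr_ge0 => p _; exact: sqr_ge0.
have Yi_le : 2 * Yi <= (N - 2) * mixed_norm i j S i by apply: sqr_offdiag_ric0_le => //; left.
have norm0 (F : 'I_n -> 'I_n -> R) : 0 <= \sum_(p | rest p) \sum_(q | rest q) F p q * F p q.
  by apply: sumr_ge0 => p _; apply: sumr_ge0 => q _; rewrite -expr2; exact: sqr_ge0.
have Yi0 : 0 <= Yi by apply: sumr_ge0 => q _; exact: sqr_ge0.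
have Yj0 : 0 <= Yj by apply: sumr_ge0 => q _; exact: sqr_ge0.
have Ej0 : 0 <= mixed_norm i j S j.
  by rewrite mulr_ge0 //; apply: sumr_ge0 => q _; apply: sumr_ge0 => p _; exact: sqr_ge0.
have sg'_gt : Bs + Dl ^+ 2 / (N - 2) + mixed_norm i j S i + mixed_norm i j S j < sigma (evolT b S T) i j.
  by rewrite BsE; exact: le_lt_trans (sigma_square_ge ij symS) sigma_evolT_gt.
have sc'_ge : (2 * N + 4 * N * (N - 1) * a) * s ^+ 2 + (2 - 4 * b) * (Ps + 2 * Yi + 2 * Yj) <= scal (evolS b S).
  apply: scal_evolS_ge; apply: le_trans (tr_sqr_ge ij sP).
  by rewrite -/Yi -/Yj !lerD2r.
have Dl'E : Ric (evolS b S) j j - Ric (evolS b S) i i = 2 * BP + Dl * br + 4 * (xi - xj) - 4 * b * (Yj - Yi).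
  rewrite !Ric_evolS // -/s !eqxx.
  have := contract_diff ij symS (Ric_sym symS); rewrite -/Dl -/K.
  have -> : \sum_(p | rest p) \sum_(q | rest q) normal_diff i j S p q * Ric S p q = BP - Dl * r2 / (N - 2) + s * Dl.
    rewrite -BPE -trB mulr_sumr -big_split; apply: eq_bigr => p rp /=.
    rewrite -(@sum_cond_delta _ _ rest (fun q => s * nd p q) p rp) -big_split; apply: eq_bigr => q _ /=.
    rewrite RicE /nd; ring.
  have -> : \sum_(q | rest q) tcoef S i j q j * Ric S i q = xi.
    by apply: eq_bigr => q /andP[qi _]; rewrite RicE (eq_sym i) (negbTE qi) /= mulr0 addr0.
  have -> : \sum_(q | rest q) tcoef S j i q i * Ric S j q = xj.
    by apply: eq_bigr => q /andP[_ qj]; rewrite RicE (eq_sym j) (negbTE qj) /= mulr0 addr0.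
  have := sqr_diff ij sP; rewrite -DlE0 -/r2 -/Yi -/Yj.
  move: DlE0; rewrite /br.
  move: (ric_contract _ _ j j) (ric_contract _ _ i i) ((_ *m _) j j) ((_ *m _) i i) (ric0 S j j) (ric0 S i i) => cj ci qj qi rj ri eD eq ec.
  have -> : cj = ci + (BP - Dl * r2 / (N - 2) + s * Dl - K * Dl + 2 * (xi - xj)) by rewrite -ec; ring.
  have -> : qj = qi + (Dl * r2 + (Yj - Yi)) by rewrite -eq; ring.
  have -> : rj = ri + Dl by rewrite eD; ring.
  by field.
have b48 : b <= 48^-1 by rewrite -[48^-1]mul1r ler_pdivlMr // mulrC (param_b_le hN b0 hNb).
have lmE' : 4 * lm ^+ 2 * sigma T i j = om * N * s by rewrite lmE Ns mulrA.
have trace_le := pinched_trace_le hN b0 hNb (omega_ge0 n b) omE sp lm0 sg0 lmE'.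
rewrite -DlE in trace_le.
have Bs0 : 0 <= Bs := norm0 _; have Ps0 : 0 <= Ps := norm0 _.
exact: (pinched_combination hN b0 (omega_ge0 n b) lm0 b48 om5 trace_le Dl0 br_le Dl'E Bs0 Ps0 Yi0 Yj0 Ej0 BP_le xi_le xj_le Xi_le Xj_le Yi_le sg'_gt sc'_ge).
Qed.

Lemma evol_pinch t : 0 <= t -> t <= 1 -> pinch_form t S T i j = 0 ->
  0 < pinch_form t (evolS b S) (evolT b S T) i j.
Proof.
(* At t = 0 the evolved form is sigma(T'), which is positive outright; at t = 1 the original form is
   om * scal S and cannot vanish. *)
rewrite le_eqVlt => /orP[/eqP <- _ _|t0].
  have sq0 : 0 <= sigma (tensor_square S) i j.
    by apply: sumr_ge0 => p _; rewrite addr_ge0 // sec_square; apply: sumr_ge0 => q _; apply: sumr_ge0 => r _; exact: sqr_ge0.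
  by rewrite /pinch_form; have := sigma_evolT_gt; lra.
have om0 : 0 < om.
  apply: lt_le_trans (param_om_ge hN b0 hNb (omega_ge0 n b) (omega_sqr n12 b0 bmax)).
  by rewrite divr_gt0.
rewrite le_eqVlt => /orP[/eqP ->|t1].
  by rewrite /pinch_form => null; exfalso; have := mulr_gt0 om0 s0; lra.
move=> null; have [lm0 sg0 lmE DlE] := pinch_form_eq0 t0 t1 null.
have := evol_pinch_gt0 lm0 sg0 lmE DlE.
have t1' : 0 < 1 - t by rewrite subr_gt0.
have tt : 0 < 2 * t * (1 - t) by rewrite !mulr_gt0.
(* For lm = (1 - t) / (2 t) the form is 2 t (1 - t) times the expression of [evol_pinch_gt0]. *)
rewrite -(pmulr_rgt0 _ tt); congr (0 < _); rewrite /pinch_form; field.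
by rewrite !gt_eqF.
Qed.

End Evolve.
End PinchEvolution.

(** * Transversality *)

Section Compactness.
Local Open Scope classical_set_scope.
Local Open Scope ring_scope.
Variables (R : realType) (n : nat).
Implicit Types (S T U : tensor R n) (A P : 'M[R]_n).

Lemma continuous_vec_mx : continuous (@vec_mx R n n).
Proof.
apply: continuous_mx => i j; rewrite (_ : (fun x => _) = (fun x : 'rV[R]_(n * n) => x 0 (mxvec_index i j))).
  exact: coord_continuous.
by apply/funext => x; rewrite mxE.
Qed.

Lemma compact_mx_unit_box (K : set 'M[R]_n) : closed K ->
  (forall A, K A -> forall i j, A i j ^+ 2 <= 1) -> compact K.
Proof.
move=> cK bK; rewrite (_ : K = vec_mx @` (vec_mx @^-1` K)); last first.
  apply/seteqP; split=> [A KA|A [v /= Kv <-]] //.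
  by exists (mxvec A); rewrite /= mxvecK.
apply: continuous_compact; first by apply: continuous_subspaceT; exact: continuous_vec_mx.
apply: compact_unit_box.
  by apply: preimage_closed => // x _; exact: continuous_vec_mx.
move=> v /= Kv k; case/mxvec_indexP: k => i j.
have := bK _ Kv i j; rewrite mxE => h; rewrite -ler_norml.
by rewrite -(@ler_pXn2r _ 2) ?nnegrE // expr1n real_normK ?num_real.
Qed.

Definition orthogonal_group : set 'M[R]_n := [set P | P *m P^T = 1%:M].

Lemma compact_orthogonal_group : compact orthogonal_group.
Proof.
apply: compact_mx_unit_box.
  rewrite (_ : orthogonal_group = [set P : 'M[R]_n | forall x : 'I_n * 'I_n, \sum_k P x.1 k * P x.2 k = (x.1 == x.2)%:R]).
    apply: closed_eqs => x; apply: continuous_sumr => k.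
    by apply: continuousMr; exact: coord_continuous.
  have e P (i j : 'I_n) : (P *m P^T) i j = \sum_k P i k * P j k.
    by rewrite mxE; apply: eq_bigr => k _; rewrite mxE.
  apply/seteqP; split=> P /= h.
    by move=> [i j] /=; rewrite -e h mxE.
  by apply/matrixP => i j; rewrite e (h (i, j)) mxE.
move=> P PP i j; have := orthogonal_rows i i PP; rewrite eqxx /dot => h.
rewrite -[leRHS]h (bigD1 j) //= !mxE -expr2 lerDl.
by apply: sumr_ge0 => k _; rewrite !mxE -expr2; exact: sqr_ge0.
Qed.

Definition unit_two_forms : set 'M[R]_n := [set A | A^T = - A /\ \sum_i \sum_j A i j ^+ 2 = 1].

Lemma compact_unit_two_forms : compact unit_two_forms.
Proof.
apply: compact_mx_unit_box.
  rewrite (_ : unit_two_forms = [set A : 'M[R]_n | forall o : option ('I_n * 'I_n),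
     (if o is Some x then A x.1 x.2 + A x.2 x.1 else \sum_i \sum_j A i j * A i j) = (if o is Some _ then 0 else 1)]).
    apply: closed_eqs => -[x|].
      by apply: continuousDr; exact: coord_continuous.
    apply: continuous_sumr => i; apply: continuous_sumr => j.
    by apply: continuousMr; exact: coord_continuous.
  have e A : \sum_i \sum_j A i j * A i j = \sum_i \sum_j A i j ^+ 2.
    by apply: eq_bigr => i _; apply: eq_bigr => j _; rewrite expr2.
  apply/seteqP; split=> A /=.
    move=> [aA nA] [[i j]|] /=; last by rewrite e.
    by have := congr1 (fun M : 'M[R]_n => M i j) aA; rewrite !mxE => ->; rewrite subrr.
  move=> h; split; last by rewrite -e (h None).
  apply/matrixP => i j; rewrite !mxE; apply/eqP; rewrite -subr_eq0 opprK addrC.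
  by rewrite (h (Some (i, j))).
move=> A [_ nA] i j; rewrite -nA (bigD1 i) //= (bigD1 j) //= -addrA lerDl addr_ge0 //.
  by apply: sumr_ge0 => k _; exact: sqr_ge0.
by apply: sumr_ge0 => k _; apply: sumr_ge0 => l _; exact: sqr_ge0.
Qed.

Lemma nonneg_unit_two_forms T : curvature_symmetries T ->
  (forall A, unit_two_forms A -> 0 <= rform T A A) -> tensor_nonneg T.
Proof.
move=> symT h; apply/(tensor_nonnegP symT) => A.
have C := rformC symT.
have aA : (A - A^T)^T = - (A - A^T) by rewrite linearB /= trmxK opprB.
suff : 0 <= rform T (A - A^T) (A - A^T) by rewrite rform_antisym //; lra.
move: (A - A^T) aA => B aB.
pose q := \sum_i \sum_j B i j ^+ 2.
have q0 : 0 <= q by apply: sumr_ge0 => k _; apply: sumr_ge0 => l _; exact: sqr_ge0.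
have [qz|qn] := eqVneq q 0.
  have -> : B = 0.
    apply/matrixP => i j; rewrite [RHS]mxE; apply/eqP; rewrite -sqrf_eq0 eq_le sqr_ge0 andbT -qz.
    rewrite /q (bigD1 i) //= (bigD1 j) //= -addrA lerDl addr_ge0 //.
      by apply: sumr_ge0 => k _; exact: sqr_ge0.
    by apply: sumr_ge0 => k _; apply: sumr_ge0 => l _; exact: sqr_ge0.
  by have := rformZl T 0 0 0; rewrite scale0r mul0r => ->.
pose r := Num.sqrt q; have rr : r ^+ 2 = q by rewrite sqr_sqrtr.
have rn : r != 0 by rewrite sqrtr_eq0 -ltNge lt_def qn.
have := h (r^-1 *: B); rewrite rformZl C rformZl => {}h.
suff U : unit_two_forms (r^-1 *: B).
  have := mulr_ge0 q0 (h U); rewrite -rr; congr (0 <= _); by field.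
split; first by rewrite linearZ /= aB scalerN.
transitivity (\sum_i \sum_j (r^-1) ^+ 2 * B i j ^+ 2).
  by apply: eq_bigr => i _; apply: eq_bigr => j _; rewrite mxE exprMn.
under eq_bigr => i _ do rewrite -mulr_sumr.
by rewrite -mulr_sumr -/q -rr -exprMn mulVf // expr1n.
Qed.

Section RotContinuity.
Variables (X : topologicalType) (F : X -> 'M[R]_n) (V : X -> tensor R n).
Hypotheses (cF : continuous F) (cV : continuous V).

Lemma continuous_tcoef_rot i j k l : continuous (fun x => tcoef (rotT (F x) (V x)) i j k l).
Proof.
under eq_fun => x do rewrite tcoef_rot.
do 4![apply: continuous_sumr => ?]; do 4![apply: continuousMr; last exact: continuous_entry].
exact: continuous_entry.
Qed.

Lemma continuous_sec_rot i j : continuous (fun x => sec (rotT (F x) (V x)) i j).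
Proof. exact: continuous_tcoef_rot. Qed.

Lemma continuous_Ric_rot i j : continuous (fun x => Ric (rotT (F x) (V x)) i j).
Proof.
under eq_fun => x do rewrite mxE.
by apply: continuous_sumr => p; exact: continuous_tcoef_rot.
Qed.

Lemma continuous_scal_rot : continuous (fun x => scal (rotT (F x) (V x))).
Proof. by apply: continuous_sumr => p; exact: continuous_Ric_rot. Qed.

Lemma continuous_sigma_rot i j : continuous (fun x => sigma (rotT (F x) (V x)) i j).
Proof. by apply: continuous_sumr => p; apply: continuousDr; exact: continuous_sec_rot. Qed.

Lemma continuous_pic_rot i j k l : continuous (fun x => pic_coef (rotT (F x) (V x)) i j k l).
Proof.
do 5?[apply: continuousDr]; try exact: continuous_tcoef_rot.
  by apply: continuousMr; [move=> x; exact: cvg_cst|exact: continuous_tcoef_rot].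
by apply: continuousMr; [move=> x; exact: cvg_cst|exact: continuous_tcoef_rot].
Qed.

End RotContinuity.

End Compactness.

Section Pinching.
Variable R : rcfType.

(** The endpoints t = 1 and t = 0 give the signs of X and Y, and the best t in between recovers the
    square roots. *)
Lemma pinch_param (X Y Z : R) :
  (forall t, 0 <= t -> t <= 1 -> 0 <= t ^+ 2 * X + (1 - t) ^+ 2 * Y - 2 * t * (1 - t) * Z) ->
  [/\ 0 <= X, 0 <= Y & Z <= Num.sqrt X * Num.sqrt Y].
Proof.
move=> h; have X0 : 0 <= X by have := h 1 ler01 (lexx 1); lra.
have Y0 : 0 <= Y by have := h 0 (lexx 0) ler01; lra.
split=> //.
have [Xz|Xn] := eqVneq X 0.
  rewrite Xz sqrtr0 mul0r leNgt; apply/negP => Z0.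
  have d0 : 0 < Y + 2 * Z by rewrite ltr_wpDl // mulr_gt0.
  (* For X = 0 the form is (1 - t)^2 (Y + 2Z) - 2 (1 - t) Z, which is minimal at this t; the case Y
     = 0 is analogous. *)
  have t0 : 0 <= (Y + Z) / (Y + 2 * Z) by apply: divr_ge0 (ltW d0); lra.
  have t1 : (Y + Z) / (Y + 2 * Z) <= 1 by rewrite ler_pdivrMr //; lra.
  have := h _ t0 t1; rewrite Xz.
  have -> : ((Y + Z) / (Y + 2 * Z)) ^+ 2 * 0 + (1 - (Y + Z) / (Y + 2 * Z)) ^+ 2 * Y - 2 * ((Y + Z) / (Y + 2 * Z)) * (1 - (Y + Z) / (Y + 2 * Z)) * Z
    = - ((Z / (Y + 2 * Z)) ^+ 2 * (Y + 2 * Z)) by field; rewrite gt_eqF.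
  by rewrite oppr_ge0 leNgt mulr_gt0 // exprn_gt0 // divr_gt0.
have [Yz|Yn] := eqVneq Y 0.
  rewrite Yz sqrtr0 mulr0 leNgt; apply/negP => Z0.
  have d0 : 0 < X + 2 * Z by rewrite ltr_wpDl // mulr_gt0.
  have t0 : 0 <= Z / (X + 2 * Z) by apply: divr_ge0 (ltW d0); lra.
  have t1 : Z / (X + 2 * Z) <= 1 by rewrite ler_pdivrMr //; lra.
  have := h _ t0 t1; rewrite Yz.
  have -> : (Z / (X + 2 * Z)) ^+ 2 * X + (1 - Z / (X + 2 * Z)) ^+ 2 * 0 - 2 * (Z / (X + 2 * Z)) * (1 - Z / (X + 2 * Z)) * Z
    = - ((Z / (X + 2 * Z)) ^+ 2 * (X + 2 * Z)) by field; rewrite gt_eqF.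
  by rewrite oppr_ge0 leNgt mulr_gt0 // exprn_gt0 // divr_gt0.
have x0 : 0 < Num.sqrt X by rewrite sqrtr_gt0 lt_def Xn.
have y0 : 0 < Num.sqrt Y by rewrite sqrtr_gt0 lt_def Yn.
have XE : X = Num.sqrt X ^+ 2 by rewrite sqr_sqrtr.
have YE : Y = Num.sqrt Y ^+ 2 by rewrite sqr_sqrtr.
move: (Num.sqrt X) (Num.sqrt Y) XE YE x0 y0 h => x y -> -> x0 y0 h.
have d0 : 0 < x + y by rewrite addr_gt0.
(* This t satisfies t x = (1 - t) y, the equality case of the arithmetic-geometric mean
   inequality. *)
have t0 : 0 <= y / (x + y) by apply: divr_ge0 (ltW y0) (ltW d0).
have t1 : y / (x + y) <= 1 by rewrite ler_pdivrMr //; lra.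
have := h _ t0 t1.
have -> : (y / (x + y)) ^+ 2 * x ^+ 2 + (1 - y / (x + y)) ^+ 2 * y ^+ 2 - 2 * (y / (x + y)) * (1 - y / (x + y)) * Z
  = 2 * x * y / (x + y) ^+ 2 * (x * y - Z) by field; rewrite gt_eqF.
by rewrite pmulr_rge0 ?subr_ge0 // divr_gt0 ?exprn_gt0 // !mulr_gt0.
Qed.

End Pinching.

Section LinearFunctionals.
Variables (R : realType) (n : nat) (b : R).
Implicit Types (S T U V : tensor R n) (A P : 'M[R]_n).
Local Notation N := (n%:R : R).
Local Notation gam := (gamma_of n b).

Lemma sigmaD (t : R) T U i j : sigma (T + t *: U) i j = sigma T i j + t * sigma U i j.
Proof.
rewrite /sigma mulr_sumr -big_split; apply: eq_bigr => p _ /=.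
by rewrite /sec !(tcoefD, tcoefZ); ring.
Qed.

Lemma RicD (t : R) S V i j : Ric (S + t *: V) i j = Ric S i j + t * Ric V i j.
Proof. by rewrite linearD linearZ /=; move: (Ric S) (Ric V) => A B; rewrite !mxE. Qed.

Lemma scalD (t : R) S V : scal (S + t *: V) = scal S + t * scal V.
Proof. by rewrite linearD linearZ. Qed.

Lemma pinch_formD (r t : R) S T V U i j :
  pinch_form b r (S + t *: V) (T + t *: U) i j = pinch_form b r S T i j + t * pinch_form b r V U i j.
Proof. by rewrite /pinch_form scalD !RicD sigmaD; ring. Qed.

Definition two_ric S i j : R := Ric S i i + Ric S j j + 2 * gam / N * scal S.

Lemma two_ricD (t : R) S V i j : two_ric (S + t *: V) i j = two_ric S i j + t * two_ric V i j.
Proof. by rewrite /two_ric scalD !RicD; ring. Qed.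

Section Frames.
Hypothesis n4 : (4 <= n)%N.

Definition idx0 : 'I_n := Ordinal (leq_trans (isT : (1 <= 4)%N) n4).
Definition idx1 : 'I_n := Ordinal (leq_trans (isT : (2 <= 4)%N) n4).
Definition idx2 : 'I_n := Ordinal (leq_trans (isT : (3 <= 4)%N) n4).
Definition idx3 : 'I_n := Ordinal n4.

Lemma PIC_frames U : (forall P, P *m P^T = 1%:M -> 0 <= pic_coef (rotT P U) idx0 idx1 idx2 idx3) -> PIC U.
Proof.
move=> h e1 e2 e3 e4 o; have [P PP rows] := orthonormal_basis o n4.
have := h P PP; rewrite /pic_coef !tcoef_rot_teval.
by rewrite (rows idx0) // (rows idx1) // (rows idx2) // (rows idx3).
Qed.

Lemma rot_coefE P A i j : (P *m A *m P^T) i j = beval A (row i P) (row j P).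
Proof. by rewrite -beval_delta beval_conj -!rowE. Qed.

Lemma two_ric_frames S : (forall P, P *m P^T = 1%:M -> 0 <= two_ric (rotT P S) idx0 idx1) ->
  forall e1 e2 : 'rV[R]_n, orthonormal [:: e1; e2] ->
          0 <= beval (Ric S) e1 e1 + beval (Ric S) e2 e2 + 2 * gam / N * scal S.
Proof.
move=> h e1 e2 o; have [P PP rows] := orthonormal_basis o (leq_trans (isT : (2 <= 4)%N) n4).
have := h P PP; rewrite /two_ric Ric_rot // scal_rot // !rot_coefE.
by rewrite (rows idx0) // (rows idx1).
Qed.

Lemma pinch_frames S T :
  (forall P, P *m P^T = 1%:M -> forall t, 0 <= t -> t <= 1 -> 0 <= pinch_form b t (rotT P S) (rotT P T) idx0 idx1) ->
  0 <= omega_of n b ->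
  forall (e1 e2 : 'rV[R]_n) (f : seq 'rV[R]_n),
          size [:: e1, e2 & f] = n -> orthonormal [:: e1, e2 & f] ->
          let sigma := \sum_(p <- f) (teval T e1 p e1 p + teval T e2 p e2 p) in
          beval (Ric S) e2 e2 - beval (Ric S) e1 e1
            <= Num.sqrt (omega_of n b) * Num.sqrt (scal S) * Num.sqrt sigma
             + 2 * (N - 2) * b * sigma.
Proof.
move=> h om0 e1 e2 f sf o; have [P PP rows] := orthonormal_basis o (eq_leq sf).
have r0 : row idx0 P = e1 by rewrite rows //= sf (leq_trans _ n4).
have r1 : row idx1 P = e2 by rewrite rows //= sf (leq_trans _ n4).
have sE : sigma (rotT P T) idx0 idx1 = \sum_(p <- f) (teval T e1 p e1 p + teval T e2 p e2 p).
  pose G v := teval T e1 v e1 v + teval T e2 v e2 v.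
  have tot : \sum_(p < n) G (row p P) = \sum_(v <- [:: e1, e2 & f]) G v.
    rewrite (big_nth 0) sf big_mkord; apply: eq_bigr => p _; rewrite rows //.
    by rewrite sf.
  transitivity (\sum_(p < n | (p != idx0) && (p != idx1)) G (row p P)); last first.
    by move: tot; rewrite !big_cons (sum_two _ (_ : idx0 != idx1)) // r0 r1 /G; lra.
  by apply: eq_bigr => p _; rewrite /sec !tcoef_rot_teval r0 r1.
cbv zeta; have := h P PP; rewrite /pinch_form Ric_rot // scal_rot // !rot_coefE r0 r1 sE => /pinch_param [_ _].
by rewrite sqrtrM // lerBlDr.
Qed.

Lemma pair_cond_frames S T : curvature_symmetries T -> 0 <= omega_of n b ->
  (forall A, unit_two_forms A -> 0 <= rform T A A) ->
  (forall P, P *m P^T = 1%:M -> 0 <= pic_coef (rotT P (S - T)) idx0 idx1 idx2 idx3) ->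
  (forall P, P *m P^T = 1%:M -> 0 <= two_ric (rotT P S) idx0 idx1) ->
  (forall P, P *m P^T = 1%:M -> forall t, 0 <= t -> t <= 1 -> 0 <= pinch_form b t (rotT P S) (rotT P T) idx0 idx1) ->
  pair_cond b S T.
Proof.
move=> symT om0 h1 h2 h3 h4; split.
- by split=> //; exact: nonneg_unit_two_forms.
- exact: PIC_frames.
- exact: two_ric_frames.
- exact: pinch_frames.
Qed.

End Frames.

Lemma pinch_form_ge0 S T t i j : pair_cond b S T -> 0 <= omega_of n b -> 0 <= scal S -> i != j ->
  0 <= t -> t <= 1 -> 0 <= pinch_form b t S T i j.
Proof.
move=> pc om0 s0 ij t0 t1; have [[symT T0] _ _ _] := pc.
have sg0 := nonneg_sigma i j symT T0.
have := pair_cond_pinch pc ij; rewrite /pinch_form.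
set X := Num.sqrt (omega_of n b) * Num.sqrt (scal S); set Y := Num.sqrt (sigma T i j).
have -> : omega_of n b * scal S = X ^+ 2 by rewrite exprMn !sqr_sqrtr.
have YE : sigma T i j = Y ^+ 2 by rewrite sqr_sqrtr.
move=> pinch; have : 0 <= 2 * t * (1 - t) * (X * Y - (Ric S j j - Ric S i i - 2 * (N - 2) * b * sigma T i j)).
  by apply: mulr_ge0; [rewrite mulr_ge0 ?mulr_ge0 // subr_ge0|rewrite subr_ge0; lra].
have := sqr_ge0 (t * X - (1 - t) * Y); rewrite {2}YE; lra.
Qed.

End LinearFunctionals.

Section Interior.
Local Open Scope classical_set_scope.
Local Open Scope ring_scope.
Variables (R : realType) (n : nat) (b : R).
Implicit Types (S T U V : tensor R n) (A P : 'M[R]_n).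
Hypotheses (n12 : (12 <= n)%N) (b0 : 0 < b) (bmax : b <= b_max R n).
Let n4 : (4 <= n)%N. Proof. by apply: leq_trans n12. Qed.
Local Notation i0 := (idx0 n4).
Local Notation i1 := (idx1 n4).
Local Notation i2 := (idx2 n4).
Local Notation i3 := (idx3 n4).

Lemma near_pos (W : topologicalType) (w0 : W) (Q : R * W -> Prop) :
  (\forall tw \near ((0 : R), w0), Q tw) ->
  \forall w \near w0, exists2 t, 0 < t & Q (t, w).
Proof.
move=> [[A B] [/= /nbhs_ballP[e /= e0 eA] wB] AB].
apply: filterS wB => w Bw; exists (e / 2); first by rewrite divr_gt0.
apply: AB; split=> //=; apply: eA.
by rewrite /ball /= sub0r normrN gtr0_norm ?divr_gt0 // ltr_pdivrMr // ltr_pMr // ltr1n.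
Qed.

Section Pair.
Variables S T : tensor R n.
Hypotheses (ctS : curvature_tensor S) (pc : pair_cond b S T) (s0 : 0 < scal S).

Lemma near_nonneg : \forall tw \near ((0 : R), evolS b S), forall A, unit_two_forms A -> 0 <= tw.1 ->
  0 <= rform T A A + tw.1 * rform (evolT b S T) A A.
Proof.
have [[symT T0] _ _ _] := pc.
have cr U : continuous (fun A => rform U A A).
  do 4![apply: continuous_sumr => ?]; do 2![apply: continuousMr; last exact: coord_continuous].
  exact: cst_continuous.
have := @compact_first_order R 'M[R]_n (tensor R n) (@unit_two_forms R n) (fun A => rform T A A)
  (fun z => rform (evolT b S T) z.1 z.1) (evolS b S) (@compact_unit_two_forms R n).
apply=> //.
- by move=> z; apply: (@continuous_comp _ _ _ fst (fun A => rform (evolT b S T) A A)); [exact: cvg_fst|exact: cr].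
- by move=> A _; exact: (proj1 (tensor_nonnegP symT) T0).
- move=> A [aA nA] _ /=; apply: evolT_nonneg => //; apply/eqP => A0.
  move: nA; rewrite A0 big1; first by move/eqP; rewrite eq_sym oner_eq0.
  by move=> i _; rewrite big1 // => j _; rewrite mxE expr0n.
Qed.

Lemma near_pic : \forall tw \near ((0 : R), evolS b S), forall P, orthogonal_group P -> 0 <= tw.1 ->
  0 <= pic_coef (rotT P (S - T)) i0 i1 i2 i3 + tw.1 * pic_coef (rotT P (tw.2 - evolT b S T)) i0 i1 i2 i3.
Proof.
have := @compact_first_order R 'M[R]_n (tensor R n) (@orthogonal_group R n)
  (fun P => pic_coef (rotT P (S - T)) i0 i1 i2 i3)
  (fun z => pic_coef (rotT z.1 (z.2 - evolT b S T)) i0 i1 i2 i3) (evolS b S) (@compact_orthogonal_group R n).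
apply.
- by apply: continuous_pic_rot => x; [exact: cvg_id|exact: cst_continuous].
- apply: continuous_pic_rot => x; first exact: cvg_fst.
  by apply: cvgB; [exact: cvg_snd|exact: cst_continuous].
- move=> P PP; rewrite rotB; have [_ pU _ _] := pair_cond_rot PP pc; exact: pic_coef_ge0.
- move=> P PP /=; rewrite !rotB -evolS_rot // -evolT_rot //.
  apply: evol_pic => //; [exact: ct_rot|exact: pair_cond_rot|by rewrite scal_rot].
Qed.

Lemma near_ric : \forall tw \near ((0 : R), evolS b S), forall P, orthogonal_group P -> 0 <= tw.1 ->
  0 <= two_ric b (rotT P S) i0 i1 + tw.1 * two_ric b (rotT P tw.2) i0 i1.
Proof.
have ct (X : topologicalType) (F : X -> 'M[R]_n) (V : X -> tensor R n) : continuous F -> continuous V ->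
   continuous (fun x => two_ric b (rotT (F x) (V x)) i0 i1).
  move=> cF cV; apply: continuousDr; first by apply: continuousDr; exact: continuous_Ric_rot.
  by apply: continuousMr; [exact: cst_continuous|exact: continuous_scal_rot].
have := @compact_first_order R 'M[R]_n (tensor R n) (@orthogonal_group R n)
  (fun P => two_ric b (rotT P S) i0 i1)
  (fun z => two_ric b (rotT z.1 z.2) i0 i1) (evolS b S) (@compact_orthogonal_group R n).
apply.
- by apply: ct => x; [exact: cvg_id|exact: cst_continuous].
- by apply: ct => x; [exact: cvg_fst|exact: cvg_snd].
- by move=> P PP; apply: (pair_cond_ric (pair_cond_rot PP pc)).
- move=> P PP /=; rewrite -evolS_rot // => null.
  apply: (evol_ric n12 b0 bmax (ct_rot P ctS) (pair_cond_rot PP pc)) null => //.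
  by rewrite scal_rot.
Qed.

Lemma near_pinch : \forall tw \near ((0 : R), evolS b S), forall z : 'M[R]_n * R,
  (@orthogonal_group R n `*` `[(0 : R), 1]%classic) z -> 0 <= tw.1 ->
  0 <= pinch_form b z.2 (rotT z.1 S) (rotT z.1 T) i0 i1
     + tw.1 * pinch_form b z.2 (rotT z.1 tw.2) (rotT z.1 (evolT b S T)) i0 i1.
Proof.
have ct (X : topologicalType) (F : X -> 'M[R]_n) (r : X -> R) (V U : X -> tensor R n) : continuous F -> continuous r ->
   continuous V -> continuous U ->
   continuous (fun x => pinch_form b (r x) (rotT (F x) (V x)) (rotT (F x) (U x)) i0 i1).
  move=> cF cr cV cU.
  have cc (c : R) : continuous (fun _ : X => c) by exact: cst_continuous.
  have c1 : continuous (fun x => 1 - r x) by apply: continuousDr => //; exact: continuousNr.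
  have cs : continuous (fun x => sigma (rotT (F x) (U x)) i0 i1) by exact: continuous_sigma_rot.
  have c2 (f : X -> R) : continuous f -> continuous (fun x => f x ^+ 2).
    by move=> cf; under eq_fun do rewrite expr2; exact: continuousMr.
  apply: continuousDr.
    apply: continuousDr; first by apply: continuousMr; [exact: c2|apply: continuousMr => //; exact: continuous_scal_rot].
    by apply: continuousMr => //; exact: c2.
  apply: continuousNr; apply: continuousMr; first by apply: continuousMr => //; exact: continuousMr.
  apply: continuousDr; last by apply: continuousNr; exact: continuousMr.
  by apply: continuousDr; [|apply: continuousNr]; exact: continuous_Ric_rot.
have cK : compact (@orthogonal_group R n `*` `[(0 : R), 1]%classic).
  by apply: compact_setX; [exact: compact_orthogonal_group|exact: segment_compact].
have := @compact_first_order R ('M[R]_n * R)%type (tensor R n) (@orthogonal_group R n `*` `[(0 : R), 1]%classic)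
  (fun z => pinch_form b z.2 (rotT z.1 S) (rotT z.1 T) i0 i1)
  (fun y => pinch_form b y.1.2 (rotT y.1.1 y.2) (rotT y.1.1 (evolT b S T)) i0 i1) (evolS b S) cK.
apply.
- by apply: ct => x; [exact: cvg_fst|exact: cvg_snd|exact: cst_continuous|exact: cst_continuous].
- apply: ct => x; last exact: cst_continuous.
  + by apply: (@continuous_comp _ _ _ fst fst); [exact: cvg_fst|exact: cvg_fst].
  + by apply: (@continuous_comp _ _ _ fst snd); [exact: cvg_fst|exact: cvg_snd].
  + exact: cvg_snd.
- move=> [P t] /= [PP]; rewrite in_itv /= => /andP[t0 t1].
  by apply: pinch_form_ge0 => //; [exact: pair_cond_rot|exact: omega_ge0|rewrite scal_rot // ltW].
- move=> [P t] /= [PP]; rewrite in_itv /= => /andP[t0 t1] null.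
  rewrite -evolS_rot // -evolT_rot //.
  apply: evol_pinch null => //; [exact: ct_rot|exact: pair_cond_rot|by rewrite scal_rot].
Qed.

(** T moves in the fixed direction [evolT] while the direction of S varies. All functionals are
    affine in the step, so the four first-order estimates, intersected, give a common step. *)
Lemma evol_interior : \forall V \near evolS b S,
  exists2 t, 0 < t & pair_cond b (S + t *: V) (T + t *: evolT b S T).
Proof.
have [[symT T0] _ _ _] := pc.
have nI := @filterI _ (nbhs ((0 : R), evolS b S)) (nbhs_filter _).
have near_all := nI _ _ near_nonneg (nI _ _ near_pic (nI _ _ near_ric near_pinch)).
have := near_pos near_all; apply: filterS => V [t t0 [h1 [h2 [h3 h4]]]]; exists t => //.
have symT' : curvature_symmetries (evolT b S T).
  apply: csD; first by apply: csD; [exact: cs_square ctS.1|exact: cs_sharp].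
  by apply: csZ; apply: cs_kn; rewrite trmx1.
apply: (pair_cond_frames (n4 := n4)); first by apply: csD => //; exact: csZ.
- exact: omega_ge0.
- by move=> A uA; rewrite rformDt rformZt; apply: h1 => //; exact: ltW.
- move=> P PP; have -> : S + t *: V - (T + t *: evolT b S T) = (S - T) + t *: (V - evolT b S T).
    by rewrite scalerBr opprD addrACA.
  by rewrite rotD rotZ pic_coefD pic_coefZ; apply: h2 => //; exact: ltW.
- by move=> P PP; rewrite rotD rotZ two_ricD; apply: h3 => //; exact: ltW.
- move=> P PP r r0 r1; rewrite !rotD !rotZ pinch_formD; apply: (h4 (P, r)); last exact: ltW.
  by split=> //=; rewrite in_itv /= r0.
Qed.

End Pair.

End Interior.

Section EllContinuity.
Local Open Scope classical_set_scope.
Local Open Scope ring_scope.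
Variables (R : realType) (n : nat).
Implicit Types (S T U V : tensor R n).

Lemma ell_linear (a b t : R) S V : ell a b (S + t *: V) = ell a b S + t *: ell a b V.
Proof.
apply: tensorP => i j k l; rewrite /ell scalD !(tcoefD, tcoefZ) !tcoef_kn !RicD; ring.
Qed.

Lemma ell0 (a b : R) : ell a b 0 = 0 :> tensor R n.
Proof.
by have := ell_linear a b (-1) 0 0; rewrite scaler0 addr0 scaleN1r subrr.
Qed.

Lemma ct_hamiltonQ S : curvature_tensor S -> curvature_tensor (hamiltonQ S).
Proof. by move=> ctS; split; [exact: cs_hamiltonQ ctS.1|exact: bianchi_hamiltonQ]. Qed.

Lemma ct_ell (a b : R) S : curvature_tensor S -> curvature_tensor (ell a b S).
Proof.
move=> ctS; have e : (Ric S)^T = Ric S by exact: Ric_sym ctS.1.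
by do 2?[apply: ctD] => //; apply: ctZ; apply: ct_kn; rewrite ?trmx1.
Qed.

Lemma continuous_ellinv (a b : R) : continuous (@ellinv R n a b).
Proof.
have ct i j k l : continuous (fun S : tensor R n => tcoef S i j k l) by exact: coord_continuous.
have cc (c : R) : continuous (fun _ : tensor R n => c) by exact: cst_continuous.
have cR i j : continuous (fun S : tensor R n => Ric S i j).
  by under eq_fun do rewrite mxE; apply: continuous_sumr.
have cs : continuous (fun S : tensor R n => scal S) by apply: continuous_sumr.
pose X (S : tensor R n) : 'M[R]_n := (b / (1 + (n%:R - 2) * b)) *: ric0 S + (a * (scal S / n%:R) / (1 + 2 * (n%:R - 1) * a)) *: 1%:M.
have cX i j : continuous (fun S => X S i j).
  pose c := b / (1 + (n%:R - 2) * b); pose d := a / (1 + 2 * (n%:R - 1) * a); pose e : R := (i == j)%:R.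
  rewrite (_ : (fun S => _) = fun S : tensor R n => c * (Ric S i j - scal S * (n%:R^-1 * e)) + scal S * (n%:R^-1 * d * e)); last first.
    apply/funext => S; rewrite /X ric0E; move: (Ric S) (scal S) => A u; rewrite !mxE /c /d /e; ring.
  apply: continuousDr; last by apply: continuousMr.
  apply: continuousMr => //; apply: continuousDr => //; apply: continuousNr; exact: continuousMr.
apply: continuous_mx => x y.
rewrite (_ : (fun S => _) = fun S : tensor R n => S x y - tcoef (kulkarni_nomizu (X S) 1%:M) (enum_val x).1 (enum_val x).2 (enum_val y).1 (enum_val y).2); last first.
  by apply/funext => S; rewrite /ellinv mxE [X in _ + X]mxE /tcoef -!surjective_pairing !enum_valK.
apply: continuousDr; first exact: coord_continuous.
apply: continuousNr; under eq_fun do rewrite tcoef_kn.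
apply: continuousDr; last by apply: continuousMr.
apply: continuousDr; last by apply: continuousNr; apply: continuousMr.
apply: continuousDr; last by apply: continuousNr; apply: continuousMr.
exact: continuousMr.
Qed.

End EllContinuity.

Theorem theorem3p2 (R : realType) (n : nat) (b : R) :
  (12 <= n)%N -> 0 < b -> b <= b_max R n ->
  transversally_invariant (@curvature_tensor R n) (@Ccone R n b)
    (@hamiltonQ R n).
Proof.
move=> n12 b0 bmax x [S [ctS [T pc]] <-] ell_neq0.
have hN := natr_ge12 R n12; have hNb := b_max_bound n12 bmax.
have n_gt0 : (0 < n)%N by apply: leq_trans n12.
have n_gt4 : (4 < n)%N by apply: leq_trans n12.
have a0 : 0 < a_of n b := param_a_gt0 hN b0 hNb.
have b1 : 1 + (n%:R - 2) * b != 0.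
  by rewrite gt_eqF // addr_gt0 // mulr_gt0 //; lra.
have a1 : 1 + 2 * (n%:R - 1) * a_of n b != 0.
  by rewrite gt_eqF // addr_gt0 // mulr_gt0 //; lra.
have s0 : 0 < scal S.
  by apply: (pair_cond_scal_gt0 n_gt4 ctS pc) => S0; apply: ell_neq0; rewrite S0 ell0.
have QE : hamiltonQ (ell (a_of n b) b S) = ell (a_of n b) b (evolS b S) by exact: hamiltonQ_ell.
split; first by apply: ct_hamiltonQ; exact: ct_ell.
have near_w : \forall w \near hamiltonQ (ell (a_of n b) b S),
  exists2 t, 0 < t & pair_cond b (S + t *: ellinv (a_of n b) b w) (T + t *: evolT b S T).
  have near_S' : \forall V \near ellinv (a_of n b) b (hamiltonQ (ell (a_of n b) b S)),
      exists2 t, 0 < t & pair_cond b (S + t *: V) (T + t *: evolT b S T).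
    by rewrite QE ellK //; exact: evol_interior.
  exact: (@continuous_ellinv R n (a_of n b) b _ _ near_S').
(* With V = [ellinv] w, the vector w is itself a multiple of ell (S + t V) - ell S. Since the
   interior is taken among curvature tensors, w is one, and hence so is S + t V. *)
apply: filterS near_w => w [t t0 pct] ctw; apply: subset_closure.
exists t^-1, (ell (a_of n b) b (S + t *: ellinv (a_of n b) b w)); split.
- by rewrite invr_ge0 ltW.
- exists (S + t *: ellinv (a_of n b) b w) => //; split; last by exists (T + t *: evolT b S T).
  by apply: ctD => //; apply: ctZ; exact: ct_ellinv.
- by rewrite ell_linear ellinvK // addrAC subrr add0r scalerA mulVf ?scale1r // gt_eqF.
Qed.
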